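(* Suppose $d\ge3$. Let $(\frac1q,\frac1p)$ belong to the closed line segment $[O,A]$, let $s$ be given by $2s=d-(\frac2p+\frac dq)$, and let $r>1$. Then the estimate $$\bigg\|\int_{\mathbb{R}^d}f(x-tv,v)\,\frac{dv}{|v|^{2s}}\bigg\|_{L^{p,\infty}_tL^{q,\infty}_x}\le C\|f\|_{L^{p,r}(\mathbb{R}^d\times\mathbb{R}^d)}\qquad\text{for all } f\in L^{p,r}(\mathbb{R}^d\times\mathbb{R}^d)$$ fails, i.e. it does not hold for any finite constant $C$. Consequently, the estimate $$\bigg\|\sum_j\lambda_j|e^{it\Delta}f_j|^2\bigg\|_{L^{p,\infty}_tL^{q,\infty}_x}\le C\|\lambda\|_{\ell^{p,r}}$$ for all orthonormal systems $(f_j)_j$ in $\dot H^s(\mathbb{R}^d)$ and all sequences $\lambda=(\lambda_j)_j\in\ell^{p,r}(\mathbb{C})$ also fails, i.e. it does not hold for any finite constant $C$.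
   Context: In the $(\frac1q,\frac1p)$-plane, $O=(0,0)$ and $A=(\frac{d-1}{d+1},\frac{d}{d+1})$; $[O,A]$ is the closed line segment joining them. $e^{it\Delta}$ is the Fourier multiplier with symbol $e^{-it|\xi|^2}$. $\dot H^s(\mathbb{R}^d)$ is the homogeneous Sobolev space with norm $\|f\|_{\dot H^s}=\||D|^sf\|_{L^2}$, $|D|=\sqrt{-\Delta}$; orthonormal systems in $\dot H^s$ are the families $(|D|^{-s}g_j)_j$ with $(g_j)_j$ orthonormal in $L^2(\mathbb{R}^d)$. Lorentz spaces: with $f^*$ the decreasing rearrangement of $f$, $\|f\|_{L^{p,r}}=\big(\int_0^\infty(\tau^{1/p}f^*(\tau))^r\frac{d\tau}{\tau}\big)^{1/r}$ for $p,r\in[1,\infty)$, and $\|f\|_{L^{p,\infty}}=\sup_{\tau>0}\tau^{1/p}f^*(\tau)$ for $p\in[1,\infty]$. For sequences $\lambda$, with $(\lambda^*_j)_j$ the decreasing permutation of $(|\lambda_j|)_j$, $\|\lambda\|_{\ell^{\alpha,r}}=\big(\sum_{j\ge1}(j^{1/\alpha}\lambda_j^* )^r\frac1j\big)^{1/r}$ for $\alpha,r\in[1,\infty)$, and $\|\lambda\|_{\ell^{\alpha,\infty}}=\sup_{j\ge1}j^{1/\alpha}\lambda_j^*$ for $\alpha\in[1,\infty]$. With first index $\infty$ only the second index $\infty$ is considered (so at the point $O$, where $p=\infty$, only $r=\infty$ is meant). $\|F\|_{L^{p,\infty}_tL^{q,\infty}_x}$ is the $L^{p,\infty}(\mathbb{R})$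 quasi-norm of $t\mapsto\|F(\cdot,t)\|_{L^{q,\infty}(\mathbb{R}^d)}$. *)

(* Defs.v *)
From HB Require Import structures.
From mathcomp Require Import all_boot all_order all_algebra.
From mathcomp Require Import all_classical all_reals all_analysis.
From mathcomp Require Import complex.

Set Implicit Arguments.
Unset Strict Implicit.
Unset Printing Implicit Defensive.

Import Order.TTheory GRing.Theory Num.Theory.
Import numFieldNormedType.Exports.
Import ComplexField.Normc.

Local Open Scope classical_set_scope.
Local Open Scope ring_scope.
Local Open Scope complex_scope.

Section euclidean_space.
Variable R : realType.

Definition euclid (d : nat) := d.-tuple (measurableTypeR R).

Definition consE (d : nat) (z : measurableTypeR R * euclid d) : euclid d.+1 :=
  [tuple of z.1 :: z.2].

(* Lebesgue measure on R^d: the d-fold product of Lebesgue measure on R,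
   transported to tuples. *)
Fixpoint lebesgueE (d : nat) : set (euclid d) -> \bar R :=
  match d with
  | 0 => dirac ([tuple] : euclid 0)
  | d'.+1 => pushforward (@lebesgue_measure R \x @lebesgueE d')%E (@consE d')
  end.

Lemma measurable_consE d :
  measurable_fun [set: measurableTypeR R * euclid d] (@consE d).
Proof. exact: measurable_cons. Qed.

Section step.
Variables (d : nat) (mu : {sigma_finite_measure set (euclid d) -> \bar R}).
Let nu : set (euclid d.+1) -> \bar R :=
  pushforward (@lebesgue_measure R \x mu)%E (@consE d).

Let nu0 : nu set0 = 0%E.
Proof. by rewrite /nu /pushforward preimage_set0 measure0. Qed.

Let nu_ge0 A : (0 <= nu A)%E.
Proof. by rewrite /nu /pushforward; apply: (@measure_ge0 _ _ _ (lebesgue_measure \x mu)%E). Qed.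

Let nu_sigma_additive : semi_sigma_additive nu.
Proof.
have mc A : measurable A -> measurable (@consE d @^-1` A).
  by move=> mA; rewrite -[X in measurable X]setTI; exact: measurable_consE.
move=> F mF tF mUF; rewrite /nu /pushforward preimage_bigcup.
apply: measure_semi_sigma_additive.
- by move=> n; exact: mc.
- apply/trivIsetP => /= i j _ _ ij; rewrite -preimage_setI.
  by move/trivIsetP : tF => /(_ _ _ _ _ ij) ->//; rewrite preimage_set0.
- by rewrite -preimage_bigcup; exact: mc.
Qed.

Let nu_sigma_finite : sigma_finite setT nu.
Proof.
pose h (x : euclid d.+1) : measurableTypeR R * euclid d :=
  (thead x, [tuple of behead x]).
have mh : measurable_fun setT h.
  apply: measurable_fun_pair; last exact: measurable_behead.
  exact: (@measurable_tnth _ (measurableTypeR R) d.+1 ord0).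
have /sigma_finiteP[F [TF ndF Foo]] := sigma_finiteT (@lebesgue_measure R).
have /sigma_finiteP[G [TG ndG Goo]] := sigma_finiteT mu.
exists (fun n => h @^-1` (F n `*` G n)).
  rewrite -preimage_bigcup; apply/esym; rewrite -[RHS](preimage_setT h).
  congr (_ @^-1` _); apply/seteqP; split => // -[x y] _.
  have [n _ Fnx] : (\bigcup_n F n) x by rewrite -TF.
  have [k _ Gky] : (\bigcup_n G n) y by rewrite -TG.
  exists (maxn n k) => //; split.
  - by move: x Fnx; exact/subsetPset/ndF/leq_maxl.
  - by move: y Gky; exact/subsetPset/ndG/leq_maxr.
move=> n; have [mF Fn] := Foo n; have [mG Gn] := Goo n; split.
  by rewrite -[X in measurable X]setTI; apply: mh => //; exact: measurableX.
rewrite /nu /pushforward -comp_preimage (_ : h \o _ = idfun); last first.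
  by apply/funext => -[a t]; rewrite /h/=; congr pair; exact: val_inj.
rewrite preimage_id product_measure1E// lte_mul_pinfty// ge0_fin_numE//.
Qed.

HB.instance Definition _ := isMeasure.Build _ _ _ nu nu0 nu_ge0 nu_sigma_additive.
HB.instance Definition _ := Measure_isSigmaFinite.Build _ _ _ nu nu_sigma_finite.

Lemma lebesgueE_step :
  exists nuM : {sigma_finite_measure set (euclid d.+1) -> \bar R}, nu = nuM.
Proof. by exists nu. Qed.

End step.

Lemma lebesgueE_sigma_finite_measure d :
  exists mu : {sigma_finite_measure set (euclid d) -> \bar R},
    @lebesgueE d = mu.
Proof.
elim: d => [|d [mu IH]] /=; first by exists (dirac ([tuple] : euclid 0)).
by rewrite IH; exact: lebesgueE_step.
Qed.

Section instances.
Variable d : nat.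

Let lebesgueE0 : @lebesgueE d set0 = 0%E.
Proof. by have [mu ->] := lebesgueE_sigma_finite_measure d. Qed.

Let lebesgueE_ge0 A : (0 <= @lebesgueE d A)%E.
Proof. by have [mu ->] := lebesgueE_sigma_finite_measure d. Qed.

Let lebesgueE_sigma_additive : semi_sigma_additive (@lebesgueE d).
Proof.
have [mu ->] := lebesgueE_sigma_finite_measure d.
exact: measure_semi_sigma_additive.
Qed.

Let lebesgueE_sigma_finite : sigma_finite setT (@lebesgueE d).
Proof.
by have [mu ->] := lebesgueE_sigma_finite_measure d; exact: sigma_finiteT.
Qed.

HB.instance Definition _ := isMeasure.Build _ _ _ (@lebesgueE d)
  lebesgueE0 lebesgueE_ge0 lebesgueE_sigma_additive.
HB.instance Definition _ := Measure_isSigmaFinite.Build _ _ _ (@lebesgueE d)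
  lebesgueE_sigma_finite.

End instances.

Definition dotE (d : nat) (x y : euclid d) : R :=
  \sum_(i < d) tnth x i * tnth y i.

Definition normE (d : nat) (x : euclid d) : R := Num.sqrt (dotE x x).

End euclidean_space.

Arguments lebesgueE {R} d _.

Section complex_valued.
Variable R : realType.
Context {disp : measure_display} {T : measurableType disp}.
Implicit Types (mu : {measure set T -> \bar R}) (f : T -> R[i]).

Definition cmeasurable f :=
  measurable_fun setT (fun x => complex.Re (f x)) /\
  measurable_fun setT (fun x => complex.Im (f x)).

Definition cintegrable mu f :=
  mu.-integrable setT (fun x => (complex.Re (f x))%:E) /\
  mu.-integrable setT (fun x => (complex.Im (f x))%:E).

Definition cintegral mu f : R[i] :=
  (\int[mu]_x complex.Re (f x)) +i* (\int[mu]_x complex.Im (f x)).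

(* |\int f dmu|, with value +oo when the integral does not converge absolutely;
   for f >= 0 this is the usual [0, +oo]-valued integral. *)
Definition abs_integral mu f : \bar R :=
  if `[< cintegrable mu f >] then (normc (cintegral mu f))%:E else +oo%E.

Definition square_integrable mu f :=
  cmeasurable f /\ (\int[mu]_x ((normc (f x)) ^+ 2)%:E < +oo)%E.

End complex_valued.

Section lorentz.
Variable R : realType.
Context {disp : measure_display} {T : measurableType disp}.
Variable mu : {measure set T -> \bar R}.
Implicit Types g : T -> \bar R.

Definition rearrangement g (tau : R) : \bar R :=
  ereal_inf [set a%:E | a in
    [set a : R | 0 <= a /\ (mu [set x | a%:E < g x] <= tau%:E)%E]].

(* The L^{p,r} quasi-norm of a function with modulus g; 1/oo = 0. *)
Definition lorentz (p r : \bar R) g : \bar R :=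
  let w tau := ((tau `^ fine p^-1)%:E * rearrangement g tau)%E in
  match r with
  | r'%:E => ((\int[lebesgue_measure]_(tau in `]0%R, +oo[)
                 (w tau `^ r' * (tau^-1)%:E)) `^ r'^-1)%E
  | _ => ereal_sup [set w tau | tau in `]0, +oo[]
  end.

End lorentz.

Section sequences.
Variable R : realType.

(* The (j+1)-st largest of the |lambda_k|; for a bounded sequence that does not
   tend to 0 no decreasing permutation need exist and this is its substitute. *)
Definition seq_rearrangement (lambda : nat -> R[i]) (j : nat) : \bar R :=
  rearrangement counting (fun k => (normc (lambda k))%:E) j%:R.

Definition seq_lorentz (alpha r : \bar R) (lambda : nat -> R[i]) : \bar R :=
  let w j := ((j.+1%:R `^ fine alpha^-1)%:E * seq_rearrangement lambda j)%E in
  match r with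
  | r'%:E => ((\sum_(0 <= j <oo) (w j `^ r' * (j.+1%:R^-1)%:E)) `^ r'^-1)%E
  | _ => ereal_sup (range w)
  end.

End sequences.

Section fourier.
Variables (R : realType) (d : nat).
Local Notation E := (euclid R d).
Local Notation leb := (@lebesgueE R d).
Implicit Types (f g h u : E -> R[i]).

Definition expi (theta : R) : R[i] := cos theta +i* sin theta.

Definition inv_fourier1 h (x : E) : R[i] :=
  ((2 * pi) ^- d)%:C * cintegral leb (fun xi => expi (dotE x xi) * h xi).

(* u is the inverse Fourier--Plancherel transform of h : the L^2 limit of the
   inverse transforms of the truncations of h to balls. *)
Definition is_inv_fourier2 h u :=
  [/\ square_integrable leb h, square_integrable leb u &
    (fun n : nat => \int[leb]_x
       ((normc (u x - inv_fourier1
          (fun xi => if normE xi <= n%:R then h xi else 0) x)) ^+ 2)%:E)%E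
      @ \oo --> 0%E].

(* h is the Fourier transform of u, h(xi) = \int u(x) e^{-i x.xi} dx, for h in
   L^1 + L^2. This class contains the Fourier transforms of all elements of the
   homogeneous Sobolev space of order s when 0 <= s < d/2, and for s = d/2 of
   those whose Fourier transform is locally integrable. *)
Definition is_fourier u h :=
  cmeasurable u /\
  exists h1 h2 u2 : E -> R[i],
    [/\ cintegrable leb h1, is_inv_fourier2 h2 u2,
        forall xi, h xi = h1 xi + h2 xi &
        {ae leb, forall x, u x = inv_fourier1 h1 x + u2 x}].

(* u = m(D) f, for the Fourier multiplier with symbol m. *)
Definition is_multiplier (m : E -> R[i]) f u :=
  exists2 h, is_fourier f h & is_fourier u (fun xi => m xi * h xi).

(* u = e^{it Delta} f *)
Definition is_schrodinger (t : R) :=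
  is_multiplier (fun xi => expi (- (t * normE xi ^+ 2))).

(* u = |D|^a f *)
Definition is_fractional (a : R) :=
  is_multiplier (fun xi => (normE xi `^ a)%:C).

Definition orthonormalL2 (g : nat -> E -> R[i]) :=
  (forall j, square_integrable leb (g j)) /\
  (forall j k, cintegral leb (fun x => g j x * (g k x)^*) = (j == k)%:R).

Definition orthonormalHs (s : R) (f : nat -> E -> R[i]) :=
  exists2 g, orthonormalL2 g & forall j, is_fractional (- s) (g j) (f j).

End fourier.

Section estimates.
Variables (R : realType) (d : nat).
Local Notation E := (euclid R d).
Local Notation leb := (@lebesgueE R d).

Definition mixed_weak_norm (p q : \bar R) (F : R -> E -> \bar R) : \bar R :=
  lorentz (@lebesgue_measure R) p +oo%E (fun t => lorentz leb q +oo%E (F t)).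

Definition transport (x v : E) (t : R) : E :=
  [tuple tnth x i - t * tnth v i | i < d].

Definition velocity_estimate (p q r : \bar R) (s C : R) :=
  forall f : E * E -> R[i], cmeasurable f ->
    (lorentz (leb \x leb)%E p r (fun z => (normc (f z))%:E) < +oo)%E ->
    (mixed_weak_norm p q (fun t x =>
       abs_integral leb
         (fun v => f (transport x v t, v) * (normE v `^ (- (2 * s)))%:C)%R)
     <= C%:E * lorentz (leb \x leb)%E p r (fun z => (normc (f z))%:E))%E.

(* The series in j is the integral over nat for the counting measure. *)
Definition orthonormal_estimate (p q r : \bar R) (s C : R) :=
  forall (f : nat -> E -> R[i]) (lambda : nat -> R[i])
         (u : nat -> R -> E -> R[i]),
    orthonormalHs s f ->
    (forall j t, is_schrodinger t (f j) (u j t)) ->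
    (seq_lorentz p r lambda < +oo)%E ->
    (mixed_weak_norm p q (fun t x =>
       abs_integral counting
         (fun j => lambda j * (normc (u j t x) ^+ 2)%:C)%R)
     <= C%:E * seq_lorentz p r lambda)%E.

End estimates.

Definition segment (R : realType) (P Q : R * R) : set (R * R) :=
  [set (1 - theta) *: P + theta *: Q | theta in `[0, 1]].

(* Main.v *)
Require Import Defs.
From HB Require Import structures.
From mathcomp Require Import all_boot all_order all_algebra.
From mathcomp Require Import all_classical all_reals all_analysis.
From mathcomp Require Import measurable_realfun complex ring lra zify.

Set Implicit Arguments.
Unset Strict Implicit.
Unset Printing Implicit Defensive.

Import Order.TTheory GRing.Theory Num.Theory.
Import numFieldNormedType.Exports.

Local Open Scope classical_set_scope.
Local Open Scope ring_scope.

(* Both estimates are refuted by superposing N dyadic scales which contribute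
   equally on the left-hand side near the origin, while the Lorentz norm on the
   right-hand side only grows like N^(1/r). Write alpha = 1/p; on the segment [O, A]
   one has (d + 1) alpha = d - 2s, and s >= 0.

   Velocity averages: at scale k let the velocities range over the cube
   [2^k, 2^(k+1)[^d, and let f = 2^(- k (d + 1) alpha) on the set of those (x, v)
   whose free trajectory passes near the origin at a time in [0, 1]. This set has
   measure O(2^(k (d + 1))), and for x and t in the unit cube and interval the
   velocity average of this piece is bounded below independently of k.

   Orthonormal systems: cut the frequency cubes [2^k, 2^(k+1)[^d into tiny cells of
   side 1/M. The inverse Fourier transforms of the indicators of distinct cells
   are orthogonal; group them into O(2^(k (d + 1))) classes according to the integer
   parts of xi and |xi|^2. For small x and t the phase x.xi - t |xi|^2 is nearly
   constant on a class, so that the evolution of the normalised sum of the waves of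
   a class is bounded below there, and the coefficient 2^(- k (d + 1) alpha) again
   makes the total contribution of each scale bounded below.

   Since r > 1, a lower bound c N is incompatible with C N^(1/r). *)

(** * Boxes in Euclidean space *)

(** Grouping makes the number of orthonormal functions match the measure of the tubes. One function
    per cell would give a left-hand side of the same order, but M^d 2^(k d) functions at scale k,
    with M of order 2^N, which is far too many. The squared evolution of a class of n cells is of
    order 2^(-2 s k) n M^(-d), additive in the cells, so merging costs nothing as long as the phase
    stays within one radian. For times of order one this asks for |xi|^2 up to an error of order
    one; over a unit cube at frequency 2^k it ranges over O(2^k) units, which is the extra factor in
    2^(k (d + 1)). A class is a union of boxes, rather than the exact set with prescribed integer
    parts, because the wave of a box factors over the coordinates: orthogonality then reduces to one
    explicit one-dimensional integral. The exponent d + 1 is the one for which weight, multiplier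
    and volume cancel on [O, A]. At O all weights are 1 and the growth exponent 1/r is read as 0. *)

Section monotonicity.
Context {R : realType}.

(** The integral of a nonnegative function is a supremum over the simple functions below it, and a
    larger function has more of them. Measurability is avoided because rearrangements and superlevel
    sets of arbitrary functions are integrated below. *)
Lemma ge0_le_integral_nonmeasurable d (T : measurableType d)
    (mu : {measure set T -> \bar R}) (D : set T) (f g : T -> \bar R) :
  (forall x, D x -> (0 <= f x)%E) -> (forall x, D x -> (f x <= g x)%E) ->
  (\int[mu]_(x in D) f x <= \int[mu]_(x in D) g x)%E.
Proof.
move=> f0 fg; rewrite !(integral_mkcond D).
have f0' x : (0 <= (f \_ D) x)%E by rewrite patchE; case: ifPn => // /set_mem/f0.
have fg' x : ((f \_ D) x <= (g \_ D) x)%E.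
  by rewrite !patchE; case: ifPn => // /set_mem/fg.
have g0' x : (0 <= (g \_ D) x)%E by apply: le_trans (fg' x).
rewrite !ge0_integralTE//; apply: le_ereal_sup => _ [h /= hf <-].
by exists h => //= x; apply: le_trans (hf x) (fg' x).
Qed.

Lemma le_lebesgue_measure (A B : set R) : A `<=` B ->
  (@lebesgue_measure R A <= lebesgue_measure B)%E.
Proof. by move=> AB; apply: le_outer_measure. Qed.

(** Product measure is the integral of the measures of the sections, so monotonicity passes through
    the induction for arbitrary sets. The superlevel sets in the mixed norm are of this kind. *)
Lemma le_lebesgueE d (A B : set (euclid R d)) : A `<=` B ->
  (lebesgueE d A <= lebesgueE d B)%E.
Proof.
elim: d A B => [|d IH] A B AB /=.
  rewrite !diracE lee_fin ler_nat; case: (boolP (_ \in A)) => //= /set_mem/AB.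
  by move=> /mem_set ->.
rewrite /pushforward /product_measure1; apply: ge0_le_integral_nonmeasurable => //.
by move=> x _; apply: IH => y; rewrite /xsection /= !inE; apply: AB.
Qed.

(** The sides are indexed by [nat], so that in an induction on [d] the remaining sides are simply
    [A \o S]. *)
Definition boxE d (A : nat -> set R) : set (euclid R d) :=
  [set x | forall i : 'I_d, A i (tnth x i)].
Arguments boxE d A : clear implicits.

Lemma boxE0 A : boxE 0 A = setT.
Proof. by apply/seteqP; split => // x _ []. Qed.

Lemma preimage_consE_boxE d A :
  @consE R d @^-1` boxE d.+1 A = A 0%N `*` boxE d (A \o S).
Proof.
apply/seteqP; split => -[a x] /= Ax.
  split; first by have := Ax ord0; rewrite tnth0.
  by move=> i; have := Ax (lift ord0 i); rewrite tnthS.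
by move=> i; have [j ->|->] := unliftP ord0 i; rewrite ?tnthS ?tnth0; apply Ax.
Qed.

Lemma measurable_boxE d (A : nat -> set R) :
  (forall i, measurable (A i : set (measurableTypeR R))) -> measurable (boxE d A).
Proof.
move=> mA.
rewrite (_ : boxE d A = \bigcap_(i in [set: 'I_d]) ((fun x => tnth x i) @^-1` A i)).
  apply: fin_bigcap_measurable => // i _; rewrite -[X in measurable X]setTI.
  exact: measurable_tnth.
by apply/seteqP; split => x Ax i; [move=> _|]; exact: Ax.
Qed.

Lemma lebesgueE_boxE d (A : nat -> set R) :
  (forall i, measurable (A i : set (measurableTypeR R))) ->
  lebesgueE d (boxE d A) = (\prod_(i < d) @lebesgue_measure R (A i))%E.
Proof.
elim: d A => [|d IH] A mA; first by rewrite big_ord0 boxE0 /= diracT.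
rewrite /= /pushforward preimage_consE_boxE big_ord_recl product_measure1E//.
  congr (_ * _)%E.
  by apply: (IH (A \o S)) => i; exact: mA.
by apply: measurable_boxE => i; exact: mA.
Qed.

(** The endpoint flags [p] and [q] are free because both closed cubes and half-open grid cells
    occur. *)
Lemma lebesgueE_cube d (a b : nat -> R) (l : R) : (forall i, b i - a i = l) ->
  0 <= l -> forall p q : bool,
  lebesgueE d (boxE d (fun i => [set` Interval (BSide p (a i)) (BSide q (b i))])) =
    (l ^+ d)%:E.
Proof.
move=> ba l0 p q; rewrite lebesgueE_boxE//.
elim: d => [|d IH]; first by rewrite big_ord0.
rewrite big_ord_recr/= IH lebesgue_measure_itv/= exprSr EFinM; congr (_ * _)%E.
have := ba d; have [->|l0'] := eqVneq l 0; move=> badl.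
  by case: ifP => // _; rewrite -EFinB badl.
have lt0l : 0 < l by rewrite lt_neqAle eq_sym l0'.
rewrite ifT ?badl// -?EFinB ?badl//.
by rewrite lte_fin -subr_gt0 badl.
Qed.

End monotonicity.
Arguments boxE {R} d A.

(** * Lower bounds for weak Lorentz quasi-norms *)

Section rearrangement_bounds.
Context {R : realType} {disp : measure_display} {T : measurableType disp}.
Variable mu : {measure set T -> \bar R}.
Implicit Types g : T -> \bar R.

Lemma rearrangement_ge0 g tau : (0 <= rearrangement mu g tau)%E.
Proof. by apply: le_ereal_inf_tmp => _ [a [a0 _] <-]; rewrite lee_fin. Qed.

Lemma rearrangement_le g (tau a : R) : 0 <= a ->
  (mu [set x | a%:E < g x] <= tau%:E)%E -> (rearrangement mu g tau <= a%:E)%E.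
Proof. by move=> a0 ha; apply: ereal_inf_lbound; exists a. Qed.

Lemma rearrangement_ge g (tau b : R) :
  (forall a : R, 0 <= a -> a < b -> (tau%:E < mu [set x | (a%:E < g x)%E])%E) ->
  (b%:E <= rearrangement mu g tau)%E.
Proof.
move=> h; apply: le_ereal_inf_tmp => _ [a [a0 ha] <-]; rewrite lee_fin leNgt.
by apply/negP => /(h _ a0); rewrite ltNge ha.
Qed.

Lemma weak_lorentz_ge p g (tau b : R) : 0 < tau ->
  (b%:E <= rearrangement mu g tau)%E ->
  ((tau `^ fine p^-1 * b)%:E <= lorentz mu p +oo%E g)%E.
Proof.
move=> tau0 h; apply: (@le_trans _ _ ((tau `^ fine p^-1)%:E * rearrangement mu g tau)%E).
  by rewrite EFinM lee_wpmul2l// lee_fin powR_ge0.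
by apply: ereal_sup_ubound; exists tau => //=; rewrite in_itv/= tau0.
Qed.

End rearrangement_bounds.

(** Both weak quasi-norms are tested at half the measure of the box on which [F] is large: a
    rearrangement is bounded below at [tau] only if the superlevel sets have measure strictly above
    [tau]. *)
Lemma mixed_weak_norm_ge (R : realType) d p q (F : R -> euclid R d -> \bar R)
    (e b : R) : 0 < e ->
  (forall t x, 0 <= t <= e -> (forall i, 0 <= tnth x i <= e) -> (b%:E <= F t x)%E) ->
  (((e / 2) `^ fine p^-1 * ((e ^+ d / 2) `^ fine q^-1 * b))%:E <=
     mixed_weak_norm p q F)%E.
Proof.
move=> e0 hF; have ed0 : 0 < e ^+ d by rewrite exprn_gt0.
apply: weak_lorentz_ge; first by rewrite divr_gt0.
apply: rearrangement_ge => a a0 ab.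
apply: (@lt_le_trans _ _ (lebesgue_measure (`[0, e]%classic : set R))).
  by rewrite lebesgue_measure_itv/= lte_fin e0 sube0 lte_fin; lra.
apply: le_lebesgue_measure => t /=; rewrite in_itv/= => t0e.
have a_lt : (a%:E < ((e ^+ d / 2) `^ fine q^-1 * b)%:E)%E by rewrite lte_fin.
apply: lt_le_trans a_lt _; apply: weak_lorentz_ge; first by rewrite divr_gt0.
apply: rearrangement_ge => a' a'0 a'b.
apply: (@lt_le_trans _ _ (lebesgueE d (boxE d (fun=> `[0, e]%classic)))).
  by rewrite (@lebesgueE_cube _ _ (fun=> 0) (fun=> e) e) ?subr0// ?lte_fin; [lra|exact: ltW].
apply: le_lebesgueE => x hx /=; apply: lt_le_trans (hF t x _ _) => //.
Qed.

(** * Lorentz quasi-norms of dyadically layered functions *)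

Section distribution_bound.
Context {R : realType} {disp : measure_display} {T : measurableType disp}.
Variable mu : {measure set T -> \bar R}.
Implicit Types g : T -> \bar R.

(* The distribution function of g is at most that of a function which takes the
   value B^{-k alpha} on a set of measure C0 B^k, for each k < N. *)
Definition distribution_bound (alpha B C0 : R) (N : nat) g :=
  [/\ forall x, (g x <= 1)%E,
      forall k, (k < N)%N ->
        (mu [set x | ((B ^+ k) `^ (- alpha))%:E < g x] <= (C0 * B ^+ k)%:E)%E &
      (mu [set x | 0 < g x] <= (C0 * B ^+ N)%:E)%E].

Variables (alpha B C0 : R) (N : nat) (g : T -> \bar R).
Hypotheses (alpha0 : 0 <= alpha) (B1 : 1 < B) (C01 : 1 <= C0).
Hypothesis gB : distribution_bound alpha B C0 N g.

Let B0 : 0 < B. Proof. by apply: lt_trans B1. Qed.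
Let C00 : 0 < C0. Proof. by apply: lt_le_trans C01. Qed.

Lemma rearrangement_le1 tau : 0 <= tau -> (rearrangement mu g tau <= 1)%E.
Proof.
move=> tau0; apply: rearrangement_le => //.
rewrite (_ : [set x | _] = set0) ?measure0 ?lee_fin//.
by apply/seteqP; split => // x /=; rewrite ltNge; case: gB => ->.
Qed.

Lemma rearrangement_eq0 tau : C0 * B ^+ N <= tau -> rearrangement mu g tau = 0%E.
Proof.
move=> tauC; apply/eqP; rewrite eq_le rearrangement_ge0 andbT.
apply: rearrangement_le => //; apply: (@le_trans _ _ (C0 * B ^+ N)%:E).
  by case: gB.
by rewrite lee_fin.
Qed.

Lemma exists_scale tau n : C0 <= tau -> tau < C0 * B ^+ n ->
  exists2 k, (k < n)%N & C0 * B ^+ k <= tau < C0 * B ^+ k.+1.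
Proof.
move=> Ct; elim: n => [|n IH]; first by rewrite expr0 mulr1 ltNge Ct.
move=> tn; case: (ltP tau (C0 * B ^+ n)) => [/IH[k kn h]|h].
  by exists k => //; rewrite ltnS ltnW.
by exists n => //; rewrite h tn.
Qed.

(** For tau between C0 B^k and C0 B^(k+1) the rearrangement is at most B^(-k alpha), and the two
    powers compensate up to (C0 B)^alpha. Below C0 the bound [g <= 1] suffices; beyond C0 B^N the
    rearrangement vanishes. The bound is independent of [N]. *)
Lemma weighted_rearrangement_le tau : 0 < tau ->
  ((tau `^ alpha)%:E * rearrangement mu g tau <= ((C0 * B) `^ alpha)%:E)%E.
Proof.
move=> tau0; have C0B : C0 <= C0 * B by rewrite ler_peMr// ltW.
have [tC|Ct] := ltP tau C0.
  apply: (@le_trans _ _ ((tau `^ alpha)%:E * 1)%E).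
    by rewrite lee_wpmul2l ?lee_fin ?powR_ge0// rearrangement_le1// ltW.
  rewrite mule1 lee_fin ge0_ler_powR// ?nnegrE ?(ltW tau0)//.
    by rewrite mulr_ge0// ltW.
  by apply: le_trans C0B; exact: ltW.
have [tC|tC] := ltP tau (C0 * B ^+ N); last first.
  by rewrite rearrangement_eq0// mule0 lee_fin powR_ge0.
have [k kN /andP[kt tk]] := exists_scale Ct tC.
apply: (@le_trans _ _ ((tau `^ alpha)%:E * ((B ^+ k) `^ (- alpha))%:E)%E).
  rewrite lee_wpmul2l ?lee_fin ?powR_ge0//; apply: rearrangement_le.
    exact: powR_ge0.
  by have [_ /(_ _ kN) h _] := gB; apply: le_trans h _; rewrite lee_fin.
have Bk : 0 < B ^+ k by rewrite exprn_gt0.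
rewrite -EFinM lee_fin powRN ler_pdivrMr ?powR_gt0// -powRM; last 2 first.
  by rewrite ltW// mulr_gt0.
  exact: ltW.
rewrite ge0_ler_powR// ?nnegrE; last 2 first.
  by rewrite ltW// !mulr_gt0.
  by rewrite -mulrA -exprS; exact: ltW.
exact: ltW.
Qed.

Lemma le1_scale_powR : 1 <= (C0 * B) `^ alpha.
Proof.
have C0B1 : 1 <= C0 * B by rewrite -[1]mulr1 ler_pM// ltW.
apply: (@le_trans _ _ (1 `^ alpha)); first by rewrite powR1.
by apply: ge0_ler_powR; rewrite // nnegrE ltW// mulr_gt0.
Qed.

End distribution_bound.

Lemma ge0_nneseries_le (R : realType) (u : nat -> \bar R) M :
  (forall j, (0 <= u j)%E) -> (forall n, (\sum_(0 <= j < n) u j <= M)%E) ->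
  (\sum_(0 <= j <oo) u j <= M)%E.
Proof.
move=> u0 h; apply: lime_le; first exact: is_cvg_nneseries.
by apply: nearW => n; exact: h.
Qed.

Section layered_sum.
Context {R : realType}.
Variables (K A rho : R) (N : nat).
Hypotheses (K0 : 0 <= K) (A0 : 0 <= A) (rho0 : 0 <= rho) (rho1 : rho < 1).

(** Bound for (tau^alpha g^*(tau))^r on the j-th cell, counted downwards from the top of the support
    of the rearrangement: constant on [N] cells, then geometric where tau < C0 and only [g <= 1] is
    available. *)
Definition layer j : R := if (j < N)%N then K else A * rho ^+ (j - N).

Lemma layer_ge0 j : 0 <= layer j.
Proof. by rewrite /layer; case: ifP => // _; rewrite mulr_ge0// exprn_ge0. Qed.

Lemma sum_layer n : \sum_(0 <= j < n) layer j <= N%:R * K + A / (1 - rho).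
Proof.
have r1 : 0 < 1 - rho by rewrite subr_gt0.
(* The induction runs on the exact partial sum, with [minn n N] constant and [n - N] geometric
   terms; the truncated subtraction gives no geometric term while n <= N. *)
apply: (@le_trans _ _ ((minn n N)%:R * K + A * (1 - rho ^+ (n - N)) / (1 - rho))).
  elim: n => [|n IH].
    by rewrite big_nil min0n sub0n expr0 mul0r subrr mulr0 mul0r add0r.
  rewrite big_nat_recr//=; apply: le_trans (lerD IH (lexx _)) _.
  rewrite /layer; case: (boolP (n < N)%N) => nN.
    rewrite (minn_idPl (ltnW nN)) (minn_idPl nN).
    have -> : (n - N = 0)%N by apply/eqP; rewrite subn_eq0 ltnW.
    have -> : (n.+1 - N = 0)%N by apply/eqP; rewrite subn_eq0.
    by rewrite -natr1; lra.
  rewrite -leqNgt in nN; rewrite (minn_idPr nN) (minn_idPr (leqW nN)) subSn// exprS.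
  rewrite le_eqVlt; apply/orP; left; apply/eqP; field; exact: lt0r_neq0.
apply: lerD; first by rewrite ler_wpM2r// ler_nat geq_minr.
rewrite ler_pM2r ?invr_gt0// -[leRHS]mulr1 ler_wpM2l//.
by rewrite lerBlDr lerDl exprn_ge0.
Qed.

End layered_sum.

Section lorentz_bound.
Context {R : realType} {disp : measure_display} {T : measurableType disp}.
Variable mu : {measure set T -> \bar R}.
Variables (p : \bar R) (B C0 : R) (N : nat) (g : T -> \bar R).
Let alpha := fine p^-1.
Hypotheses (alpha0 : 0 <= alpha) (B1 : 1 < B) (C01 : 1 <= C0).
Hypothesis gB : distribution_bound mu alpha B C0 N g.

Let B0 : 0 < B. Proof. by apply: lt_trans B1. Qed.
Let C00 : 0 < C0. Proof. by apply: lt_le_trans C01. Qed.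

Lemma weak_lorentz_le :
  (lorentz mu p +oo%E g <= ((C0 * B) `^ alpha)%:E)%E.
Proof.
apply: ge_ereal_sup => _ [tau tau0 <-]; rewrite /= in_itv/= andbT in tau0.
exact: weighted_rearrangement_le gB _ _.
Qed.

(** Geometric cells tiling ]0, C0 B^N[. Numbering them downwards lets a series over [nat] exhaust
    the neighbourhood of 0. *)
Let cell (j : nat) : set R :=
  `[C0 * B ^+ N * B ^- j.+1, C0 * B ^+ N * B ^- j[%classic.

Let exists_cell tau : 0 < tau -> tau < C0 * B ^+ N -> exists j, cell j tau.
Proof.
move=> t0 tC.
have CB0 : 0 < C0 * B ^+ N by rewrite mulr_gt0// exprn_gt0.
have ex : exists j, C0 * B ^+ N * B ^- j.+1 <= tau.
  have q1 : 1 < C0 * B ^+ N / tau by rewrite ltr_pdivlMr// mul1r.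
  have [j hj] : exists j, C0 * B ^+ N / tau <= B ^+ j.
    have := @cvg_expr R B^-1.
    rewrite ger0_norm ?invr_ge0 ?ltW// invf_lt1// => /(_ B1) h.
    have /cvgrPdist_lt /(_ (tau / (C0 * B ^+ N))) := h.
    move=> /(_ _)[|n _ /(_ n (leqnn n))]; first by rewrite divr_gt0.
    rewrite sub0r normrN ger0_norm ?exprn_ge0 ?invr_ge0 ?ltW// => hn.
    exists n; rewrite ler_pdivrMr//.
    move: hn; rewrite ltr_pdivlMr// exprVn ltr_pdivrMl ?exprn_gt0//.
    exact: ltW.
  exists j; rewrite ler_pdivrMr ?exprn_gt0//.
  rewrite ler_pdivrMr// in hj; apply: le_trans hj _; rewrite mulrC ler_pM2l//.
  by rewrite exprS ler_peMl ?exprn_ge0 ?ltW.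
have [j hj hmin] := ex_minnP ex; exists j; rewrite /cell/= in_itv/= hj/=.
case: j hj hmin => [|j] hj hmin; first by rewrite expr0 invr1 mulr1.
by rewrite ltNge; apply/negP => /hmin; rewrite ltnn.
Qed.

(** The integrand is dominated on each cell by a constant: [layer] over the left endpoint. Since a
    cell is B - 1 times as long as its left endpoint, it contributes (B - 1) times its layer, and
    the layers sum to O(N). Positivity of alpha gives rho = B^(-alpha r) < 1, hence convergence near
    tau = 0. *)
Lemma lorentz_le (r : R) : 0 < alpha -> 1 < r -> (0 < N)%N ->
  (lorentz mu p r%:E g <=
    (((B - 1) * (((C0 * B) `^ alpha) `^ r +
         (C0 `^ alpha) `^ r / (1 - ((B `^ alpha) `^ r)^-1))) `^ r^-1
      * N%:R `^ r^-1)%:E)%E.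
Proof.
move=> a0 r1 N0.
have r0 : 0 < r by apply: lt_trans r1.
set K := ((C0 * B) `^ alpha) `^ r; set A := (C0 `^ alpha) `^ r.
set rho := ((B `^ alpha) `^ r)^-1.
have K0 : 0 <= K by exact: powR_ge0.
have A0 : 0 <= A by exact: powR_ge0.
have rho0 : 0 <= rho by rewrite invr_ge0 powR_ge0.
have rho1 : rho < 1.
  rewrite invf_lt1; last by rewrite !powR_gt0.
  rewrite -(powRrM B alpha r).
  apply: (@le_lt_trans _ _ (1 `^ (alpha * r))); first by rewrite powR1.
  by apply: gt0_ltr_powR; rewrite ?nnegrE ?mulr_gt0// ltW.
have Bn0 n : 0 < B ^+ n by rewrite exprn_gt0.
pose W := layer K A rho N.
have W0 j : 0 <= W j by exact: layer_ge0.
pose c j : R := W j / (C0 * B ^+ N * B ^- j.+1).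
have cell0 j : 0 < C0 * B ^+ N * B ^- j.+1.
  by rewrite mulr_gt0 ?invr_gt0// mulr_gt0.
have c0 j : 0 <= c j by rewrite mulr_ge0// invr_ge0 ltW.
pose w (tau : R) : \bar R := (((tau `^ alpha)%:E * rearrangement mu g tau) `^ r * (tau^-1)%:E)%E.
have wle tau : 0 < tau -> (w tau <= \sum_(0 <= j <oo) (c j * \1_(cell j) tau)%:E)%E.
  move=> tau0; have [tC|tC] := ltP tau (C0 * B ^+ N); last first.
    rewrite /w (rearrangement_eq0 gB tC) mule0 poweR0r ?gt_eqF// mul0e.
    by apply: nneseries_ge0 => j _ _; rewrite lee_fin mulr_ge0.
  have [j jtau] := exists_cell tau0 tC.
  apply: (@le_trans _ _ (c j)%:E); last first.
    apply: (@le_trans _ _ (\sum_(0 <= i < j.+1) (c i * \1_(cell i) tau)%:E)%E).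
      rewrite big_nat_recr//= indicE mem_set// mulr1 leeDr// sume_ge0// => i _.
      by rewrite lee_fin mulr_ge0.
    by apply: nneseries_lim_ge => i _ _; rewrite lee_fin mulr_ge0.
  rewrite /c EFinM; apply: lee_pmul; first exact: poweR_ge0.
  - by rewrite lee_fin invr_ge0 ltW.
  - have x0 : (0 <= (tau `^ alpha)%:E * rearrangement mu g tau)%E.
      by rewrite mule_ge0 ?lee_fin ?powR_ge0// rearrangement_ge0.
    rewrite /W /layer; case: ltnP => jN.
      apply: (@le_trans _ _ (((C0 * B) `^ alpha)%:E `^ r)%E);
      last by rewrite poweR_EFin lexx.
      apply: gt0_ler_poweR; rewrite ?in_itv/= ?x0 ?leey ?lee_fin ?powR_ge0//.
        exact: ltW.
      exact: weighted_rearrangement_le gB _ _.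
    (* For j >= N the right endpoint of the cell is C0 B^(-(j - N)), whose power is exactly the
       geometric layer. *)
    have hB : (C0 `^ alpha) `^ r * rho ^+ (j - N) =
        ((C0 * B ^+ N * B ^- j) `^ alpha) `^ r.
      have -> : C0 * B ^+ N * B ^- j = C0 * (B ^+ (j - N))^-1.
        rewrite -{1}(subnK jN) exprD invfM -!mulrA; congr (_ * _).
        by rewrite mulrCA mulfV ?mulr1 ?gt_eqF.
      rewrite powRM ?ltW ?invr_gt0// powRM ?powR_ge0//; congr (_ * _).
      rewrite /rho exprVn -(powR_mulrn _ (powR_ge0 _ _)) -powR_mulrn; last exact: ltW.
      rewrite -!powRN -(powRrM B) -(powRrM _ alpha) -(powRrM B) -(powRrM B).
      by congr (B `^ _); rewrite mulrN mulNr mulrC mulrA.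
    rewrite /A hB.
    apply: (@le_trans _ _ (((C0 * B ^+ N * B ^- j) `^ alpha)%:E `^ r)%E);
      last by rewrite poweR_EFin lexx.
    apply: gt0_ler_poweR; rewrite ?in_itv/= ?x0 ?leey ?lee_fin ?powR_ge0//.
      exact: ltW.
    apply: (@le_trans _ _ ((tau `^ alpha)%:E * 1)%E).
      by rewrite lee_wpmul2l ?lee_fin ?powR_ge0// (rearrangement_le1 gB)// ltW.
    rewrite mule1 lee_fin ge0_ler_powR// ?nnegrE ?(ltW tau0)//.
      by rewrite ltW// mulr_gt0 ?invr_gt0// mulr_gt0.
    by move: jtau; rewrite /cell/= in_itv/= => /andP[_ /ltW].
  - rewrite lee_fin lef_pV2 ?posrE//.
    by move: jtau; rewrite /cell/= in_itv/= => /andP[].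
have mcell j : measurable_fun (`]0%R, +oo[%classic : set (measurableTypeR R))
    (EFin \o (fun tau : R => c j * \1_(cell j) tau)).
  apply/measurable_EFinP; apply: measurable_funM => //.
  by apply: measurable_indic; exact: measurable_itv.
have intw : (\int[lebesgue_measure]_(tau in `]0%R, +oo[) w tau <=
    ((B - 1) * (K + A / (1 - rho)) * N%:R)%:E)%E.
  apply: (@le_trans _ _ (\int[lebesgue_measure]_(tau in `]0%R, +oo[)
      (\sum_(0 <= j <oo) (c j * \1_(cell j) tau)%:E))%E).
    apply: ge0_le_integral_nonmeasurable => tau /=; rewrite in_itv/= andbT => tau0.
      by rewrite mule_ge0 ?poweR_ge0// lee_fin invr_ge0 ltW.
    exact: wle.
  rewrite integral_nneseries//; last first.
    by move=> j tau _; rewrite lee_fin mulr_ge0.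
  apply: ge0_nneseries_le => [j|n].
    by apply: integral_ge0 => tau _; rewrite lee_fin mulr_ge0.
  have -> : (\sum_(0 <= j < n) (\int[lebesgue_measure]_(tau in `]0%R, +oo[)
     (c j * \1_(cell j) tau)%:E) = \sum_(0 <= j < n) ((B - 1) * W j)%:E)%E.
    apply: eq_bigr => j _.
    under eq_integral do rewrite EFinM.
    rewrite ge0_integralZl//; last 2 first.
      - by apply/measurable_EFinP/measurable_indic; exact: measurable_itv.
      - by rewrite lee_fin.
    rewrite integral_indic//; last exact: measurable_itv.
    rewrite (_ : cell j `&` _ = cell j); last first.
      apply/setIidPl => tau; rewrite /cell/= !in_itv/= andbT => /andP[h _].
      by apply: lt_le_trans h.
    rewrite /cell /= lebesgue_measure_itv/= lte_fin.
    have BjS : C0 * B ^+ N * B ^- j = C0 * B ^+ N * B ^- j.+1 * B.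
      by rewrite exprS; field; rewrite !gt_eqF.
    rewrite BjS ltr_pMr// B1 -EFinB -EFinM; congr EFin.
    by rewrite /c; field; rewrite !gt_eqF.
  rewrite sumEFin lee_fin -mulr_sumr -mulrA; apply: ler_wpM2l.
    by rewrite subr_ge0 ltW.
  apply: le_trans (sum_layer N K0 A0 rho0 rho1 n) _.
  have Ar : 0 <= A / (1 - rho) by rewrite divr_ge0// subr_ge0 ltW.
  (* As N >= 1, the geometric tail is absorbed into the factor [N]. *)
  have N1 : 1 <= N%:R :> R by rewrite ler1n.
  by rewrite mulrDl [N%:R * _]mulrC lerD2l ler_peMr.
have S0 : 0 <= (B - 1) * (K + A / (1 - rho)).
  apply: mulr_ge0; first by rewrite subr_ge0 ltW.
  by apply: (addr_ge0 K0 (divr_ge0 A0 _)); rewrite subr_ge0 ltW.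
rewrite -powRM//.
apply: (@le_trans _ _ (((B - 1) * (K + A / (1 - rho)) * N%:R)%:E `^ r^-1)%E);
  last by rewrite poweR_EFin lexx.
apply: gt0_ler_poweR; rewrite ?invr_ge0 ?(ltW r0)// in_itv/= leey andbT.
  apply: integral_ge0 => tau; rewrite /= in_itv/= andbT => tau0.
  by rewrite mule_ge0 ?poweR_ge0// lee_fin invr_ge0 ltW.
by rewrite lee_fin mulr_ge0.
Qed.

End lorentz_bound.

(** Each doubling of the range adds 2^m terms, none larger than 2^(-m). This is the discrete form of
    the logarithmic measure of a dyadic range. *)
Lemma harmonic_dyadic (R : realType) m :
  \sum_(0 <= j < 2 ^ m) (j.+1%:R^-1 : R) <= m.+1%:R.
Proof.
elim: m => [|m IH]; first by rewrite expn0 big_nat1 invr1.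
rewrite (@big_cat_nat _ _ _ (2 ^ m)%N)//=; last by rewrite leq_exp2l.
rewrite -[m.+2%:R]natr1; apply: lerD => //.
apply: (@le_trans _ _ (\sum_(2 ^ m <= j < 2 ^ m.+1) ((2 ^ m)%:R^-1 : R))).
  rewrite !big_nat; apply: ler_sum => j /andP[mj _].
  by rewrite lef_pV2 ?posrE ?ltr0n ?expn_gt0// ler_nat ltnW.
by rewrite sumr_const_nat expnS mul2n -addnn addnK -[leLHS]mulr_natr mulVf// pnatr_eq0 expn_eq0.
Qed.

(** * Lorentz quasi-norms of sequences *)

Section seq_lorentz_bound.
Context {R : realType}.
Variables (p : \bar R) (B C0 : R) (N : nat) (lambda : nat -> R[i]).
Let alpha := fine p^-1.
Let g (k : nat) : \bar R := (ComplexField.Normc.normc (lambda k))%:E.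
Hypotheses (alpha0 : 0 <= alpha) (B1 : 1 < B) (C01 : 1 <= C0).
Hypothesis gB : distribution_bound counting alpha B C0 N g.

Let B0 : 0 < B. Proof. by apply: lt_trans B1. Qed.
Let C00 : 0 < C0. Proof. by apply: lt_le_trans C01. Qed.

(** The weight has base j + 1 while the rearrangement is taken at j. For j >= 1 the inequality j + 1
    <= 2 j costs the factor 2^alpha; for j = 0 only [g <= 1] is used. *)
Lemma seq_weight_le j :
  ((j.+1%:R `^ alpha)%:E * seq_rearrangement lambda j <=
     (2 `^ alpha * (C0 * B) `^ alpha)%:E)%E.
Proof.
case: j => [|j].
  rewrite powR1 mul1e; apply: le_trans (rearrangement_le1 gB _) _ => //.
  have p2 : 1 <= 2 `^ alpha :> R.
    by rewrite -[2]mul1r; apply: le1_scale_powR => //; rewrite ltr1n.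
  rewrite lee_fin -[leLHS]mulr1; apply: ler_pM => //.
  exact: le1_scale_powR.
apply: (@le_trans _ _ ((2 `^ alpha)%:E * ((j.+1%:R `^ alpha)%:E * seq_rearrangement lambda j.+1))%E).
  rewrite muleA -EFinM; apply: lee_wpmul2r; first exact: rearrangement_ge0.
  rewrite lee_fin -powRM// ge0_ler_powR// ?nnegrE ?mulr_ge0//.
  by rewrite -natrM ler_nat; lia.
rewrite EFinM lee_wpmul2l ?lee_fin ?powR_ge0//.
exact: weighted_rearrangement_le gB _ _.
Qed.

Lemma weak_seq_lorentz_le :
  (seq_lorentz p +oo%E lambda <= (2 `^ alpha * (C0 * B) `^ alpha)%:E)%E.
Proof. by apply: ge_ereal_sup => _ [j _ <-]; exact: seq_weight_le. Qed.

(** Terms vanish from the index C0 B^N <= 2^(c + b N) on, and the earlier ones are at most a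
    constant over j + 1. The harmonic sum up to there is at most c + b N + 1, hence O(N). *)
Lemma seq_lorentz_le (r : R) (b c : nat) :
  1 < r -> (0 < N)%N -> B <= (2 ^ b)%:R -> C0 <= (2 ^ c)%:R ->
  (seq_lorentz p r%:E lambda <=
    (((2 `^ alpha * (C0 * B) `^ alpha) `^ r * (b + c).+1%:R) `^ r^-1
      * N%:R `^ r^-1)%:E)%E.
Proof.
move=> r1 N0 Bb Cc.
have r0 : 0 < r by apply: lt_trans r1.
have bcN : ((c + b * N).+1 <= (b + c).+1 * N)%N.
  by clear -N0; have := leq_pmulr c N0; lia.
set K := 2 `^ alpha * (C0 * B) `^ alpha.
have K0 : 0 <= K by rewrite mulr_ge0 ?powR_ge0.
pose w j : \bar R := ((j.+1%:R `^ alpha)%:E * seq_rearrangement lambda j)%E.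
have w0 j : (0 <= w j)%E by rewrite mule_ge0 ?lee_fin ?powR_ge0// rearrangement_ge0.
have t0 j : (0 <= w j `^ r * (j.+1%:R^-1)%:E)%E by rewrite mule_ge0 ?poweR_ge0.
have M2 : C0 * B ^+ N <= (2 ^ (c + b * N))%:R.
  rewrite expnD natrM expnM [X in _ <= _ * X]natrX; apply: ler_pM => //.
  - exact: ltW.
  - by rewrite exprn_ge0 ?ltW.
  - by rewrite lerXn2r ?nnegrE// ltW.
have wK j : (w j `^ r * (j.+1%:R^-1)%:E <= (K `^ r * j.+1%:R^-1)%:E)%E.
  rewrite EFinM lee_wpmul2r ?lee_fin//.
  apply: (@le_trans _ _ (K%:E `^ r)%E);
      last by rewrite poweR_EFin lexx.
  apply: gt0_ler_poweR; rewrite ?in_itv/= ?w0 ?leey ?andbT ?lee_fin//; first exact: ltW.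
  exact: seq_weight_le.
have wz j : (2 ^ (c + b * N) <= j)%N -> w j = 0%E.
  move=> hj; rewrite /w /seq_rearrangement (rearrangement_eq0 gB) ?mule0//.
  by apply: le_trans M2 _; rewrite ler_nat.
have sumw : (\sum_(0 <= j <oo) (w j `^ r * (j.+1%:R^-1)%:E) <=
    (K `^ r * (b + c).+1%:R * N%:R)%:E)%E.
  apply: ge0_nneseries_le => // n.
  apply: (@le_trans _ _ (\sum_(0 <= j < maxn n (2 ^ (c + b * N)))
      (w j `^ r * (j.+1%:R^-1)%:E))%E).
    by apply: lee_sum_nneg_natr => //; exact: leq_maxl.
  rewrite (@big_cat_nat _ _ _ (2 ^ (c + b * N))%N)//=; last exact: leq_maxr.
  rewrite [X in (_ + X)%E]big1_seq ?adde0; last first.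
    move=> j /=; rewrite mem_index_iota => /andP[hj _].
    by rewrite (wz j hj) poweR0r ?gt_eqF// mul0e.
  apply: (@le_trans _ _ (\sum_(0 <= j < 2 ^ (c + b * N)) (K `^ r * j.+1%:R^-1)%:E)%E).
    by apply: lee_sum => j _; exact: wK.
  rewrite sumEFin lee_fin -mulr_sumr -mulrA ler_wpM2l ?powR_ge0//.
  apply: le_trans (harmonic_dyadic _ _) _.
  by rewrite -natrM ler_nat; exact: bcN.
rewrite -powRM//; last by rewrite mulr_ge0// powR_ge0.
apply: (@le_trans _ _ ((K `^ r * (b + c).+1%:R * N%:R)%:E `^ r^-1)%E);
  last by rewrite poweR_EFin lexx.
apply: gt0_ler_poweR => //; rewrite ?invr_ge0 ?ltW// in_itv/= leey andbT.
  by apply: nneseries_ge0 => j _ _; exact: t0.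
by rewrite lee_fin !mulr_ge0// powR_ge0.
Qed.

End seq_lorentz_bound.

Section lorentz_growth.
Context {R : realType}.
Variables (p r : \bar R) (B C0 : R).
Hypotheses (alpha0 : 0 <= fine p^-1) (B1 : 1 < B) (C01 : 1 <= C0).
Hypotheses (r1 : (1 < r)%E) (pr : fine p^-1 = 0 -> r = +oo%E).

(** The constant is fixed before the measure space, the function and [N]. For r = +oo the growth
    exponent is 0, which includes the endpoint with 1/p = 0, where the hypothesis [pr] leaves no
    other r. *)
Lemma lorentz_growth : exists2 K : R, 0 <= K &
  forall (disp : measure_display) (T : measurableType disp)
    (mu : {measure set T -> \bar R}) g N, (0 < N)%N ->
  distribution_bound mu (fine p^-1) B C0 N g ->
  (lorentz mu p r g <= (K * N%:R `^ fine r^-1)%:E)%E.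
Proof.
move: r r1 pr => [r'| |]//; last first.
  move=> _ _; exists ((C0 * B) `^ fine p^-1); first exact: powR_ge0.
  move=> disp T mu g N N0 gB; rewrite invey/= powRr0 mulr1.
  exact: weak_lorentz_le gB.
rewrite lte_fin => r'1 ar.
have a0 : 0 < fine p^-1.
  by rewrite lt_neqAle eq_sym alpha0 andbT; apply/eqP => /ar.
exists (((B - 1) * (((C0 * B) `^ fine p^-1) `^ r' +
  (C0 `^ fine p^-1) `^ r' / (1 - ((B `^ fine p^-1) `^ r')^-1))) `^ r'^-1).
  exact: powR_ge0.
move=> disp T mu g N N0 gB; rewrite inver gt_eqF/= ?(lt_trans _ r'1)//.
exact: (lorentz_le alpha0 B1 C01 gB).
Qed.

Lemma seq_lorentz_growth : exists2 K : R, 0 <= K &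
  forall (lambda : nat -> R[i]) N, (0 < N)%N ->
  distribution_bound counting (fine p^-1) B C0 N
    (fun k => (ComplexField.Normc.normc (lambda k))%:E) ->
  (seq_lorentz p r lambda <= (K * N%:R `^ fine r^-1)%:E)%E.
Proof.
have pow2 (x : R) : exists n, x <= (2 ^ n)%:R.
  exists (Num.trunc `|x|).+1; apply: (le_trans (ler_norm _)).
  apply: (@le_trans _ _ (Num.trunc `|x|).+1%:R).
    by rewrite ltW// truncnS_gt.
  by rewrite ler_nat ltnW// ltn_expl.
move: r r1 pr => [r'| |]//; last first.
  move=> _ _; exists (2 `^ fine p^-1 * (C0 * B) `^ fine p^-1).
    by rewrite mulr_ge0 ?powR_ge0.
  move=> lambda N N0 gB; rewrite invey/= powRr0 mulr1.
  exact: weak_seq_lorentz_le gB.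
rewrite lte_fin => r'1 ar.
have [b Bb] := pow2 B; have [c Cc] := pow2 C0.
exists (((2 `^ fine p^-1 * (C0 * B) `^ fine p^-1) `^ r' * (b + c).+1%:R) `^ r'^-1).
  exact: powR_ge0.
move=> lambda N N0 gB; rewrite inver gt_eqF/= ?(lt_trans _ r'1)//.
exact: (seq_lorentz_le alpha0 B1 C01 gB).
Qed.

(** Here r > 1 becomes decisive: the right-hand side grows with an exponent strictly below 1. *)
Lemma fine_inv_lt1 : 0 <= fine r^-1 < 1.
Proof.
move: r r1 => [r'| |]//; last by rewrite invey/= lexx ltr01.
rewrite lte_fin => r'1; have r'0 : 0 < r' by apply: lt_trans r'1.
by rewrite inver gt_eqF//= invr_ge0 ltW//= invf_lt1.
Qed.

End lorentz_growth.

Lemma lorentz_ge0 (R : realType) (disp : measure_display) (T : measurableType disp)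
    (mu : {measure set T -> \bar R}) (p r : \bar R) (g : T -> \bar R) :
  (0 <= lorentz mu p r g)%E.
Proof.
have w0 (t : R) : (0 <= (t `^ fine p^-1)%:E * rearrangement mu g t)%E.
  by rewrite mule_ge0 ?lee_fin ?powR_ge0// rearrangement_ge0.
case: r => [r'||]; first exact: poweR_ge0.
  all: by apply: le_trans (w0 1) _; apply: ereal_sup_ubound; exists 1 => //;
    rewrite /= in_itv/= ltr01.
Qed.

Lemma seq_lorentz_ge0 (R : realType) (p r : \bar R) (lambda : nat -> R[i]) :
  (0 <= seq_lorentz p r lambda)%E.
Proof.
have w0 j : (0 <= (j.+1%:R `^ fine p^-1)%:E * seq_rearrangement lambda j)%E.
  by rewrite mule_ge0 ?lee_fin ?powR_ge0// rearrangement_ge0.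
case: r => [r'||]; first exact: poweR_ge0.
  all: by apply: le_trans (w0 0%N) _; apply: ereal_sup_ubound; exists 0%N.
Qed.

(** * Complex-valued integrals *)

Import ComplexField.Normc.
Local Open Scope complex_scope.

Section complex_parts.
Context {R : realType}.
Implicit Types x y : R[i].

Lemma cReD x y : complex.Re (x + y) = complex.Re x + complex.Re y.
Proof. by case: x y => [a b] [c d]. Qed.

Lemma cImD x y : complex.Im (x + y) = complex.Im x + complex.Im y.
Proof. by case: x y => [a b] [c d]. Qed.

Lemma cReM x y : complex.Re (x * y) =
  complex.Re x * complex.Re y - complex.Im x * complex.Im y.
Proof. by case: x y => [a b] [c d]. Qed.

Lemma cImM x y : complex.Im (x * y) =
  complex.Re x * complex.Im y + complex.Im x * complex.Re y.
Proof. by case: x y => [a b] [c d]. Qed.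

Lemma complex_eqP x y :
  complex.Re x = complex.Re y -> complex.Im x = complex.Im y -> x = y.
Proof. by case: x y => [a b] [c d] /= -> ->. Qed.

Lemma Re_le_normc x : complex.Re x <= normc x.
Proof.
case: x => a b /=; apply: le_trans (ler_norm a) _.
by rewrite -sqrtr_sqr ler_wsqrtr// lerDl sqr_ge0.
Qed.

Lemma normc_ge0 x : 0 <= normc x.
Proof. by case: x => a b /=; exact: sqrtr_ge0. Qed.

Lemma normc_real (a : R) : normc a%:C = `|a|.
Proof. by rewrite /= expr0n/= addr0 sqrtr_sqr. Qed.

Lemma normc_sqr x : (normc x ^+ 2)%:C = x * x^*.
Proof.
case: x => a b /=; rewrite sqr_sqrtr ?addr_ge0 ?sqr_ge0//.
by apply: complex_eqP => /=; ring.
Qed.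

End complex_parts.

Section cintegral_linear.
Context {R : realType} {disp : measure_display} {T : measurableType disp}.
Variable mu : {measure set T -> \bar R}.
Implicit Types f g : T -> R[i].

Lemma cintegrable_cmeasurable f : cintegrable mu f -> cmeasurable f.
Proof.
by move=> [/measurable_int/measurable_EFinP ? /measurable_int/measurable_EFinP].
Qed.

Lemma cmeasurableM f g : cmeasurable f -> cmeasurable g ->
  cmeasurable (fun x => f x * g x).
Proof.
move=> [mf1 mf2] [mg1 mg2]; split.
  under eq_fun do rewrite cReM.
  by apply: measurable_funB; exact: measurable_funM.
under eq_fun do rewrite cImM.
by apply: measurable_funD; exact: measurable_funM.
Qed.

Lemma cmeasurable_cst (c : R[i]) : cmeasurable (fun _ : T => c).
Proof. by split; exact: measurable_cst. Qed.

Lemma cmeasurable_real (f : T -> R) : measurable_fun setT f ->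
  cmeasurable (fun x => (f x)%:C).
Proof. by move=> mf; split => //; exact: measurable_cst. Qed.

Lemma cmeasurable_conj f : cmeasurable f -> cmeasurable (fun x => (f x)^*).
Proof.
move=> [m1 m2]; split.
  by rewrite (_ : (fun x => _) = (fun x => complex.Re (f x)))//;
    apply/funext => x; case: (f x).
rewrite (_ : (fun x => _) = (fun x => - complex.Im (f x))).
  exact: measurable_funN.
by apply/funext => x; case: (f x).
Qed.

Lemma cintegrableZ (c : R[i]) f : cintegrable mu f ->
  cintegrable mu (fun x => c * f x).
Proof.
move=> [i1 i2]; split.
  rewrite (_ : (fun x => _) = (fun x => (complex.Re c)%:E * (complex.Re (f x))%:E
     - (complex.Im c)%:E * (complex.Im (f x))%:E)%E); last first.
    by apply/funext => x; rewrite cReM EFinB !EFinM.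
  by apply: integrableB => //; exact: integrableZl.
rewrite (_ : (fun x => _) = (fun x => (complex.Re c)%:E * (complex.Im (f x))%:E
     + (complex.Im c)%:E * (complex.Re (f x))%:E)%E); last first.
  by apply/funext => x; rewrite cImM EFinD !EFinM.
by apply: integrableD => //; exact: integrableZl.
Qed.

Lemma cintegralZ (c : R[i]) f : cintegrable mu f ->
  cintegral mu (fun x => c * f x) = c * cintegral mu f.
Proof.
move=> [i1 i2]; have iZ (k : R) (h : T -> R) : mu.-integrable setT (EFin \o h) ->
  mu.-integrable setT (EFin \o (fun x => k * h x)).
  move=> ih; rewrite (_ : EFin \o _ = (fun x => k%:E * (h x)%:E)%E)//.
  exact: integrableZl.
apply: complex_eqP; rewrite ?cReM ?cImM /=.
  under eq_Rintegral do rewrite cReM.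
  by rewrite RintegralB// ?RintegralZl//; exact: iZ.
under eq_Rintegral do rewrite cImM.
by rewrite RintegralD// ?RintegralZl//; exact: iZ.
Qed.

Lemma Re_cintegral f : complex.Re (cintegral mu f) = \int[mu]_x complex.Re (f x).
Proof. by []. Qed.

Lemma Im_cintegral f : complex.Im (cintegral mu f) = \int[mu]_x complex.Im (f x).
Proof. by []. Qed.

Lemma cintegrableD f g : cintegrable mu f -> cintegrable mu g ->
  cintegrable mu (fun x => f x + g x).
Proof.
move=> [f1 f2] [g1 g2]; split.
  rewrite (_ : (fun x => _) = (fun x => (complex.Re (f x))%:E + (complex.Re (g x))%:E)%E).
    exact: integrableD.
  by apply/funext => x; rewrite cReD EFinD.
rewrite (_ : (fun x => _) = (fun x => (complex.Im (f x))%:E + (complex.Im (g x))%:E)%E).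
  exact: integrableD.
by apply/funext => x; rewrite cImD EFinD.
Qed.

Lemma cintegralD f g : cintegrable mu f -> cintegrable mu g ->
  cintegral mu (fun x => f x + g x) = cintegral mu f + cintegral mu g.
Proof.
move=> [f1 f2] [g1 g2]; apply: complex_eqP => /=.
  by under eq_Rintegral do rewrite cReD; rewrite RintegralD.
by under eq_Rintegral do rewrite cImD; rewrite RintegralD.
Qed.

Lemma cintegrable0 : cintegrable mu (fun=> 0).
Proof. by split; exact: integrable0. Qed.

Lemma cintegral0 : cintegral mu (fun=> 0) = 0.
Proof. by apply: complex_eqP; rewrite /= /Rintegral integral0. Qed.

Lemma cintegrable_sum (I : Type) (s : seq I) (F : I -> T -> R[i]) :
  (forall i, cintegrable mu (F i)) -> cintegrable mu (fun x => \sum_(i <- s) F i x).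
Proof.
move=> iF; elim: s => [|i s IH].
  by under eq_fun do rewrite big_nil; exact: cintegrable0.
by under eq_fun do rewrite big_cons; exact: cintegrableD.
Qed.

Lemma cintegral_sum (I : Type) (s : seq I) (F : I -> T -> R[i]) :
  (forall i, cintegrable mu (F i)) ->
  cintegral mu (fun x => \sum_(i <- s) F i x) = \sum_(i <- s) cintegral mu (F i).
Proof.
move=> iF; elim: s => [|i s IH].
  by under eq_fun do rewrite big_nil; rewrite big_nil cintegral0.
under eq_fun do rewrite big_cons.
by rewrite big_cons cintegralD ?IH//; exact: cintegrable_sum.
Qed.

(** The bound on [f] is asked only where [g] does not vanish, so that [f] may be a negative power of
    |xi| when [g] is supported away from the origin. *)
Lemma cintegrableM_le f g (M : R) : 0 <= M -> cmeasurable f -> cintegrable mu g ->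
  (forall x, g x != 0 -> normc (f x) <= M) -> cintegrable mu (fun x => f x * g x).
Proof.
move=> M0 mf ig fM; have [m1 m2] := cmeasurableM mf (cintegrable_cmeasurable ig).
have Re_le (z : R[i]) : `|complex.Re z| <= normc z.
  by case: z => a b /=; rewrite -sqrtr_sqr ler_wsqrtr// lerDl sqr_ge0.
have Im_le (z : R[i]) : `|complex.Im z| <= normc z.
  by case: z => a b /=; rewrite -sqrtr_sqr ler_wsqrtr// lerDr sqr_ge0.
have le_sum (z : R[i]) : normc z <= `|complex.Re z| + `|complex.Im z|.
  case: z => a b /=; rewrite -[leRHS]ger0_norm ?addr_ge0//.
  rewrite -[leRHS]sqrtr_sqr ler_wsqrtr// sqrrD !real_normK ?num_real// -addrAC lerDl.
  by rewrite mulrn_wge0// mulr_ge0.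
have [g1 g2] := ig.
have ibound : mu.-integrable setT
    (fun x => M%:E * (`|(complex.Re (g x))%:E| + `|(complex.Im (g x))%:E|))%E.
  apply: integrableZl => //; apply: integrableD => //.
    exact: integrable_abse.
  exact: integrable_abse.
have bnd x : normc (f x * g x) <= M * (`|complex.Re (g x)| + `|complex.Im (g x)|).
  rewrite normcM; have [->|/fM fMx] := eqVneq (g x) 0.
    by rewrite normc0 mulr0 mulr_ge0 ?addr_ge0.
  by apply: ler_pM; rewrite ?normc_ge0 ?fMx ?le_sum.
split; apply: (le_integrable _ _ _ ibound) => //.
- by apply/measurable_EFinP.
- move=> x _ /=; rewrite lee_fin [leRHS]ger0_norm.
    exact: le_trans (Re_le (f x * g x)) (bnd x).
  by rewrite mulr_ge0 ?addr_ge0.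
- by apply/measurable_EFinP.
- move=> x _ /=; rewrite lee_fin [leRHS]ger0_norm.
    exact: le_trans (Im_le (f x * g x)) (bnd x).
  by rewrite mulr_ge0 ?addr_ge0.
Qed.

End cintegral_linear.

(** * Fubini for tensor products *)

Section tensor_product.
Context {R : realType} {d1 d2 : measure_display}.
Context {T1 : measurableType d1} {T2 : measurableType d2}.
Variable m1 : {sigma_finite_measure set T1 -> \bar R}.
Variable m2 : {sigma_finite_measure set T2 -> \bar R}.

Section real_tensor.
Variables (f : T1 -> R) (g : T2 -> R).
Hypotheses (intf : m1.-integrable setT (EFin \o f)).
Hypotheses (intg : m2.-integrable setT (EFin \o g)).

Lemma measurable_tensor :
  measurable_fun setT (fun z : T1 * T2 => f z.1 * g z.2).
Proof.
have /measurable_EFinP mf := measurable_int _ intf.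
have /measurable_EFinP mg := measurable_int _ intg.
apply: measurable_funM; first exact: (measurableT_comp mf).
exact: (measurableT_comp mg).
Qed.

Lemma integrable_tensor :
  (m1 \x m2)%E.-integrable setT (fun z => (f z.1 * g z.2)%:E).
Proof.
have /measurable_EFinP mf := measurable_int _ intf.
have /measurable_EFinP mg := measurable_int _ intg.
apply/integrable12ltyP; first by apply/measurable_EFinP; exact: measurable_tensor.
have [_ ig] := integrableP _ _ _ intg; have [_ jf] := integrableP _ _ _ intf.
have -> : (\int[m1]_x \int[m2]_y `|(f x * g y)%:E| =
    \int[m1]_x (`|(f x)%:E| * \int[m2]_y `|(g y)%:E|))%E.
  apply: eq_integral => x _; rewrite -ge0_integralZl//.
    by apply: eq_integral => y _; rewrite EFinM abseM.
  by apply: measurableT_comp => //; apply/measurable_EFinP.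
rewrite ge0_integralZr//; last 2 first.
- by apply: measurableT_comp => //; apply/measurable_EFinP.
- exact: integral_ge0.
rewrite lte_mul_pinfty//; first exact: integral_ge0.
by rewrite ge0_fin_numE//; exact: integral_ge0.
Qed.

Lemma Rintegral_tensor :
  \int[(m1 \x m2)%E]_z (f z.1 * g z.2) = (\int[m1]_x f x) * (\int[m2]_y g y).
Proof.
rewrite /Rintegral -integral12_prod_meas1//; last exact: integrable_tensor.
rewrite /fubini_F /=.
have -> : (\int[m1]_x \int[m2]_y (f x * g y)%:E =
    \int[m1]_x ((f x)%:E * \int[m2]_y (g y)%:E))%E.
  apply: eq_integral => x _; rewrite -integralZl//.
have gfin : (\int[m2]_y (g y)%:E)%E \is a fin_num by exact: integrable_fin_num.
rewrite -(fineK gfin) integralZr// fineM//.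
exact: integrable_fin_num.
Qed.

End real_tensor.

Lemma cintegral_prod (f : T1 -> R[i]) (g : T2 -> R[i]) :
  cintegrable m1 f -> cintegrable m2 g ->
  cintegrable (m1 \x m2)%E (fun z => f z.1 * g z.2) /\
  cintegral (m1 \x m2)%E (fun z => f z.1 * g z.2) =
    cintegral m1 f * cintegral m2 g.
Proof.
move=> [f1 f2] [g1 g2].
have i11 := integrable_tensor f1 g1; have i22 := integrable_tensor f2 g2.
have i12 := integrable_tensor f1 g2; have i21 := integrable_tensor f2 g1.
split; first split.
- rewrite (_ : (fun z => _) = (fun z => (complex.Re (f z.1) * complex.Re (g z.2))%:E -
    (complex.Im (f z.1) * complex.Im (g z.2))%:E)%E); first exact: integrableB.
  by apply/funext => z; rewrite cReM EFinB.
- rewrite (_ : (fun z => _) = (fun z => (complex.Re (f z.1) * complex.Im (g z.2))%:E +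
    (complex.Im (f z.1) * complex.Re (g z.2))%:E)%E); first exact: integrableD.
  by apply/funext => z; rewrite cImM EFinD.
apply: complex_eqP; rewrite ?cReM ?cImM !Re_cintegral !Im_cintegral.
  under eq_Rintegral do rewrite cReM.
  rewrite RintegralB//; congr (_ - _).
    exact: (@Rintegral_tensor (@complex.Re R \o f) (@complex.Re R \o g)).
  exact: (@Rintegral_tensor (@complex.Im R \o f) (@complex.Im R \o g)).
under eq_Rintegral do rewrite cImM.
rewrite RintegralD//; congr (_ + _).
  exact: (@Rintegral_tensor (@complex.Re R \o f) (@complex.Im R \o g)).
exact: (@Rintegral_tensor (@complex.Im R \o f) (@complex.Re R \o g)).
Qed.

End tensor_product.

Section euclidean_integrals.
Context {R : realType}.
Local Notation leb := (@lebesgueE R).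
Local Notation lebR := (@lebesgue_measure R).

Lemma integrableES d (f : euclid R d.+1 -> \bar R) : measurable_fun setT f ->
  (lebR \x leb d)%E.-integrable setT (f \o @consE R d) ->
  (leb d.+1).-integrable setT f /\
  (\int[leb d.+1]_x f x = \int[(lebR \x leb d)%E]_z f (consE z))%E.
Proof.
move=> mf intf; split.
  exact: (@integrable_pushforward _ _ _ _ R (@consE R d) (@measurable_consE R d)
    (lebR \x leb d)%E setT f mf intf measurableT).
exact: (@integral_pushforward _ _ _ _ R (@consE R d) (@measurable_consE R d)
    (lebR \x leb d)%E setT f mf intf measurableT).
Qed.

Lemma cintegralES d (f : euclid R d.+1 -> R[i]) : cmeasurable f ->
  cintegrable (lebR \x leb d)%E (f \o @consE R d) ->
  cintegrable (leb d.+1) f /\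
  cintegral (leb d.+1) f = cintegral (lebR \x leb d)%E (f \o @consE R d).
Proof.
move=> [m1 m2] [i1 i2].
have [j1 e1] := @integrableES d (fun x => (complex.Re (f x))%:E)
  (proj2 (measurable_EFinP _ _) m1) i1.
have [j2 e2] := @integrableES d (fun x => (complex.Im (f x))%:E)
  (proj2 (measurable_EFinP _ _) m2) i2.
split => //; apply: complex_eqP; rewrite /= /Rintegral; congr fine.
  exact: e1.
exact: e2.
Qed.

Lemma cmeasurable_tnth d (i : 'I_d) (F : R -> R[i]) :
  cmeasurable (F : measurableTypeR R -> R[i]) ->
  cmeasurable (fun x : euclid R d => F (tnth x i)).
Proof.
have mt := @measurable_tnth _ (measurableTypeR R) d i.
by move=> [m1 m2]; split; [exact: (measurableT_comp m1)|exact: (measurableT_comp m2)].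
Qed.

Lemma cmeasurable_prod d (F : 'I_d -> euclid R d -> R[i]) :
  (forall i, cmeasurable (F i)) -> cmeasurable (fun x => \prod_i F i x).
Proof.
move=> mF; elim: (index_enum 'I_d) => [|i s IH].
  by under eq_fun do rewrite big_nil; exact: cmeasurable_cst.
by under eq_fun do rewrite big_cons; exact: cmeasurableM.
Qed.

(** Induction on [d] through the pushforward along [consE]; in dimension 0 the empty product is
    integrated against the Dirac mass. *)
Lemma cintegral_tensor d (F : nat -> measurableTypeR R -> R[i]) :
  (forall i, cintegrable lebR (F i)) ->
  cintegrable (leb d) (fun x => \prod_(i < d) F i (tnth x i)) /\
  cintegral (leb d) (fun x => \prod_(i < d) F i (tnth x i)) =
    \prod_(i < d) cintegral lebR (F i).
Proof.
elim: d F => [|d IH] F iF.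
  under eq_fun do rewrite big_ord0; rewrite big_ord0; split.
    by split => /=; apply: finite_measure_integrable_cst.
  apply: complex_eqP; rewrite /= /Rintegral.
    by rewrite integral_dirac// diracT mul1e.
  by rewrite integral_dirac// diracT mul1e.
have [i' e'] := IH (F \o S) (fun i => iF i.+1).
have [i2 e2] := cintegral_prod (iF 0%N) i'.
have E : (fun x : euclid R d.+1 => \prod_(i < d.+1) F i (tnth x i)) \o @consE R d =
    (fun z => F 0%N z.1 * \prod_(i < d) F i.+1 (tnth z.2 i)).
  apply/funext => -[a x] /=; rewrite big_ord_recl tnth0; congr (_ * _).
  by apply: eq_bigr => i _; rewrite tnthS.
have [] := @cintegralES d (fun x => \prod_(i < d.+1) F i (tnth x i)).
- apply: cmeasurable_prod => i; apply: cmeasurable_tnth.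
  exact: cintegrable_cmeasurable (iF i).
- by rewrite E.
move=> j1 j2; split => //; rewrite j2 E e2 e' big_ord_recl.
by congr (_ * _).
Qed.

End euclidean_integrals.

(** * The versine kernel and orthogonal waves *)

Section trigonometric_bounds.
Context {R : realType}.

Lemma normr_sin_le (y : R) : `|sin y| <= `|y|.
Proof.
wlog y0 : y / 0 < y.
  move=> h; have [y0|y0|<-] := ltgtP 0 y; [exact: h| |by rewrite sin0].
  by rewrite -normrN -sinN -[leRHS]normrN; apply: h; rewrite oppr_gt0.
have [c _] := MVT y0 (fun x _ => is_derive_sin x)
  (continuous_subspaceT (@continuous_sin R)).
rewrite sin0 !subr0 => ->; rewrite normrM ler_piMl//; exact: cos_max.
Qed.

Lemma one_sub_cos_le (x : R) : 1 - cos x <= x ^+ 2 / 2.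
Proof.
have -> : 1 - cos x = 2 * sin (x / 2) ^+ 2.
  have {1}-> : x = (x / 2) *+ 2 by rewrite -mulr_natr; field.
  by rewrite cos_mulr2n cos2sin2 -mulr_natr; ring.
have -> : x ^+ 2 / 2 = 2 * (x / 2) ^+ 2 by field.
rewrite ler_pM2l// -real_normK ?num_real// -[leRHS]real_normK ?num_real//.
by rewrite lerXn2r ?nnegrE//; exact: normr_sin_le.
Qed.

Lemma cos_ge_half (x : R) : `|x| <= 1 -> 2^-1 <= cos x.
Proof.
move=> x1; have := one_sub_cos_le x.
have : x ^+ 2 <= 1 by rewrite -real_normK ?num_real// expr_le1.
lra.
Qed.

End trigonometric_bounds.

(** * Dilation and reflection of Lebesgue measure *)

Section scaling.
Context {R : realType}.
Local Notation mu := (@lebesgue_measure R).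

Lemma measurable_scale (k : R) :
  measurable_fun setT (fun x : measurableTypeR R => (k * x : measurableTypeR R)).
Proof. exact: measurable_funM. Qed.

(** The preimage of a set under x -> k x has 1/k times its measure; the factor k compensates, so
    this is Lebesgue measure again. *)
Definition scaled_lebesgue (k : R) (k0 : 0 < k) :=
  mscale (NngNum (ltW k0))
    (measure_function_pushforward__canonical__measure_function_Measure mu
       (measurable_scale k)).

Lemma scaled_lebesgueE (k : R) (k0 : 0 < k) (A : set R) :
  measurable (A : set (measurableTypeR R)) -> mu A = scaled_lebesgue k0 A.
Proof.
move=> mA; apply: lebesgue_measure_unique => // _ [[a b]] _ <-.
rewrite -[RHS]/(k%:E * mu ((fun x : R => k * x)%R @^-1` `]a, b]))%E.
rewrite (_ : _ @^-1` _ = `]k^-1 * a, k^-1 * b]%classic); last first.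
  by apply/seteqP; split => x /=; rewrite !in_itv/= ltr_pdivrMl// ler_pdivlMl.
rewrite !lebesgue_measure_itv/= !lte_fin ltr_pM2l ?invr_gt0//.
case: ifPn => // _; last by rewrite mule0.
by rewrite -!EFinB -EFinM; congr EFin; field; exact: lt0r_neq0.
Qed.

Lemma ge0_integral_scale (k : R) (f : R -> \bar R) : 0 < k ->
  measurable_fun setT f -> (forall x, (0 <= f x)%E) ->
  (\int[mu]_x f (k * x)%R = (k^-1)%:E * \int[mu]_x f x)%E.
Proof.
move=> k0 mf f0.
have := @ge0_integral_pushforward _ _ _ _ R _ (measurable_scale k) mu setT f
  measurableT mf (fun y _ => f0 y).
rewrite preimage_setT => <-.
have -> : (\int[mu]_x f x = \int[scaled_lebesgue k0]_x f x)%E.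
  by apply: eq_measure_integral => A mA _; exact: scaled_lebesgueE.
rewrite ge0_integral_mscale// muleA -EFinM mulVf ?mul1e//.
exact: lt0r_neq0.
Qed.

Lemma Rintegral_odd (f : R -> R) : measurable_fun setT f ->
  (forall x, f (- x) = - f x) -> \int[mu]_x f x = 0.
Proof.
move=> mf fN; have mN : measurable_fun setT
    (-%R : measurableTypeR R -> measurableTypeR R).
  exact: measurable_funN.
have negE (g : R -> \bar R) : measurable_fun setT g -> (forall x, 0 <= g x)%E ->
    (\int[mu]_x g (- x)%R = \int[mu]_x g x)%E.
  move=> mg g0.
  have := @ge0_integral_pushforward _ _ _ _ R _ mN mu setT g measurableT mg
    (fun y _ => g0 y).
  rewrite preimage_setT => <-.
  apply: (@eq_measure_integral _ _ _ setT mu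
    (measure_function_pushforward__canonical__measure_function_Measure mu mN) g).
  by move=> A mA _; exact: (lebesgue_measureN mA).
rewrite /Rintegral integralE.
have -> : (\int[mu]_x (fun x => (f x)%:E)^\- x = \int[mu]_x (fun x => (f x)%:E)^\+ x)%E.
  rewrite -[RHS]negE//; last first.
    by apply: measurable_funepos; apply/measurable_EFinP.
  by apply: eq_integral => x _; rewrite funenegE funeposE fN.
(* If the common integral of the two parts is infinite, their difference is not finite and [fine]
   returns its default value 0, so the identity holds without integrability. *)
have [/fineK <-|] := boolP ((\int[mu]_x (fun x => (f x)%:E)^\+ x) \is a fin_num)%E.
  by rewrite subee.
rewrite ge0_fin_numE; last exact: integral_ge0.
by rewrite -leNgt leye_eq => /eqP ->.
Qed.

End scaling.

Section parametric_measurability.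
Context {R : realType} {d1 d2 : measure_display}.
Context {T1 : measurableType d1} {T2 : measurableType d2}.
Variable m2 : {sigma_finite_measure set T2 -> \bar R}.

(** Tonelli applies to the positive and negative parts separately, so the sections need not be
    integrable. *)
Lemma measurable_Rintegral (F : T1 * T2 -> R) : measurable_fun setT F ->
  measurable_fun setT (fun x => \int[m2]_y F (x, y)).
Proof.
move=> mF; have mE : measurable_fun setT (EFin \o F) by apply/measurable_EFinP.
rewrite /Rintegral; apply: (measurableT_comp (f := fine)) => //.
rewrite (_ : (fun x => _) = (fun x => \int[m2]_y (EFin \o F)^\+ (x, y) -
    \int[m2]_y (EFin \o F)^\- (x, y))%E); last first.
  apply/funext => x; rewrite integralE; congr (_ - _)%E.
    by apply: eq_integral => y _; rewrite !funeposE.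
  by apply: eq_integral => y _; rewrite !funenegE.
apply: emeasurable_funB.
  have := @measurable_fun_fubini_tonelli_F _ _ _ _ _ m2 ((EFin \o F)^\+)%E.
  apply => //.
  exact: measurable_funepos.
have := @measurable_fun_fubini_tonelli_F _ _ _ _ _ m2 ((EFin \o F)^\-)%E.
  apply => //.
exact: measurable_funeneg.
Qed.

Lemma cmeasurable_cintegral (F : T1 * T2 -> R[i]) : cmeasurable F ->
  cmeasurable (fun x => cintegral m2 (fun y => F (x, y))).
Proof.
move=> [mRe mIm]; split.
  exact: (@measurable_Rintegral (fun z => complex.Re (F z))).
exact: (@measurable_Rintegral (fun z => complex.Im (F z))).
Qed.

End parametric_measurability.

Section exponential.
Context {R : realType}.

Lemma expiD (a b : R) : expi (a + b) = expi a * expi b.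
Proof. by rewrite /expi cosD sinD; apply: complex_eqP => /=; ring. Qed.

Lemma expi0 : expi (0 : R) = 1.
Proof. by rewrite /expi cos0 sin0. Qed.

Lemma normc_expi (a : R) : normc (expi a) = 1.
Proof. by rewrite /= cos2Dsin2 sqrtr1. Qed.

Lemma cmeasurable_expi (d : measure_display) (T : measurableType d) (f : T -> R) :
  measurable_fun setT f -> cmeasurable (fun x => expi (f x)).
Proof.
move=> mf; split => /=; apply: (measurableT_comp _ mf).
  by apply: continuous_measurable_fun; exact: continuous_cos.
by apply: continuous_measurable_fun; exact: continuous_sin.
Qed.

End exponential.

Section versine_kernel.
Context {R : realType}.
Local Notation mu := (@lebesgue_measure R).

(** For x <> 0 this is half the squared modulus of the Fourier transform of the indicator of an
    interval of length |k|. At x = 0 division by zero gives 0 instead of the limit k^2 / 2. *)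
Definition versine_kernel (k x : R) : R := (1 - cos (k * x)) / x ^+ 2.

Lemma versine_kernel_ge0 k x : 0 <= versine_kernel k x.
Proof. by rewrite divr_ge0 ?sqr_ge0// subr_ge0 cos_le1. Qed.

Lemma measurable_versine_kernel k : measurable_fun setT (versine_kernel k).
Proof.
apply: measurable_funM; last first.
  rewrite (_ : (fun x => _) = (fun x : R => (x ^+ 2) `^ (-1))); last first.
    by apply/funext => x; rewrite powR_inv1 ?sqr_ge0.
  have mX : measurable_fun setT (fun x : R => x ^+ 2) by exact: measurable_funX.
  exact: (measurableT_comp (measurable_powR (-1)) mX).
apply: measurable_funB => //.
apply: (measurableT_comp (f := cos) (g := fun x : R => k * x)).
  by apply: continuous_measurable_fun; exact: continuous_cos.
exact: measurable_funM.
Qed.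

(** An integrable majorant: 1 - cos x <= x^2 / 2 serves for x^2 <= 1, and 1 - cos x <= 2 for larger
    x. *)
Lemma versine_kernel_le x : versine_kernel 1 x <= 4 * (oneDsqr x)^-1.
Proof.
rewrite /versine_kernel mul1r /oneDsqr.
have [->|x0] := eqVneq x 0.
  by rewrite cos0 subrr mul0r expr0n/= addr0 invr1.
have x2 : 0 < x ^+ 2 by rewrite exprn_even_gt0.
have x21 : 0 < 1 + x ^+ 2 by rewrite addr_gt0.
rewrite ler_pdivrMr// mulrAC ler_pdivlMr//.
have := one_sub_cos_le x; have := cos_geN1 x; have := cos_le1 x.
by have [|] := leP (x ^+ 2) 1; nra.
Qed.

Lemma versine_kernel_lty : (\int[mu]_x (versine_kernel 1 x)%:E < +oo)%E.
Proof.
apply: (@le_lt_trans _ _ (\int[mu]_x (4%:E * ((oneDsqr x)^-1)%:E))%E).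
  apply: ge0_le_integral_nonmeasurable => x _; rewrite ?lee_fin.
    exact: versine_kernel_ge0.
  exact: versine_kernel_le.
have mO : measurable_fun setT (EFin \o (fun x : R => (oneDsqr x)^-1)).
  apply/measurable_EFinP; apply: continuous_measurable_fun.
  exact: continuous_oneDsqrV.
rewrite ge0_integralZl//.
rewrite ge0_symfun_integralT; last 3 first.
- by move=> x; rewrite invr_ge0.
- exact: continuous_oneDsqrV.
- by move=> x /=; rewrite /oneDsqr sqrrN.
rewrite -set_itvcy (integral0y_oneDsqr R) -!EFinM ltry//.
Qed.

(** The classical value of this integral is pi, so that 2 [versine_mass] stands for the Plancherel
    constant 2 pi. *)
Definition versine_mass : R := \int[mu]_x versine_kernel 1 x.

Lemma versine_mass_gt0 : 0 < versine_mass.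
Proof.
rewrite -lte_fin /versine_mass /Rintegral fineK; last first.
  rewrite ge0_fin_numE ?versine_kernel_lty//.
  by apply: integral_ge0 => x _; rewrite lee_fin versine_kernel_ge0.
have pi0 := pi_gt0 R.
(* On ]pi/2, pi] the cosine is negative, so the kernel is at least 1 / x^2 >= pi^(-2) there. *)
apply: (@lt_le_trans _ _ ((pi ^- 2)%:E * (pi / 2)%:E)%E).
  by rewrite -EFinM lte_fin mulr_gt0// ?divr_gt0// invr_gt0 exprn_gt0.
have -> : (pi / 2)%:E = mu `]pi / 2, pi]%classic.
  rewrite lebesgue_measure_itv/= lte_fin ifT; last by lra.
  by rewrite -EFinB; congr EFin; lra.
rewrite -(@integral_cst _ _ _ mu `]pi / 2, pi]%classic); last exact: measurable_itv.
rewrite integral_mkcond; apply: ge0_le_integral_nonmeasurable => x _.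
  rewrite patchE; case: ifP => // _; rewrite lee_fin invr_ge0 exprn_ge0//; exact: ltW.
rewrite patchE; case: ifPn => [|_]; last by rewrite lee_fin versine_kernel_ge0.
rewrite inE/= in_itv/= => /andP[x1 x2]; have x0 : 0 < x by lra.
rewrite lee_fin /versine_kernel mul1r.
have c0 : cos x < 0.
  by rewrite -(cos_pihalf R) ltr_cos// in_itv/=; apply/andP; split; lra.
rewrite -[leLHS]mul1r; apply: ler_pM => //.
- by rewrite invr_ge0 exprn_ge0// ltW.
- lra.
rewrite lef_pV2 ?posrE ?exprn_gt0// lerXn2r ?nnegrE//; exact: ltW.
Qed.

Lemma versine_kernelE k x : versine_kernel k x = k ^+ 2 * versine_kernel 1 (k * x).
Proof.
rewrite /versine_kernel mul1r exprMn.
have [->|k0] := eqVneq k 0; first by rewrite !mul0r cos0 subrr mul0r expr0n/= mul0r.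
have [->|x0] := eqVneq x 0; first by rewrite !mulr0 cos0 subrr !mul0r mulr0.
by field; apply/andP.
Qed.

Lemma versine_kernelN k x : versine_kernel (- k) x = versine_kernel k x.
Proof. by rewrite /versine_kernel mulNr cosN. Qed.

(** The dilation x -> k x contributes k^2 from the kernel and 1/k from the measure. Because the
    result is a multiple of |k|, inner products of waves become second differences of the absolute
    value. *)
Lemma integral_versine_kernel k :
  (\int[mu]_x (versine_kernel k x)%:E = (`|k| * versine_mass)%:E)%E.
Proof.
wlog k0 : k / 0 < k.
  move=> h; have [k0|k0|<-] := ltgtP 0 k; first exact: h.
    rewrite -normrN -h ?oppr_gt0//.
    by under [RHS]eq_integral do rewrite versine_kernelN.
  rewrite normr0 mul0r; apply: integral0_eq => x _.
  by rewrite /versine_kernel mul0r cos0 subrr mul0r.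
under eq_integral do rewrite versine_kernelE EFinM.
rewrite ge0_integralZl//; last 3 first.
- apply/measurable_EFinP; apply: (measurableT_comp (measurable_versine_kernel 1)).
  exact: measurable_funM.
- by move=> x _; rewrite lee_fin versine_kernel_ge0.
- by rewrite lee_fin sqr_ge0.
rewrite (ge0_integral_scale (f := fun x => (versine_kernel 1 x)%:E) k0); last 2 first.
- by apply/measurable_EFinP; exact: measurable_versine_kernel.
- by move=> x; rewrite lee_fin versine_kernel_ge0.
rewrite muleA -EFinM (_ : k ^+ 2 / k = k); last by field; rewrite gt_eqF.
rewrite (gtr0_norm k0) EFinM /versine_mass /Rintegral fineK//.
rewrite ge0_fin_numE ?versine_kernel_lty//.
by apply: integral_ge0 => x _; rewrite lee_fin versine_kernel_ge0.
Qed.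

Lemma integrable_versine_kernel k :
  mu.-integrable setT (EFin \o versine_kernel k).
Proof.
apply/integrableP; split; first by apply/measurable_EFinP; exact: measurable_versine_kernel.
under eq_integral => x _ do rewrite /= ger0_norm ?versine_kernel_ge0//.
by rewrite integral_versine_kernel ltry.
Qed.

Lemma Rintegral_versine_kernel k :
  \int[mu]_x versine_kernel k x = `|k| * versine_mass.
Proof. by rewrite /Rintegral integral_versine_kernel. Qed.

End versine_kernel.

Section wave.
Context {R : realType}.
Local Notation mu := (@lebesgue_measure R).

Lemma integrable_indic_itv (a b : R) :
  mu.-integrable setT (EFin \o (\1_(`[a, b[%classic) : R -> R)).
Proof.
apply/integrableP; split.
  by apply/measurable_EFinP; apply: measurable_indic; exact: measurable_itv.
under eq_integral => x _ do rewrite /= ger0_norm//.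
rewrite integral_indic// setIT /= lebesgue_measure_itv/=; case: ifP => // _.
by rewrite -EFinB ltry.
Qed.

Lemma cintegrable_real (d : measure_display) (T : measurableType d)
    (m : {measure set T -> \bar R}) (f : T -> R) :
  m.-integrable setT (EFin \o f) -> cintegrable m (fun x => (f x)%:C).
Proof. by move=> intf; split => //=; exact: integrable0. Qed.

Definition plane_wave (a b x xi : R) : R[i] :=
  expi (x * xi) * (\1_(`[a, b[%classic) xi)%:C.

Lemma cintegrable_plane_wave (a b x : R) : cintegrable mu (plane_wave a b x).
Proof.
apply: (@cintegrableM_le _ _ _ mu (fun xi : R => expi (x * xi)) _ 1) => //.
- apply: (@cmeasurable_expi _ _ (measurableTypeR R) (fun xi : R => x * xi)).
  by apply: measurable_funM.
- exact: (cintegrable_real (integrable_indic_itv a b)).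
- by move=> xi _; rewrite normc_expi.
Qed.

Definition wave (a b x : R) : R[i] := cintegral mu (plane_wave a b x).

Lemma Re_plane_wave a b x xi :
  complex.Re (plane_wave a b x xi) = cos (x * xi) * \1_(`[a, b[%classic) xi.
Proof. by rewrite /plane_wave cReM /= mulr0 subr0. Qed.

Lemma Im_plane_wave a b x xi :
  complex.Im (plane_wave a b x xi) = sin (x * xi) * \1_(`[a, b[%classic) xi.
Proof. by rewrite /plane_wave cImM /= mulr0 add0r. Qed.

Lemma Rintegral_itv_FTC (f F : R -> R) (a b : R) : a < b ->
  continuous f -> (forall x : R, is_derive x 1 F (f x)) ->
  \int[mu]_xi (f xi * \1_(`[a, b[%classic) xi) = F b - F a.
Proof.
move=> ab cf dF.
have -> : \int[mu]_xi (f xi * \1_(`[a, b[%classic) xi) =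
    \int[mu]_(xi in `[a, b[) f xi.
  rewrite [RHS]Rintegral_mkcond; apply: eq_Rintegral => xi _.
  by rewrite patchE indicE; case: ifP => _; rewrite ?mulr1 ?mulr0.
have cF : continuous F.
  move=> x; apply/differentiable_continuous/derivable1_diffP.
  by have [] := dF x.
rewrite Rintegral_itv_bndo_bndc; last first.
  apply: (@integrableS _ _ _ mu `[a, b]) => //; first exact: subset_itv_co_cc.
  apply: continuous_compact_integrable; first exact: segment_compact.
  exact: continuous_subspaceT.
rewrite /Rintegral (@continuous_FTC2 _ f F)//.
- exact: continuous_subspaceT.
- split.
  + by move=> x _; have [] := dF x.
  + by apply: cvg_at_right_filter; exact: cF.
  + by apply: cvg_at_left_filter; exact: cF.
- by move=> x _; rewrite derive1E; have [] := dF x.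
Qed.

Lemma is_derive_mull (x xi : R) : is_derive xi 1 (fun y : R => x * y) x.
Proof.
have h := @is_deriveZ R R R id x xi 1 1 (is_derive_id xi 1).
by apply: is_derive_eq h _; rewrite /GRing.scale /= mulr1.
Qed.

Lemma is_derive_comp_mull (f df : R -> R) (x k xi : R) :
  (forall y : R, is_derive y 1 f (df y)) ->
  is_derive xi 1 (fun y : R => k * f (x * y)) (k * x * df (x * xi)).
Proof.
move=> Df.
have h := @is_derive1_comp R f (fun y : R => x * y) xi _ _ (Df (x * xi))
  (is_derive_mull x xi).
have := @is_deriveZ R R R _ k xi 1 _ h.
by move=> /is_derive_eq; apply; rewrite /GRing.scale /=; ring.
Qed.

Lemma Re_wave (a b x : R) : a < b -> x != 0 ->
  complex.Re (wave a b x) = (sin (x * b) - sin (x * a)) / x.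
Proof.
move=> ab x0; rewrite /wave Re_cintegral.
under eq_Rintegral do rewrite Re_plane_wave.
have dF (xi : R) : is_derive xi 1 (fun y : R => x^-1 * sin (x * y)) (cos (x * xi)).
  apply: is_derive_eq (is_derive_comp_mull x x^-1 xi (@is_derive_sin R)) _.
  by rewrite mulVf// mul1r.
have cf : continuous (fun xi : R => cos (x * xi)).
  move=> xi; apply: (@continuous_comp _ _ _ ( *%R x) cos).
    exact: mulrl_continuous.
  exact: continuous_cos.
by rewrite (Rintegral_itv_FTC ab cf dF) -mulrBr mulrC.
Qed.

Lemma Im_wave (a b x : R) : a < b -> x != 0 ->
  complex.Im (wave a b x) = (cos (x * a) - cos (x * b)) / x.
Proof.
move=> ab x0; rewrite /wave Im_cintegral.
under eq_Rintegral do rewrite Im_plane_wave.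
have dF (xi : R) : is_derive xi 1 (fun y : R => - x^-1 * cos (x * y)) (sin (x * xi)).
  apply: is_derive_eq (is_derive_comp_mull x (- x^-1) xi (@is_derive_cos R)) _.
  by rewrite mulNr mulVf// mulN1r opprK.
have cf : continuous (fun xi : R => sin (x * xi)).
  move=> xi; apply: (@continuous_comp _ _ _ ( *%R x) sin).
    exact: mulrl_continuous.
  exact: continuous_sin.
by rewrite (Rintegral_itv_FTC ab cf dF); ring.
Qed.

Lemma waveN (a b x : R) : wave a b (- x) = (wave a b x)^*.
Proof.
rewrite /wave; apply: complex_eqP.
  rewrite [RHS](_ : _ = complex.Re (wave a b x)); last by rewrite /wave; case: (cintegral _ _).
  rewrite /wave !Re_cintegral; apply: eq_Rintegral => xi _.
  by rewrite !Re_plane_wave mulNr cosN.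
rewrite [RHS](_ : _ = - complex.Im (wave a b x)); last by rewrite /wave; case: (cintegral _ _).
rewrite /wave !Im_cintegral -[RHS]mulN1r -RintegralZl//; last first.
  by have [] := cintegrable_plane_wave a b x.
by apply: eq_Rintegral => xi _; rewrite !Im_plane_wave mulNr sinN; ring.
Qed.

Lemma cmeasurable_wave (a b : R) : cmeasurable (wave a b : measurableTypeR R -> R[i]).
Proof.
apply: (@cmeasurable_cintegral _ _ _ (measurableTypeR R) (measurableTypeR R) mu
  (fun z => plane_wave a b z.1 z.2)).
apply: cmeasurableM.
  by apply: cmeasurable_expi; exact: measurable_funM.
apply: cmeasurable_real; by apply: (measurableT_comp (g := snd)).
Qed.

Lemma normc_wave_sqr (a b x : R) : a < b -> x != 0 ->
  normc (wave a b x) ^+ 2 = 2 * versine_kernel (b - a) x.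
Proof.
move=> ab x0; have := Re_wave ab x0; have := Im_wave ab x0.
case: (wave a b x) => u v /= -> ->.
rewrite sqr_sqrtr ?addr_ge0 ?sqr_ge0// /versine_kernel.
rewrite (_ : (b - a) * x = x * b - x * a); last by ring.
rewrite cosB; have := cos2Dsin2 (x * a); have := cos2Dsin2 (x * b).
move=> h1 h2; set w := cos (x * b) * cos (x * a) + _.
transitivity ((cos (x * b) ^+ 2 + sin (x * b) ^+ 2 +
   (cos (x * a) ^+ 2 + sin (x * a) ^+ 2) - 2 * w) / x ^+ 2).
  by rewrite /w; field.
by rewrite h1 h2; field.
Qed.

Definition wave_product (a b a' b' x : R) := wave a b x * (wave a' b' x)^*.

Lemma cmeasurable_wave_product a b a' b' :
  cmeasurable (wave_product a b a' b' : measurableTypeR R -> R[i]).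
Proof.
by apply: cmeasurableM; [|apply: cmeasurable_conj]; exact: cmeasurable_wave.
Qed.

Lemma normc_conj (z : R[i]) : normc z^* = normc z.
Proof. by case: z => u v /=; rewrite sqrrN. Qed.

Lemma cintegrable_wave_product a b a' b' : a < b -> a' < b' ->
  cintegrable mu (wave_product a b a' b').
Proof.
move=> ab ab'; pose C := normc (wave_product a b a' b' 0).
(* Majorant from |z w| <= |z|^2 + |w|^2. The last term takes care of x = 0, where the kernels vanish
   by convention while the waves do not. *)
pose D x := 2 * versine_kernel (b - a) x + 2 * versine_kernel (b' - a') x +
  C * \1_[set (0 : R)] x.
have iD : mu.-integrable setT (EFin \o D).
  have iZ (k : R) (h : R -> R) : mu.-integrable setT (EFin \o h) ->
    mu.-integrable setT (fun x => (k * h x)%:E).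
    by move=> ih; exact: (integrableZl measurableT k ih).
  have -> : EFin \o D = (fun x => (2 * versine_kernel (b - a) x)%:E +
     (2 * versine_kernel (b' - a') x)%:E + (C * \1_[set (0 : R)] x)%:E)%E by [].
  apply: integrableD => //; last first.
    apply: iZ; apply/integrableP; split.
      by apply/measurable_EFinP; exact: measurable_indic.
    under eq_integral => x _ do rewrite /= ger0_norm//.
    by rewrite integral_indic// setIT /= lebesgue_measure_set1.
  by apply: integrableD => //; apply: iZ; exact: integrable_versine_kernel.
have D0 x : 0 <= D x.
  apply: addr_ge0; last by rewrite mulr_ge0 ?normc_ge0// indicE ler0n.
  by apply: addr_ge0; rewrite mulr_ge0 ?versine_kernel_ge0.
have leD x : normc (wave_product a b a' b' x) <= D x.
  rewrite /D; have [->|x0] := eqVneq x 0.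
    rewrite indicE mem_set// mulr1 lerDr.
    by rewrite addr_ge0// mulr_ge0// versine_kernel_ge0.
  rewrite indicE memNset ?mulr0 ?addr0; last by apply/eqP.
  rewrite /wave_product normcM normc_conj -!normc_wave_sqr//.
  have := normc_ge0 (wave a b x); have := normc_ge0 (wave a' b' x); nra.
have [m1 m2] := cmeasurable_wave_product a b a' b'.
split; apply: (le_integrable _ _ _ iD) => //.
- by apply/measurable_EFinP.
- move=> x _; rewrite lee_fin [leRHS]ger0_norm//; apply: le_trans (leD x).
  case: (wave_product a b a' b' x) => u v /=.
  by rewrite -sqrtr_sqr ler_wsqrtr// lerDl sqr_ge0.
- by apply/measurable_EFinP.
- move=> x _; rewrite lee_fin [leRHS]ger0_norm//; apply: le_trans (leD x).
  case: (wave_product a b a' b' x) => u v /=.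
  by rewrite -sqrtr_sqr ler_wsqrtr// lerDr sqr_ge0.
Qed.

(** The real part is, away from x = 0, a combination of three versine kernels; the imaginary part is
    odd by [waveN]. The second difference of the absolute value is twice the length of the overlap
    of the two intervals, so this is Plancherel for indicators of intervals of equal length. *)
Lemma cintegral_wave_product (a a' h : R) : 0 < h ->
  cintegral mu (wave_product a (a + h) a' (a' + h)) =
    ((`|a - a' + h| + `|a - a' - h| - 2 * `|a - a'|) * versine_mass)%:C.
Proof.
move=> h0; have ab : a < a + h by rewrite ltrDl.
have ab' : a' < a' + h by rewrite ltrDl.
have [m1 m2] := cmeasurable_wave_product a (a + h) a' (a' + h).
apply: complex_eqP; last first.
  rewrite Im_cintegral; apply: Rintegral_odd => // x.
  rewrite /wave_product !waveN.
  by case: (wave a _ x) (wave a' _ x) => [u v] [u' v'] /=; ring.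
rewrite Re_cintegral /=.
pose Q x := versine_kernel (a - a' + h) x + versine_kernel (a - a' - h) x
  - 2 * versine_kernel (a - a') x.
have QE x : x != 0 -> complex.Re (wave_product a (a + h) a' (a' + h) x) = Q x.
  move=> x0; rewrite /wave_product.
  have -> (z w : R[i]) : complex.Re (z * w^*) =
      complex.Re z * complex.Re w + complex.Im z * complex.Im w.
    by case: z w => [u v] [u' v'] /=; ring.
  rewrite !Re_wave// !Im_wave// /Q /versine_kernel.
  rewrite (_ : (a - a' + h) * x = x * (a + h) - x * a'); last by ring.
  rewrite (_ : (a - a' - h) * x = x * a - x * (a' + h)); last by ring.
  rewrite (_ : 2 * _ = ((1 - cos (x * (a + h) - x * (a' + h))) +
     (1 - cos (x * a - x * a'))) / x ^+ 2); last first.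
    rewrite (_ : (a - a') * x = x * a - x * a'); last by ring.
    rewrite (_ : x * (a + h) - x * (a' + h) = x * a - x * a'); last by ring.
    by field.
  by rewrite !cosB; field.
have vkZ k : mu.-integrable setT (fun x => (2 * versine_kernel k x)%:E).
  exact: (integrableZl measurableT 2 (integrable_versine_kernel k)).
have iv := @integrable_versine_kernel R.
have iD k l : mu.-integrable setT (fun x => (versine_kernel k x + versine_kernel l x)%:E).
  exact: (integrableD measurableT (iv k) (iv l)).
have -> : \int[mu]_x complex.Re (wave_product a (a + h) a' (a' + h) x) = \int[mu]_x Q x.
  congr fine; apply: ae_eq_integral => //.
  - by apply/measurable_EFinP.
  - apply/measurable_EFinP; apply: measurable_funB.
      by apply: measurable_funD; exact: measurable_versine_kernel.
    by apply: measurable_funM => //; exact: measurable_versine_kernel.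
  exists [set 0]; split => //; first exact: lebesgue_measure_set1.
  move=> x /= hx; apply/eqP; apply: contra_notT hx => x0 _.
  by congr EFin; exact: QE.
rewrite /Q (RintegralB measurableT (iD _ _) (vkZ _)).
rewrite (RintegralD measurableT (iv _) (iv _)) (RintegralZl 2 measurableT (iv _)).
by rewrite !Rintegral_versine_kernel; ring.
Qed.

(* Plancherel for the pieces of the grid [M^-1 Z]: by scaling, both sides of the
   identity are linear in the step, so the value of versine_mass is irrelevant. *)
Lemma cintegral_wave_grid (M a b : nat) : (0 < M)%N ->
  cintegral mu (wave_product (a%:R / M%:R) (a.+1%:R / M%:R)
                             (b%:R / M%:R) (b.+1%:R / M%:R)) =
    if a == b then (2 * versine_mass / M%:R)%:C else 0.
Proof.
move=> M0; have Mp : 0 < M%:R^-1 :> R by rewrite invr_gt0 ltr0n.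
have E (n : nat) : n.+1%:R / M%:R = n%:R / M%:R + M%:R^-1 :> R.
  by rewrite -natr1 mulrDl mul1r.
rewrite !E cintegral_wave_product//.
have -> : a%:R / M%:R - b%:R / M%:R = (a%:R - b%:R) / M%:R :> R by rewrite mulrBl.
set t : R := M%:R^-1; set c : R := a%:R - b%:R.
have [ab|ab] := eqVneq a b.
  rewrite /c ab subrr mul0r normr0 add0r sub0r normrN (gtr0_norm Mp).
  by congr (_%:C); rewrite -/t; ring.
have cabs : 1 <= `|c|.
  rewrite /c; have [lt_ab|lt_ba|] := ltngtP a b; last by move/eqP: ab.
    by rewrite distrC ger0_norm ?subr_ge0 ?ler_nat 1?ltnW// -natrB 1?ltnW// ler1n subn_gt0.
  by rewrite ger0_norm ?subr_ge0 ?ler_nat 1?ltnW// -natrB 1?ltnW// ler1n subn_gt0.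
(* Distinct grid points are at least one step t apart, so the absolute value is affine between c t -
   t and c t + t and its second difference vanishes. *)
suff -> : `|c * t + t| + `|c * t - t| - 2 * `|c * t| = 0 by rewrite mul0r.
have t0 : 0 < t by []; move: cabs; clearbody t c => cabs.
have [c0|c0] := lerP 0 c.
  rewrite (ger0_norm c0) in cabs.
  have ct : t <= c * t by rewrite ler_peMl// ltW.
  by rewrite !ger0_norm; [ring|lra..].
rewrite (ltr0_norm c0) in cabs.
have ct : c * t <= - t.
  by rewrite -mulN1r ler_pM2r//; lra.
by rewrite (ler0_norm (x := c * t)) ?(ler0_norm (x := _ + _)); [ring|lra..].
Qed.

End wave.

(** * Fourier multipliers of grid waves *)

Section inverse_fourier.
Context {R : realType} (d : nat).
Local Notation E := (euclid R d).
Local Notation leb := (@lebesgueE R d).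

Lemma measurable_coord (i : 'I_d) : measurable_fun setT (fun x : E => tnth x i).
Proof. exact: (@measurable_tnth _ (measurableTypeR R) d i). Qed.

Lemma measurable_dotE : measurable_fun setT (fun z : E * E => dotE z.1 z.2).
Proof.
rewrite /dotE; apply: measurable_sum => i.
apply: measurable_funM.
  exact: (measurableT_comp (measurable_coord i) (@measurable_fst _ _ E E)).
exact: (measurableT_comp (measurable_coord i) (@measurable_snd _ _ E E)).
Qed.

Lemma measurable_normE : measurable_fun setT (@normE R d).
Proof.
have msq : measurable_fun setT (fun x : E => dotE x x).
  by apply: measurable_sum => i; apply: measurable_funM; exact: measurable_coord.
apply: (measurableT_comp _ msq).
by apply: continuous_measurable_fun; exact: sqrt_continuous.
Qed.

Lemma dotEl (x : E) : measurable_fun setT (dotE x).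
Proof. by apply: measurable_sum => i; apply: measurable_funM => //; exact: measurable_coord. Qed.

Lemma cintegrable_fourier (h : E -> R[i]) (x : E) : cintegrable leb h ->
  cintegrable leb (fun xi => expi (dotE x xi) * h xi).
Proof.
move=> ih; apply: (@cintegrableM_le _ _ _ _ _ _ 1) => //.
  by apply: cmeasurable_expi; exact: dotEl.
by move=> xi _; rewrite normc_expi.
Qed.

Lemma cmeasurable_inv_fourier1 (h : E -> R[i]) : cmeasurable h ->
  cmeasurable (inv_fourier1 h).
Proof.
move=> mh; apply: cmeasurableM; first exact: cmeasurable_cst.
apply: (@cmeasurable_cintegral _ _ _ E E leb
  (fun z => expi (dotE z.1 z.2) * h z.2)).
apply: cmeasurableM; first exact: cmeasurable_expi measurable_dotE.
have [m1 m2] := mh.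
by split; [exact: (measurableT_comp m1 (@measurable_snd _ _ E E))|
  exact: (measurableT_comp m2 (@measurable_snd _ _ E E))].
Qed.

Lemma inv_fourier1_0 (x : E) : inv_fourier1 (fun=> 0) x = 0.
Proof.
rewrite /inv_fourier1 (_ : (fun xi => _) = fun=> 0) ?cintegral0 ?mulr0//.
by apply/funext => xi; rewrite mulr0.
Qed.

(** For integrable [h] the square-integrable part of the decomposition is taken to be zero. Every
    profile used later is integrable, so all multiplier claims reduce to this case. *)
Lemma is_fourier_inv_fourier1 (h : E -> R[i]) : cintegrable leb h ->
  is_fourier (inv_fourier1 h) h.
Proof.
move=> ih; split.
  by apply: cmeasurable_inv_fourier1; exact: cintegrable_cmeasurable ih.
exists h, (fun=> 0), (fun=> 0); split => //.
- have sq0 : square_integrable leb (fun _ : E => 0 : R[i]).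
    split; first exact: cmeasurable_cst.
    rewrite integral0_eq// => x _; by rewrite normc0 expr0n.
  split => //.
  rewrite (_ : (fun n => _) = cst 0%E); first exact: cvg_cst.
  apply/funext => n; apply: integral0_eq => x _.
  rewrite (_ : (fun xi => _) = fun=> 0); last by apply/funext => xi; case: ifP.
  by rewrite inv_fourier1_0 subrr normc0 expr0n.
- by move=> xi; rewrite addr0.
- by apply: aeW => x; exact/esym/addr0.
Qed.

End inverse_fourier.

(** * Orthonormal waves built from grid cells *)

Section grid.
Context {R : realType} (d M : nat).
Hypothesis M0 : (0 < M)%N.
Local Notation E := (euclid R d).
Local Notation leb := (@lebesgueE R d).
Local Notation lebR := (@lebesgue_measure R).
Implicit Types (a b : d.-tuple nat) (S : seq (d.-tuple nat)).

Definition grid_itv (n : nat) : set R := `[n%:R / M%:R, n.+1%:R / M%:R[%classic.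

Definition grid_cell a : set E := boxE d (fun i => grid_itv (nth 0%N a i)).

Lemma measurable_grid_cell a : measurable (grid_cell a).
Proof. by apply: measurable_boxE => i; exact: measurable_itv. Qed.

Lemma lebesgueE_grid_cell a : leb (grid_cell a) = ((M%:R^-1) ^+ d)%:E.
Proof.
apply: (@lebesgueE_cube _ _ (fun i => (nth 0%N a i)%:R / M%:R)
  (fun i => (nth 0%N a i).+1%:R / M%:R)) => [i|]; last by rewrite invr_ge0.
by rewrite -mulrBl -natr1 addrC addKr mul1r.
Qed.

Lemma indic_grid_cell a (x : E) : (\1_(grid_cell a) x)%:C =
  \prod_(i < d) (\1_(grid_itv (nth 0%N a i)) (tnth x i))%:C :> R[i].
Proof.
rewrite -rmorph_prod; congr (_%:C); rewrite indicE.
have [|] := boolP (x \in grid_cell a).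
  rewrite inE => xa; rewrite big1// => i _; rewrite indicE mem_set//; exact: xa.
move=> xa; suff [i hi] : exists i : 'I_d, tnth x i \notin grid_itv (nth 0%N a i).
  by rewrite (bigD1 i)//= indicE (negbTE hi) mul0r.
apply/existsP; apply: contraNT xa; rewrite negb_exists => /forallP h.
by apply/mem_set => i; have := h i; rewrite negbK inE.
Qed.

Lemma integrable_grid_cell a : leb.-integrable setT (EFin \o (\1_(grid_cell a) : E -> R)).
Proof.
apply/integrableP; split.
  by apply/measurable_EFinP; apply: measurable_indic; exact: measurable_grid_cell.
under eq_integral => x _ do rewrite /= ger0_norm//.
rewrite integral_indic//; last exact: measurable_grid_cell.
by rewrite setIT /= lebesgueE_grid_cell ltry.
Qed.

Definition cell_wave a (x : E) : R[i] :=
  cintegral leb (fun xi => expi (dotE x xi) * (\1_(grid_cell a) xi)%:C).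

Lemma expi_dotE n (x y : euclid R n) :
  expi (dotE x y) = \prod_(i < n) expi (tnth x i * tnth y i).
Proof.
rewrite /dotE; elim/big_rec2: _ => [|i z w _ <-]; first exact: expi0.
exact: expiD.
Qed.

Lemma cell_waveE a (x : E) : cell_wave a x =
  \prod_(i < d) wave ((nth 0%N a i)%:R / M%:R) ((nth 0%N a i).+1%:R / M%:R) (tnth x i).
Proof.
pose F (i : nat) : measurableTypeR R -> R[i] :=
  plane_wave ((nth 0%N a i)%:R / M%:R) ((nth 0%N a i).+1%:R / M%:R) (nth 0 x i).
have iF i : cintegrable lebR (F i) by exact: cintegrable_plane_wave.
have [_ eF] := @cintegral_tensor _ d F iF.
transitivity (cintegral leb (fun xi : E => \prod_(i < d) F i (tnth xi i))); last first.
  by apply: (eq_trans eF); apply: eq_bigr => i _; rewrite /wave /F (tnth_nth 0).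
congr cintegral.
apply/funext => xi; rewrite expi_dotE indic_grid_cell -big_split/=.
by apply: eq_bigr => i _; rewrite /F /plane_wave (tnth_nth 0 x).
Qed.

(** The squared L^2 norm of [cell_wave], classically (2 pi / M)^d. *)
Definition cell_mass : R := (2 * versine_mass / M%:R) ^+ d.

Lemma cell_mass_gt0 : 0 < cell_mass.
Proof.
by rewrite exprn_gt0// divr_gt0 ?ltr0n// mulr_gt0// versine_mass_gt0.
Qed.

(** The inner product factors over the coordinates; distinct cells differ in some coordinate, and
    the factor of that coordinate is zero. *)
Lemma cell_wave_orthogonal a b :
  cintegrable leb (fun x => cell_wave a x * (cell_wave b x)^*) /\
  cintegral leb (fun x => cell_wave a x * (cell_wave b x)^*) =
    if a == b then cell_mass%:C else 0.
Proof.
pose F (i : nat) : measurableTypeR R -> R[i] :=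
  wave_product ((nth 0%N a i)%:R / M%:R) ((nth 0%N a i).+1%:R / M%:R)
               ((nth 0%N b i)%:R / M%:R) ((nth 0%N b i).+1%:R / M%:R).
have itv n : n%:R / M%:R < n.+1%:R / M%:R :> R.
  by rewrite ltr_pM2r ?invr_gt0 ?ltr0n// ltr_nat.
have iF i : cintegrable lebR (F i) by exact: cintegrable_wave_product.
have [i1 e1] := @cintegral_tensor _ d F iF.
have FE : (fun x => cell_wave a x * (cell_wave b x)^*) =
    (fun x : E => \prod_(i < d) F i (tnth x i)).
  by apply/funext => x; rewrite !cell_waveE rmorph_prod -big_split.
rewrite FE; split => //; rewrite e1.
under eq_bigr => i _ do rewrite /F cintegral_wave_grid//.
have [->|ab] := eqVneq a b.
  under eq_bigr do rewrite eqxx.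
  by rewrite prodr_const card_ord /cell_mass rmorphXn.
have [i hi] : exists i : 'I_d, nth 0%N a i != nth 0%N b i.
  apply/existsP; apply: contraNT ab; rewrite negb_exists => /forallP h.
  apply/eqP/eq_from_tnth => i; have := h i; rewrite negbK => /eqP.
  by rewrite -!tnth_nth.
by rewrite (bigD1 i)//= (negbTE hi) mul0r.
Qed.

(** The factor (2 pi)^d cancels the one in [inv_fourier1]; the square root normalises the sum of
    orthogonal cell waves. *)
Definition grid_profile S (xi : E) : R :=
  (2 * pi) ^+ d / Num.sqrt ((size S)%:R * cell_mass) *
    \sum_(a <- S) \1_(grid_cell a) xi.

Lemma cintegrable_indic_grid_cell a : cintegrable leb (fun xi => (\1_(grid_cell a) xi)%:C).
Proof. exact: cintegrable_real (integrable_grid_cell a). Qed.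

Lemma cintegrable_grid_profile S : cintegrable leb (fun xi => (grid_profile S xi)%:C).
Proof.
rewrite (_ : (fun xi => _) = (fun xi =>
    ((2 * pi) ^+ d / Num.sqrt ((size S)%:R * cell_mass))%:C *
      \sum_(a <- S) (\1_(grid_cell a) xi)%:C)); last first.
  by apply/funext => xi; rewrite /grid_profile rmorphM rmorph_sum.
apply: cintegrableZ; apply: cintegrable_sum => a.
exact: cintegrable_indic_grid_cell.
Qed.

Definition grid_wave S : E -> R[i] := inv_fourier1 (fun xi => (grid_profile S xi)%:C).

Lemma grid_waveE S x : grid_wave S x =
  ((Num.sqrt ((size S)%:R * cell_mass))^-1)%:C * \sum_(a <- S) cell_wave a x.
Proof.
rewrite /grid_wave /inv_fourier1.
rewrite (_ : (fun xi => _) = (fun xi =>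
    ((2 * pi) ^+ d / Num.sqrt ((size S)%:R * cell_mass))%:C *
      \sum_(a <- S) (expi (dotE x xi) * (\1_(grid_cell a) xi)%:C))); last first.
  apply/funext => xi; rewrite /grid_profile rmorphM rmorph_sum/= mulrCA.
  by rewrite mulr_sumr.
have ia a : cintegrable leb (fun xi => expi (dotE x xi) * (\1_(grid_cell a) xi)%:C).
  by apply: cintegrable_fourier; exact: cintegrable_indic_grid_cell.
rewrite cintegralZ; last exact: cintegrable_sum.
rewrite cintegral_sum// mulrA -rmorphM/=; congr (_%:C * _).
by rewrite mulrA mulVf ?mul1r// expf_neq0// mulf_neq0// gt_eqF// pi_gt0.
Qed.

Lemma grid_wave_inner S S' :
  cintegrable leb (fun x => grid_wave S x * (grid_wave S' x)^*) /\
  cintegral leb (fun x => grid_wave S x * (grid_wave S' x)^*) =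
    ((Num.sqrt ((size S)%:R * cell_mass))^-1 *
     (Num.sqrt ((size S')%:R * cell_mass))^-1)%:C *
    \sum_(a <- S) \sum_(b <- S') if a == b then cell_mass%:C else 0.
Proof.
have -> : (fun x => grid_wave S x * (grid_wave S' x)^*) = (fun x =>
   ((Num.sqrt ((size S)%:R * cell_mass))^-1 *
     (Num.sqrt ((size S')%:R * cell_mass))^-1)%:C *
    \sum_(a <- S) \sum_(b <- S') (cell_wave a x * (cell_wave b x)^*)).
  have cM (z w : R[i]) : Num.conj (z * w) = Num.conj z * Num.conj w by exact: rmorphM.
  have cR (c : R) : Num.conj c%:C = c%:C by exact: conjc_real.
  have rM (z w : R) : (z * w)%:C = z%:C * w%:C :> R[i] by exact: rmorphM.
  apply/funext => x; have cS : Num.conj (\sum_(b <- S') cell_wave b x) =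
    \sum_(b <- S') Num.conj (cell_wave b x) by exact: rmorph_sum.
  rewrite !grid_waveE cM cS cR mulrACA rM; congr (_ * _).
  by rewrite mulr_suml; apply: eq_bigr => a _; rewrite mulr_sumr.
have io a b := proj1 (cell_wave_orthogonal a b).
have is1 : cintegrable leb (fun x => \sum_(a <- S) \sum_(b <- S')
    (cell_wave a x * (cell_wave b x)^*)).
  by apply: cintegrable_sum => a; apply: cintegrable_sum => b; exact: io.
split; first exact: cintegrableZ.
rewrite cintegralZ//; congr (_ * _).
rewrite cintegral_sum; last by move=> a; apply: cintegrable_sum => b; exact: io.
apply: eq_bigr => a _; rewrite cintegral_sum//.
by apply: eq_bigr => b _; rewrite (proj2 (cell_wave_orthogonal a b)).
Qed.

Lemma orthonormal_grid_wave (S : nat -> seq (d.-tuple nat)) :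
  (forall j, uniq (S j)) -> (forall j, S j != [::]) ->
  (forall j k a, a \in S j -> a \in S k -> j = k) ->
  orthonormalL2 (fun j => grid_wave (S j)).
Proof.
move=> uS S0 dS; have m0 := cell_mass_gt0.
split=> [j|j k].
  split.
    apply: cmeasurable_inv_fourier1; apply: cintegrable_cmeasurable.
    exact: cintegrable_grid_profile.
  have [[iR _] _] := grid_wave_inner (S j) (S j).
  have /integrableP[_] := iR; apply: le_lt_trans.
  apply: ge0_le_integral_nonmeasurable => x _; first by rewrite lee_fin sqr_ge0.
  by rewrite -normc_sqr /= lee_fin ler_norm.
rewrite (proj2 (grid_wave_inner _ _)); have [<-|jk] := eqVneq j k.
  have -> : \sum_(a <- S j) \sum_(b <- S j) (if a == b then cell_mass%:C else 0) =
      ((size (S j))%:R * cell_mass)%:C :> R[i].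
    transitivity (\sum_(a <- S j) cell_mass%:C : R[i]).
      apply: eq_big_seq => a aS; rewrite (bigD1_seq a)//= eqxx big1 ?addr0// => b.
      by rewrite eq_sym => /negbTE ->.
    rewrite big_const_seq count_predT iter_addr_0 -rmorphMn/=; congr (_%:C).
    by rewrite mulr_natl.
  rewrite -rmorphM/= -invfM -expr2 sqr_sqrtr; last by rewrite mulr_ge0// ltW.
  rewrite mulVf//; apply: mulf_neq0; last by rewrite gt_eqF.
  by rewrite pnatr_eq0 size_eq0; exact: S0.
rewrite big1_seq ?mulr0// => a /= aSj; rewrite big1_seq// => b /= bSk.
by case: eqP => // ab; case/eqP: jk; apply: (dS _ _ a) => //; rewrite ab.
Qed.

End grid.

Section grid_evolution.
Context {R : realType} (d M : nat).
Hypothesis M0 : (0 < M)%N.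
Local Notation E := (euclid R d).
Local Notation leb := (@lebesgueE R d).
Variables (s : R) (S : seq (d.-tuple nat)).
Hypothesis s0 : 0 <= s.
Hypothesis S1 : forall a, a \in S -> exists i : 'I_d, (0 < tnth a i)%N.
Local Notation profile := (grid_profile (R := R) M S).

Lemma le_coord_normE (x : E) (i : 'I_d) : `|tnth x i| <= normE x.
Proof.
rewrite /normE /dotE -sqrtr_sqr ler_wsqrtr// (bigD1 i)//= expr2 lerDl.
by apply: sumr_ge0 => j _; rewrite -expr2 sqr_ge0.
Qed.

Lemma grid_profile_ge0 xi : 0 <= profile xi.
Proof.
rewrite mulr_ge0//; last by apply: sumr_ge0 => a _; rewrite indicE ler0n.
by rewrite divr_ge0 ?sqrtr_ge0// exprn_ge0// mulr_ge0// pi_ge0.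
Qed.

Lemma grid_profile_neq0 xi : profile xi != 0 -> exists2 a, a \in S & grid_cell M a xi.
Proof.
rewrite mulf_eq0 negb_or => /andP[_]; apply: contraNP => h.
rewrite big1_seq// => a /= aS; rewrite indicE memNset// => xa.
by apply: h; exists a.
Qed.

(** A positive coordinate index in each cell keeps the support at distance 1/M from the origin,
    where |xi|^(-s) is singular. *)
Lemma grid_profile_support xi : profile xi != 0 -> M%:R^-1 <= normE xi.
Proof.
move=> /grid_profile_neq0[a aS xa]; have [i ai] := S1 aS.
apply: le_trans (le_coord_normE xi i); apply: le_trans (ler_norm _).
have := xa i; rewrite /grid_itv/= in_itv/= -tnth_nth => /andP[+ _].
apply: le_trans; rewrite -[leLHS]mul1r ler_pM2r ?invr_gt0 ?ltr0n//.
by rewrite ler1n.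
Qed.

Definition sobolev_profile (xi : E) : R[i] := (normE xi `^ (- s))%:C * (profile xi)%:C.

Lemma cintegrable_sobolev_profile : cintegrable leb sobolev_profile.
Proof.
have Mp : 0 < M%:R^-1 :> R by rewrite invr_gt0 ltr0n.
apply: (@cintegrableM_le _ _ _ _ _ _ (M%:R^-1 `^ (- s))).
- exact: powR_ge0.
- apply: cmeasurable_real.
  exact: (measurableT_comp (measurable_powR (- s)) (@measurable_normE R d)).
- exact: cintegrable_grid_profile.
move=> xi pxi; rewrite normc_real ger0_norm ?powR_ge0// !powRN.
have hx : M%:R^-1 <= normE xi.
  by apply: grid_profile_support; apply: contraNneq pxi => ->.
rewrite lef_pV2 ?posrE ?powR_gt0//; last exact: lt_le_trans hx.
by rewrite ge0_ler_powR// ?nnegrE ?(ltW Mp)// ltW// (lt_le_trans Mp).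
Qed.

Definition sobolev_wave : E -> R[i] := inv_fourier1 sobolev_profile.

Definition evolved_profile (t : R) (xi : E) : R[i] :=
  expi (- (t * normE xi ^+ 2)) * sobolev_profile xi.

Definition evolved_wave (t : R) : E -> R[i] := inv_fourier1 (evolved_profile t).

Lemma cintegrable_evolved_profile t : cintegrable leb (evolved_profile t).
Proof.
apply: (@cintegrableM_le _ _ _ _ _ _ 1) => //.
- apply: cmeasurable_expi; apply: measurable_funN; apply: measurable_funM => //.
  by apply: measurable_funX; exact: measurable_normE.
- exact: cintegrable_sobolev_profile.
- by move=> xi _; rewrite normc_expi.
Qed.

Lemma is_fractional_grid_wave : is_fractional (- s) (grid_wave M S) sobolev_wave.
Proof.
exists (fun xi => (profile xi)%:C).
  by apply: is_fourier_inv_fourier1; exact: cintegrable_grid_profile.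
by apply: is_fourier_inv_fourier1; exact: cintegrable_sobolev_profile.
Qed.

Lemma is_schrodinger_evolved_wave t : is_schrodinger t sobolev_wave (evolved_wave t).
Proof.
exists sobolev_profile.
  by apply: is_fourier_inv_fourier1; exact: cintegrable_sobolev_profile.
by apply: is_fourier_inv_fourier1; exact: cintegrable_evolved_profile.
Qed.

Lemma Rintegral_grid_profile : \int[leb]_xi profile xi =
  (2 * pi) ^+ d / Num.sqrt ((size S)%:R * cell_mass d M) * ((size S)%:R * M%:R^-1 ^+ d).
Proof.
rewrite /grid_profile.
have is1 : leb.-integrable setT (EFin \o (fun xi : E => \sum_(a <- S) \1_(grid_cell M a) xi)).
  rewrite (_ : _ \o _ = (fun xi => \sum_(a <- S) (\1_(grid_cell M a) xi)%:E)%E).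
    by apply: integrable_sum => // a _; exact: integrable_grid_cell.
  by apply/funext => xi /=; rewrite sumEFin.
rewrite RintegralZl//; congr (_ * _).
rewrite /Rintegral (_ : (fun xi => _) = (fun xi => \sum_(a <- S) (\1_(grid_cell M a) xi)%:E)%E);
  last first.
  by apply/funext => xi; rewrite sumEFin.
rewrite integral_sum//; last by move=> a; exact: integrable_grid_cell.
rewrite (eq_bigr (fun=> (M%:R^-1 ^+ d)%:E)); last first.
  move=> a _; rewrite integral_indic//; last exact: measurable_grid_cell.
  by rewrite setIT /= lebesgueE_grid_cell.
by rewrite sumEFin/= big_const_seq count_predT iter_addr_0 mulr_natl.
Qed.

(* On a class of cells where the phase oscillates by less than one radian there
   is no cancellation in the oscillatory integral. *)
Lemma evolved_wave_ge (t : R) (x : E) (L phase : R) : (0 < size S)%N -> 0 < L ->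
  (forall a xi, a \in S -> grid_cell M a xi -> normE xi <= L) ->
  (forall a xi, a \in S -> grid_cell M a xi ->
     `|dotE x xi - t * normE xi ^+ 2 - phase| <= 1) ->
  4^-1 * (L `^ (- s)) ^+ 2 * ((size S)%:R * M%:R^-1 ^+ d) / (2 * versine_mass) ^+ d <=
    normc (evolved_wave t x) ^+ 2.
Proof.
move=> S0 L0 hL hphase; have m0 := @cell_mass_gt0 R d M M0.
have J0 := @versine_mass_gt0 R.
have pid : 0 < (2 * pi : R) ^+ d by rewrite exprn_gt0// mulr_gt0// pi_gt0.
have Sr : 0 < (size S)%:R :> R by rewrite ltr0n.
have Mr : 0 < M%:R^-1 ^+ d :> R by rewrite exprn_gt0// invr_gt0 ltr0n.
pose G xi := expi (dotE x xi) * evolved_profile t xi.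
have iG : cintegrable leb G.
  by apply: cintegrable_fourier; exact: cintegrable_evolved_profile.
pose w xi := cos (dotE x xi - t * normE xi ^+ 2 - phase) * (normE xi `^ (- s) * profile xi).
have ReG xi : complex.Re (expi (- phase) * G xi) = w xi.
  rewrite /G /evolved_profile /sobolev_profile -[_%:C * _%:C]rmorphM.
  rewrite mulrA -expiD mulrA -expiD.
  by rewrite cReM /= mulr0 subr0 /w; congr (cos _ * _); ring.
have iZ := cintegrableZ (expi (- phase)) iG.
(* Rotation by the common phase preserves the modulus of the integral; afterwards the cosine is at
   least 1/2 on the support, and |xi|^(-s) >= L^(-s) because s >= 0. *)
have low : 2^-1 * L `^ (- s) * \int[leb]_xi profile xi <= normc (cintegral leb G).
  have -> : normc (cintegral leb G) = normc (expi (- phase) * cintegral leb G).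
    by rewrite normcM normc_expi mul1r.
  rewrite -cintegralZ//.
  apply: le_trans (Re_le_normc _); rewrite Re_cintegral.
  have ip : leb.-integrable setT (EFin \o profile).
    by have [] := @cintegrable_grid_profile R d M S.
  rewrite -RintegralZl//; apply: le_Rintegral => //.
  - exact: (integrableZl measurableT (2^-1 * L `^ (- s)) ip).
  - by have [] := iZ.
  move=> xi _; rewrite ReG /w.
  have [->|pxi] := eqVneq (profile xi) 0; first by rewrite !mulr0.
  have [a aS xa] := grid_profile_neq0 pxi.
  rewrite -[leLHS]mulrA; apply: ler_pM => //.
  - by rewrite mulr_ge0 ?powR_ge0// grid_profile_ge0.
  - by apply: cos_ge_half; exact: hphase aS xa.
  apply: ler_wpM2r; first exact: grid_profile_ge0.
  have n0 : 0 < normE xi.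
    by apply: lt_le_trans (grid_profile_support pxi); rewrite invr_gt0 ltr0n.
  rewrite !powRN lef_pV2 ?posrE ?powR_gt0//.
  by rewrite ge0_ler_powR// ?nnegrE ?(ltW n0) ?(ltW L0)//; exact: hL aS xa.
rewrite Rintegral_grid_profile in low.
have -> : normc (evolved_wave t x) = ((2 * pi) ^+ d)^-1 * normc (cintegral leb G).
  rewrite /evolved_wave /inv_fourier1 normcM normc_real ger0_norm//.
  by rewrite invr_ge0 ltW.
set A := normc _ in low *; set q := Num.sqrt _ in low.
have q0 : 0 < q by rewrite sqrtr_gt0 mulr_gt0.
have qq : q ^+ 2 = (size S)%:R * cell_mass d M by rewrite sqr_sqrtr// ltW// mulr_gt0.
have low2 : 2^-1 * L `^ (- s) * ((size S)%:R * M%:R^-1 ^+ d) / q <=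
    ((2 * pi) ^+ d)^-1 * A.
  rewrite ler_pdivlMl//; apply: le_trans low; rewrite le_eqVlt; apply/orP; left.
  by apply/eqP; field; rewrite gt_eqF.
have pos : 0 <= 2^-1 * L `^ (- s) * ((size S)%:R * M%:R^-1 ^+ d) / q.
  by rewrite divr_ge0 ?(ltW q0)// !mulr_ge0 ?powR_ge0// ltW.
have := lerXn2r 2 pos (le_trans pos low2) low2.
apply: le_trans; rewrite le_eqVlt; apply/orP; left; apply/eqP.
have massE : cell_mass d M = (2 * versine_mass) ^+ d * M%:R^-1 ^+ d :> R.
  by rewrite /cell_mass exprMn.
set l := L `^ _; set n : R := (size S)%:R in Sr qq *.
set m := M%:R^-1 ^+ d in Mr massE *; set K := (2 * versine_mass) ^+ d in massE *.
have K0 : 0 < K by rewrite exprn_gt0// mulr_gt0.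
(* With n cells of volume m the integral of the profile squares to (n m)^2 / (n K m), up to
   constants. The result is linear in n, which makes the bound additive over cells. *)
transitivity (4^-1 * l ^+ 2 * (n * m) ^+ 2 / q ^+ 2).
  rewrite qq massE; clearbody l n m K; field.
  by rewrite !gt_eqF.
by clearbody l n m q; field; rewrite gt_eqF.
Qed.

End grid_evolution.

(** * Classes of frequency cells *)

Section frequency_cells.
Local Open Scope nat_scope.

Fixpoint tuples_over (d : nat) (s : seq nat) : seq (d.-tuple nat) :=
  match d with
  | 0 => [:: [tuple]]
  | d'.+1 => [seq cons_tuple x y | x <- s, y <- tuples_over d' s]
  end.

Lemma size_tuples_over d s : size (tuples_over d s) = size s ^ d.
Proof. by elim: d => //= d IH; rewrite size_allpairs IH expnS. Qed.

Lemma mem_tuples_over d s (a : d.-tuple nat) :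
  (a \in tuples_over d s) = all (mem s) a.
Proof.
elim: d a => [|d IH] a /=; first by rewrite (tuple0 a) mem_seq1; apply/eqP.
apply/allpairsP/idP => [[[x y] /= [xs ys ->]]|].
  by rewrite /= xs -IH.
case/tupleP: a => x y /= /andP[xs ys]; exists (x, y) => /=; split => //.
by rewrite IH.
Qed.

Lemma uniq_tuples_over d s : uniq s -> uniq (tuples_over d s).
Proof.
move=> us; elim: d => //= d IH; apply: allpairs_uniq => // -[x y] [x' y'] _ _ /=.
by move=> /(congr1 val)/= [-> /val_inj ->].
Qed.

Section cell_classes.
Variables (d M N : nat).
Hypotheses (d0 : 0 < d) (M0 : 0 < M).
Implicit Types (a : d.-tuple nat) (k : nat).

Definition layer_cells k := tuples_over d (iota (M * 2 ^ k) (M * 2 ^ k)).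

Definition cells := undup (flatten [seq layer_cells k | k <- iota 0 N]).

(* The unit cube containing the cell and the integer part of |xi|^2 at its corner:
   on the union of the cells sharing a key the phase x.xi - t |xi|^2 is nearly
   constant for small x and t. *)
Definition cell_key a : seq nat * nat :=
  ([seq m %/ M | m <- a], (\sum_(m <- a) m ^ 2) %/ M ^ 2).

(** All coordinates of a cell lie in the same dyadic interval, so the first one already determines
    the scale; this asks for d > 0. *)
Definition key_scale (c : seq nat * nat) : nat := trunc_log 2 (head 0 c.1).

Definition keys := undup [seq cell_key a | a <- cells].

(* An orthonormal system is indexed by all of nat: each index beyond the keys gets
   a single cell outside the dyadic layers, and weight 0 in class_weight. *)
Definition filler (j : nat) : d.-tuple nat := nseq_tuple d (M * 2 ^ N + j).

Definition cell_class j :=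
  if j < size keys then [seq a <- cells | cell_key a == nth ([::], 0) keys j]
  else [:: filler j].

Lemma mem_layer_cells k a :
  reflect (forall i : 'I_d, M * 2 ^ k <= tnth a i < M * 2 ^ k.+1) (a \in layer_cells k).
Proof.
rewrite mem_tuples_over; apply: (iffP all_tnthP) => h i; have := h i;
  by rewrite /= mem_iota expnS mul2n -addnn mulnDr.
Qed.

Lemma mem_cells a : reflect (exists2 k, k < N & a \in layer_cells k) (a \in cells).
Proof.
rewrite mem_undup; apply: (iffP flatten_mapP).
  by move=> [k]; rewrite mem_iota /= add0n => kN ak; exists k.
by move=> [k kN ak]; exists k => //; rewrite mem_iota.
Qed.

Lemma key_scale_layer k a : a \in layer_cells k -> key_scale (cell_key a) = k.
Proof.
move=> /mem_layer_cells ak; rewrite /key_scale /=.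
have -> : head 0 [seq m %/ M | m <- a] = tnth a (Ordinal d0) %/ M.
  by rewrite -nth0 (nth_map 0) ?size_tuple// (tnth_nth 0).
apply: trunc_log_eq => //; have /andP[h1 h2] := ak (Ordinal d0).
rewrite leq_divRL// ltn_divLR//; apply/andP; split; first by rewrite mulnC.
by rewrite mulnC.
Qed.

Lemma mem_layer_of_key a j : j < size keys -> a \in cell_class j ->
  a \in layer_cells (key_scale (nth ([::], 0) keys j)).
Proof.
move=> jJ; rewrite /cell_class jJ mem_filter => /andP[/eqP <-].
by move=> /mem_cells[k kN ak]; rewrite (key_scale_layer ak).
Qed.

Lemma key_scale_lt j : j < size keys -> key_scale (nth ([::], 0) keys j) < N.
Proof.
move=> jJ; have := mem_nth ([::], 0) jJ; rewrite mem_undup => /mapP[a + ->].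
by move=> /mem_cells[k kN ak]; rewrite (key_scale_layer ak).
Qed.

Lemma uniq_cell_class j : uniq (cell_class j).
Proof. by rewrite /cell_class; case: ifP => // _; rewrite filter_uniq// undup_uniq. Qed.

Lemma cell_class_neq0 j : cell_class j != [::].
Proof.
rewrite /cell_class; case: ifP => // jJ; rewrite -size_eq0 size_filter -lt0n -has_count.
have := mem_nth ([::], 0) jJ; rewrite mem_undup => /mapP[a ac ->].
by apply/hasP; exists a.
Qed.

Lemma cell_class_gt0 j a : a \in cell_class j -> exists i : 'I_d, 0 < tnth a i.
Proof.
case: (ltnP j (size keys)) => jJ.
  move=> /(mem_layer_of_key jJ)/mem_layer_cells ak; exists (Ordinal d0).
  have /andP[+ _] := ak (Ordinal d0); apply: leq_trans.
  by rewrite muln_gt0 M0 expn_gt0.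
rewrite /cell_class ltnNge jJ /= inE => /eqP ->; exists (Ordinal d0).
by rewrite tnth_nseq addn_gt0 muln_gt0 M0 expn_gt0.
Qed.

Lemma cell_class_disjoint j k a : a \in cell_class j -> a \in cell_class k -> j = k.
Proof.
have fill_not j' : filler j' \notin cells.
  apply/negP => /mem_cells[l lN /mem_layer_cells/(_ (Ordinal d0))/andP[_]].
  rewrite tnth_nseq ltnNge => /negP; apply; apply: (@leq_trans (M * 2 ^ N)).
    by rewrite leq_pmul2l// leq_exp2l.
  exact: leq_addr.
rewrite /cell_class; case: ifP => [jJ|_]; case: ifP => [kJ|_].
- rewrite !mem_filter => /andP[/eqP -> _] /andP[/eqP /esym/eqP + _].
  by rewrite nth_uniq ?undup_uniq// => /eqP.
- rewrite mem_filter => /andP[_ ac]; rewrite inE => /eqP aE.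
  by have := fill_not k; rewrite -aE ac.
- rewrite inE => /eqP aE; rewrite mem_filter => /andP[_ ac].
  by have := fill_not j; rewrite -aE ac.
rewrite !inE => /eqP -> /eqP/(congr1 (fun a => tnth a (Ordinal d0))).
by rewrite !tnth_nseq => /addnI.
Qed.

(** There are 2^(i d) possible integer parts n. Given n, the second component exceeds |n|^2 by less
    than 4 d 2^i, since (n_j + 1)^2 - n_j^2 = 2 n_j + 1 <= 4 2^i. *)
Lemma count_keys_layer i :
  count (fun c => key_scale c == i) keys <= 4 * d * (2 ^ d.+1) ^ i.
Proof.
pose L := [seq (tval n, \sum_(m <- tval n) m ^ 2 + p) |
  n <- tuples_over d (iota (2 ^ i) (2 ^ i)), p <- iota 0 (4 * d * 2 ^ i)].
have szL : size L = 4 * d * (2 ^ d.+1) ^ i.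
  rewrite size_allpairs size_tuples_over !size_iota -!expnM mulnCA -expnD.
  by congr (_ * 2 ^ _); lia.
rewrite -szL -size_filter; apply: uniq_leq_size.
  by rewrite filter_uniq// undup_uniq.
move=> c; rewrite mem_filter mem_undup => /andP[ci /mapP[a ac cE]].
move/mem_cells: ac => [k kN ak]; move: ci; rewrite cE (key_scale_layer ak) => /eqP ki.
move/mem_layer_cells: ak; rewrite {}ki => ak.
pose n := [tuple of [seq m %/ M | m <- a]].
have nE j : tnth n j = tnth a j %/ M by rewrite tnth_map.
have nbox j : 2 ^ i <= tnth n j < 2 ^ i.+1.
  rewrite nE leq_divRL// ltn_divLR// ![2 ^ _ * M]mulnC; exact: ak.
have M20 : 0 < M ^ 2 by rewrite expn_gt0 M0.
apply/allpairsP; exists (n, (\sum_(m <- a) m ^ 2) %/ M ^ 2 - \sum_(m <- n) m ^ 2) => /=.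
have lo : \sum_(m <- n) m ^ 2 <= (\sum_(m <- a) m ^ 2) %/ M ^ 2.
  rewrite leq_divRL// !big_tuple big_distrl/=; apply: leq_sum => j _.
  by rewrite -expnMn nE leq_exp2r// leq_divM.
split.
- rewrite mem_tuples_over; apply/all_tnthP => j; rewrite /= mem_iota.
  by have := nbox j; rewrite expnS mul2n -addnn.
- rewrite mem_iota /= add0n ltn_subLR// ltn_divLR// !big_tuple.
  apply: (@leq_trans (\sum_(j < d) (tnth n j).+1 ^ 2 * M ^ 2)).
    (* The inequality to prove is strict; its extra unit is absorbed by the d >= 1 units on the
       right. *)
    apply: (@leq_trans (\sum_(j < d) ((tnth a j) ^ 2).+1)).
      under [X in _ <= X]eq_bigr do rewrite -addn1.
      by rewrite big_split/= sum1_card card_ord -addn1 leq_add2l.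
    apply: leq_sum => j _; rewrite -expnMn ltn_exp2r// nE.
    by rewrite -ltn_divLR.
  rewrite -big_distrl/= leq_pmul2r//.
  apply: (@leq_trans (\sum_(j < d) (tnth n j ^ 2 + 4 * 2 ^ i))).
    apply: leq_sum => j _; have := nbox j; rewrite expnS => /andP[_ h].
    by rewrite -addn1 sqrnD exp1n muln1; lia.
  by rewrite big_split/= sum_nat_const card_ord mulnA [d * 4]mulnC.
by rewrite subnKC.
Qed.

(** The ratio 2^(d+1) is at least 2, so the geometric sum over lower scales is at most its next term
    and the constant 4 d persists. *)
Lemma count_keys_below k :
  count (fun c => key_scale c < k) keys <= 4 * d * (2 ^ d.+1) ^ k.
Proof.
have B2 : 2 <= 2 ^ d.+1 by rewrite expnS leq_pmulr// expn_gt0.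
suff h : count (fun c => key_scale c < k) keys <= 4 * d * \sum_(i < k) (2 ^ d.+1) ^ i.
  apply: leq_trans h _; rewrite leq_mul2l; apply/orP; right.
  elim: k => [|k IH]; first by rewrite big_ord0.
  rewrite big_ord_recr/=; apply: leq_trans (leq_add IH (leqnn _)) _.
  by rewrite addnn -mul2n [X in _ <= X]expnS leq_mul2r B2 orbT.
elim: k => [|k IH]; first by rewrite (eq_count (a2 := pred0)) ?count_pred0.
rewrite big_ord_recr/= mulnDr; apply: leq_trans (leq_add IH (count_keys_layer k)).
rewrite -(@count_predUI _ (fun c => key_scale c < k)) [leqRHS]addnC -[leqLHS]add0n.
rewrite leq_add// sub_count// => c /=.
by rewrite ltnS leq_eqVlt orbC.
Qed.

End cell_classes.

End frequency_cells.

(** Without absolute convergence [abs_integral] is +oo and there is nothing to prove, so lower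
    bounds never require integrability. *)
Lemma abs_integral_ge (R : realType) (disp : measure_display) (T : measurableType disp)
    (mu : {measure set T -> \bar R}) (f : T -> R[i]) (b : R) :
  (b%:E <= \int[mu]_x (complex.Re (f x))%:E)%E -> (b%:E <= abs_integral mu f)%E.
Proof.
move=> h; rewrite /abs_integral; case: asboolP => [[iR iI]|_]; last exact: leey.
rewrite lee_fin; apply: le_trans (Re_le_normc _).
rewrite Re_cintegral -lee_fin /Rintegral fineK//.
exact: integrable_fin_num.
Qed.

Lemma counting_le (R : realType) (A : set nat) (s : seq nat) :
  (forall j, A j -> j \in s) -> (@counting nat R A <= (size s)%:R%:E)%E.
Proof.
move=> As; have fA : finite_set A.
  by apply: (sub_finite_set (B := [set` s])) => //; exact: finite_seq.
rewrite /counting asboolT// lee_fin ler_nat.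
apply: uniq_leq_size (finmap.fset_uniq _) _ => j.
by rewrite in_fset_set// => /set_mem/As.
Qed.

Lemma linear_not_le_power (R : realType) (a b kappa : R) : 0 < a -> 0 <= kappa < 1 ->
  ~ (forall N : nat, (0 < N)%N -> a * N%:R <= b * N%:R `^ kappa).
Proof.
move=> a0 /andP[k0 k1] h.
have k' : 0 < 1 - kappa by rewrite subr_gt0.
have b0 : 0 < b.
  by have := h 1%N isT; rewrite powR1 !mulr1; exact: lt_le_trans.
(* The value at which a x = b x^kappa; any integer beyond it contradicts the assumed inequality.
   Positivity of [b] comes from N = 1. *)
set x := (b / a) `^ (1 - kappa)^-1.
have x0 : 0 <= x by exact: powR_ge0.
pose N := (Num.truncn x).+1.
have xN : x < N%:R by exact: truncnS_gt.
have N0 : 0 < N%:R :> R by rewrite ltr0n.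
have := h N isT.
have NE : N%:R = N%:R `^ kappa * N%:R `^ (1 - kappa) :> R.
  rewrite -powRD; last by rewrite (gt_eqF N0) implybT.
  by rewrite addrC subrK powRr1// ltW.
have Nk : 0 < N%:R `^ kappa :> R by rewrite powR_gt0.
rewrite {1}NE mulrCA [b * _]mulrC ler_pM2l// -ler_pdivlMl// mulrC => hN.
have : x `^ (1 - kappa) < N%:R `^ (1 - kappa).
  by apply: gt0_ltr_powR; rewrite // nnegrE ltW.
rewrite /x -powRrM mulVf ?gt_eqF// powRr1; last by rewrite divr_ge0// ltW.
by rewrite ltNge hN.
Qed.

Lemma succ_sqr_le u v : (u < v -> u.+1 ^ 2 <= u ^ 2 + 2 * v)%N.
Proof. by rewrite -addn1 sqrnD exp1n muln1; lia. Qed.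

(** * Size and phase on a frequency class *)

Section class_geometry.
Context {R : realType} (d N : nat).
Hypothesis d0 : (0 < d)%N.
(** With this fineness |xi|^2 varies by at most 1 on a cell of frequency up to 2^N: in each of d
    coordinates the square grows by at most 2 2^N / M. *)
Let M := (2 * d * 2 ^ N)%N.
Local Notation E := (euclid R d).
Local Notation key_ := (nth ([::], 0%N) (keys d M N)).

Let M0 : (0 < M)%N. Proof. by rewrite !muln_gt0 d0 expn_gt0. Qed.
Let Mr : 0 < M%:R :> R. Proof. by rewrite ltr0n. Qed.

Lemma grid_coord (a : d.-tuple nat) (xi : E) (i : 'I_d) : grid_cell M a xi ->
  (tnth a i)%:R / M%:R <= tnth xi i < (tnth a i).+1%:R / M%:R.
Proof. by move=> /(_ i); rewrite /grid_itv/= in_itv/= -tnth_nth. Qed.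

Variables (j : nat) (a : d.-tuple nat) (xi : E).
Hypotheses (jJ : (j < size (keys d M N))%N) (aj : a \in cell_class d M N j).
Hypothesis xa : grid_cell M a xi.
Let k := key_scale (key_ j).

Let ak (i : 'I_d) : (M * 2 ^ k <= tnth a i < M * 2 ^ k.+1)%N.
Proof. by move: i; exact/mem_layer_cells/(mem_layer_of_key d0 M0). Qed.

Let keyE : cell_key M a = key_ j.
Proof. by move: aj; rewrite /cell_class jJ mem_filter => /andP[/eqP]. Qed.

Lemma class_normE_le : normE xi <= (2 * d%:R) * 2 ^+ k.
Proof.
have xb (i : 'I_d) : 0 <= tnth xi i <= 2 ^+ k.+1.
  have /andP[h1 h2] := grid_coord i xa; have /andP[_ h3] := ak i.
  rewrite (le_trans _ h1) ?divr_ge0//=; apply/ltW/(lt_le_trans h2).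
  by rewrite ler_pdivrMr// -natrX -natrM ler_nat mulnC.
have d1 : 1 <= d%:R :> R by rewrite ler1n.
have h0 : 0 <= 2 * d%:R * 2 ^+ k :> R by rewrite !mulr_ge0.
rewrite -[leRHS]ger0_norm// -sqrtr_sqr ler_wsqrtr//.
apply: (@le_trans _ _ (\sum_(i < d) (2 ^+ k.+1) ^+ 2)).
  apply: ler_sum => i _; have /andP[x0 x1] := xb i.
  by rewrite -expr2 lerXn2r ?nnegrE.
rewrite sumr_const card_ord -[leLHS]mulr_natl (exprS (2 : R) k).
have -> : (2 * d%:R * 2 ^+ k) ^+ 2 = d%:R ^+ 2 * (2 * 2 ^+ k) ^+ 2 :> R by ring.
by rewrite ler_wpM2r ?exprn_ge0 ?mulr_ge0// expr2 ler_peMr.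
Qed.

(** The phase at the integer part of xi, with |xi|^2 replaced by P + 1, where P is the second key
    component. This is the midpoint of [P, P + 2], which contains |xi|^2 on the whole class: one
    unit for the integer part, one for the variation within a cell. *)
Definition class_phase (t : R) (x : E) : R :=
  \sum_(i < d) tnth x i * (nth 0%N (key_ j).1 i)%:R - t * ((key_ j).2%:R + 1).

(** The linear part deviates by at most d times 1/(2 d) = 1/2, as each fractional part is at most 1.
    The quadratic part deviates by at most t <= 1/2. This fixes the size 1/(2 d) of the box. *)
Lemma class_phase_le (t : R) (x : E) : 0 <= t <= (2 * d%:R)^-1 ->
  (forall i, 0 <= tnth x i <= (2 * d%:R)^-1) ->
  `|dotE x xi - t * normE xi ^+ 2 - class_phase t x| <= 1.
Proof.
move=> /andP[t0 te] xe; have d1 : 1 <= d%:R :> R by rewrite ler1n.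
have dr : 0 < d%:R :> R by rewrite ltr0n.
have hn (i : 'I_d) : 0 <= tnth xi i - (nth 0%N (key_ j).1 i)%:R <= 1.
  rewrite -keyE /= (nth_map 0%N) ?size_tuple// -tnth_nth.
  have /andP[h1 h2] := grid_coord i xa.
  have q1 : (tnth a i %/ M)%:R <= (tnth a i)%:R / M%:R :> R.
    by rewrite ler_pdivlMr// -natrM ler_nat leq_divM.
  have q2 : (tnth a i).+1%:R / M%:R <= (tnth a i %/ M)%:R + 1 :> R.
    by rewrite ler_pdivrMr// natr1 -natrM ler_nat -ltn_divLR.
  by apply/andP; split; lra.
have hlin : 0 <= dotE x xi - \sum_(i < d) tnth x i * (nth 0%N (key_ j).1 i)%:R <= 2^-1.
  rewrite /dotE -sumrB; apply/andP; split.
    apply: sumr_ge0 => i _; rewrite -mulrBr mulr_ge0//.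
      by have /andP[] := xe i.
    by have /andP[] := hn i.
  apply: (@le_trans _ _ (\sum_(i < d) (2 * d%:R)^-1)).
    apply: ler_sum => i _; rewrite -mulrBr -[leRHS]mulr1.
    by have /andP[? ?] := xe i; have /andP[? ?] := hn i; apply: ler_pM.
  by rewrite sumr_const card_ord -mulr_natl le_eqVlt; apply/orP; left; apply/eqP;
    field; rewrite gt_eqF.
have normE2 : normE xi ^+ 2 = \sum_(i < d) tnth xi i ^+ 2.
  rewrite sqr_sqrtr; first by apply: eq_bigr => i _; rewrite expr2.
  by apply: sumr_ge0 => i _; rewrite -expr2 sqr_ge0.
pose P := (key_ j).2.
have PE : P = ((\sum_(i < d) tnth a i ^ 2) %/ M ^ 2)%N.
  by rewrite /P -keyE /= big_tuple.
have M2 : 0 < (M ^ 2)%:R :> R by rewrite ltr0n expn_gt0 M0.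
have lo : P%:R <= normE xi ^+ 2.
  rewrite normE2; apply: (@le_trans _ _ (\sum_(i < d) ((tnth a i)%:R / M%:R) ^+ 2)).
    under eq_bigr do rewrite expr_div_n -!natrX.
    by rewrite -mulr_suml ler_pdivlMr// -natr_sum -natrM ler_nat PE leq_divM.
  apply: ler_sum => i _; have /andP[h _] := grid_coord i xa.
  by rewrite lerXn2r// nnegrE ?divr_ge0// (le_trans _ h)// divr_ge0.
have hi : normE xi ^+ 2 <= P%:R + 2.
  rewrite normE2; apply: (@le_trans _ _ (\sum_(i < d) ((tnth a i).+1%:R / M%:R) ^+ 2)).
    apply: ler_sum => i _; have /andP[h1 h2] := grid_coord i xa.
    rewrite lerXn2r ?nnegrE ?divr_ge0//; last exact: ltW.
    by rewrite (le_trans _ h1)// divr_ge0.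
  under eq_bigr do rewrite expr_div_n -!natrX.
  rewrite -mulr_suml ler_pdivrMr// -natr_sum -[2]/(2%:R) -natrD -natrM ler_nat.
  have kN : (k < N)%N by exact: (key_scale_lt d0 M0).
  apply: (@leq_trans (\sum_(i < d) (tnth a i ^ 2 + 2 * (M * 2 ^ N)))%N).
    apply: leq_sum => i _; have /andP[_ h] := ak i.
    have h' : (tnth a i < M * 2 ^ N)%N.
      by apply: leq_trans h _; rewrite leq_pmul2l// leq_exp2l.
    exact: succ_sqr_le.
  rewrite big_split/= sum_nat_const card_ord.
  have -> : (d * (2 * (M * 2 ^ N)) = M ^ 2)%N by rewrite /M -mulnn; ring.
  by rewrite addn2 mulSn addnC leq_add2l ltnW// -ltn_divLR ?expn_gt0 ?M0// PE.
rewrite /class_phase -/P.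
have -> : dotE x xi - t * normE xi ^+ 2 -
   (\sum_(i < d) tnth x i * (nth 0%N (key_ j).1 i)%:R - t * (P%:R + 1)) =
   (dotE x xi - \sum_(i < d) tnth x i * (nth 0%N (key_ j).1 i)%:R) -
   t * (normE xi ^+ 2 - (P%:R + 1)) by ring.
have th : t <= 2^-1.
  apply: le_trans te _; rewrite lef_pV2 ?posrE ?mulr_gt0//; lra.
move: hlin lo hi; set u := _ - \sum_(i < d) _; set v := _ ^+ 2; set q := P%:R.
move=> /andP[u0 u1] lo hi; rewrite ler_norml; apply/andP; split; nra.
Qed.

End class_geometry.

(** * Failure of the estimate for orthonormal systems *)

Section class_sums.
Context {R : realType} (d M N : nat).
Hypotheses (d0 : (0 < d)%N) (M0 : (0 < M)%N).
Variable v : nat -> R.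
Local Notation scale j := (key_scale (nth ([::], 0%N) (keys d M N) j)).

(** The lower bound for a class is proportional to its size, so only the number of cells at each
    scale matters, however unevenly the classes share them. *)
Lemma sum_cell_classes :
  \sum_(0 <= j < size (keys d M N)) v (scale j) * (size (cell_class d M N j))%:R =
    \sum_(a <- cells d M N) v (key_scale (cell_key M a)).
Proof.
transitivity (\sum_(c <- keys d M N) \sum_(a <- cells d M N | cell_key M a == c)
    v (key_scale (cell_key M a))).
  rewrite (big_nth ([::], 0%N)) !big_nat; apply: eq_bigr => j /andP[_ jJ].
  rewrite /cell_class jJ -big_filter.
  rewrite (eq_big_seq (fun=> v (scale j))); last first.
    by move=> a; rewrite mem_filter => /andP[/eqP ->].
  by rewrite big_const_seq count_predT iter_addr_0 mulr_natr.
under eq_bigr do rewrite big_mkcond.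
rewrite exchange_big/=; apply: eq_big_seq => a ac.
rewrite -big_mkcond -big_filter (eq_filter (a2 := pred1 (cell_key M a))); last first.
  by move=> c; rewrite /= eq_sym.
rewrite filter_pred1_uniq ?big_seq1 ?undup_uniq//.
by rewrite mem_undup map_f.
Qed.

Lemma sum_cells_ge : (forall k, 0 <= v k) ->
  \sum_(0 <= k < N) v k * ((M * 2 ^ k) ^ d)%:R <=
    \sum_(a <- cells d M N) v (key_scale (cell_key M a)).
Proof.
move=> v0.
have -> : \sum_(a <- cells d M N) v (key_scale (cell_key M a)) =
    \sum_(0 <= k < N) \sum_(a <- cells d M N | key_scale (cell_key M a) == k) v k.
  under [RHS]eq_bigr do rewrite big_mkcond.
  rewrite exchange_big/=; apply: eq_big_seq => a /mem_cells[k kN ak].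
  rewrite (key_scale_layer d0 M0 ak) -big_mkcond -big_filter.
  rewrite (eq_filter (a2 := pred1 k)); last by move=> l; rewrite /= eq_sym.
  by rewrite filter_pred1_uniq ?big_seq1// ?iota_uniq// mem_index_iota.
rewrite !big_nat; apply: ler_sum => k /andP[_ kN].
rewrite -big_filter big_const_seq count_predT iter_addr_0 -[leRHS]mulr_natr.
apply: ler_wpM2l => //; rewrite ler_nat.
have <- : size (layer_cells d M k) = ((M * 2 ^ k) ^ d)%N.
  by rewrite size_tuples_over size_iota.
apply: uniq_leq_size; first by rewrite uniq_tuples_over// iota_uniq.
move=> a ak; rewrite mem_filter (key_scale_layer d0 M0 ak) eqxx.
by apply/mem_cells; exists k.
Qed.

End class_sums.

(** Weight times multiplier times volume of the dyadic cube. This is where the position of (1/q,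
    1/p) on the segment enters, through [scaling]. *)
Lemma dyadic_scaling (R : realType) (d k : nat) (alpha s : R) :
  d.+1%:R * alpha = d%:R - 2 * s ->
  ((2 ^+ d.+1) ^+ k) `^ (- alpha) * (2 ^+ k) `^ (- (2 * s)) * (2 ^+ k) ^+ d = 1 :> R.
Proof.
move=> scaling.
have p2 : 0 < 2 ^+ k :> R by rewrite exprn_gt0.
have p2n (b : bool) : b ==> (2 ^+ k != 0 :> R) by rewrite (gt_eqF p2) implybT.
have -> : (2 ^+ d.+1) ^+ k = (2 ^+ k) `^ d.+1%:R :> R.
  by rewrite powR_mulrn ?(ltW p2)// exprAC.
rewrite -(powR_mulrn d (ltW p2)) -powRrM -(powRD (p2n _)) -(powRD (p2n _)).
by rewrite mulrN scaling opprB addrAC subrK subrr powRr0.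
Qed.

Section orthonormal_failure.
Context {R : realType} (d : nat).
Hypothesis d0 : (0 < d)%N.
Variables (p q r : \bar R) (s : R).
Hypotheses (alpha0 : 0 <= fine p^-1) (s0 : 0 <= s).
Hypothesis scaling : d.+1%:R * fine p^-1 = d%:R - 2 * s.
Hypotheses (r1 : (1 < r)%E) (pr : fine p^-1 = 0 -> r = +oo%E).
Let alpha := fine p^-1.
Let B : R := 2 ^+ d.+1.

Let B1 : 1 < B. Proof. by rewrite exprn_egt1// ltr1n. Qed.

Section fixed_scale.
Variable N : nat.
Hypothesis N0 : (0 < N)%N.
Let M := (2 * d * 2 ^ N)%N.
Let M0 : (0 < M)%N. Proof. by rewrite !muln_gt0 d0 expn_gt0. Qed.
Local Notation ks := (keys d M N).
Local Notation scale j := (key_scale (nth ([::], 0%N) ks j)).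

Definition class_weight (j : nat) : R :=
  if (j < size ks)%N then (B ^+ scale j) `^ (- alpha) else 0.

Lemma class_weight_ge0 j : 0 <= class_weight j.
Proof. by rewrite /class_weight; case: ifP => // _; exact: powR_ge0. Qed.

(** A weight exceeds B^(-k alpha) only at scales below k, and those classes are counted by
    [count_keys_below]. *)
Lemma class_weight_distribution : distribution_bound counting alpha B (4 * d)%:R N
  (fun j => (normc (class_weight j)%:C)%:E).
Proof.
have Bk k : 0 < B ^+ k by rewrite exprn_gt0// (lt_trans _ B1).
have BE k : (4 * d)%:R * B ^+ k = (4 * d * (2 ^ d.+1) ^ k)%:R.
  by rewrite [RHS]natrM !natrX.
have count_le k (P : nat -> Prop) :
    (forall j, P j -> (j < size ks)%N /\ (scale j < k)%N) ->
    (counting [set j | P j] <= ((4 * d)%:R * B ^+ k)%:E)%E.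
  move=> hP; pose l := [seq j <- iota 0 (size ks) | (scale j < k)%N].
  apply: (@le_trans _ _ (size l)%:R%:E).
    apply: counting_le => j /hP[jJ jk].
    by rewrite mem_filter jk mem_iota.
  rewrite lee_fin BE ler_nat size_filter.
  apply: leq_trans (count_keys_below N d0 M0 k).
  by rewrite -[X in (_ <= count _ X)%N](mkseq_nth ([::], 0%N)) /mkseq count_map.
split.
- move=> j; rewrite lee_fin normc_real ger0_norm ?class_weight_ge0//.
  rewrite /class_weight; case: ifP => // _; rewrite powRN invf_le1 ?powR_gt0//.
  apply: (@le_trans _ _ (1 `^ alpha)); first by rewrite powR1.
  by apply: ge0_ler_powR; rewrite // ?nnegrE ?(ltW (Bk _))// exprn_ege1// ltW.
- move=> k kN; apply: (count_le k) => j.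
  rewrite lte_fin normc_real ger0_norm ?class_weight_ge0//.
  rewrite /class_weight; case: ifP => [jJ|_]; last by rewrite ltNge powR_ge0.
  move=> h; split => //; rewrite ltnNge; apply/negP => kj; move: h.
  apply/negP; rewrite -leNgt !powRN lef_pV2 ?posrE ?powR_gt0//.
  apply: ge0_ler_powR; rewrite // ?nnegrE ?(ltW (Bk _))//.
  by rewrite ler_eXn2l.
- apply: (count_le N) => j; rewrite lte_fin normc_real ger0_norm ?class_weight_ge0//.
  rewrite /class_weight; case: ifP => [jJ|_]; last by rewrite ltxx.
  by split => //; exact: key_scale_lt.
Qed.

Lemma orthonormal_class_waves :
  orthonormalHs s (fun j => sobolev_wave M s (cell_class d M N j) : euclid R d -> R[i]).
Proof.
exists (fun j => grid_wave M (cell_class d M N j)).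
  apply: orthonormal_grid_wave => //.
  - by move=> j; exact: uniq_cell_class.
  - by move=> j; exact: cell_class_neq0.
  - by move=> j k a; exact: cell_class_disjoint.
move=> j; apply: is_fractional_grid_wave => // a.
exact: cell_class_gt0.
Qed.

Lemma sum_class_waves_ge (t : R) (x : euclid R d) : 0 <= t <= (2 * d%:R)^-1 ->
  (forall i, 0 <= tnth x i <= (2 * d%:R)^-1) ->
  ((4^-1 * (2 * d%:R) `^ (- (2 * s)) / (2 * versine_mass) ^+ d * N%:R)%:E <=
   abs_integral counting (fun j => (class_weight j)%:C *
     (normc (evolved_wave M s (cell_class d M N j) t x) ^+ 2)%:C)%R)%E.
Proof.
move=> ht hx; apply: abs_integral_ge.
pose w j := class_weight j * normc (evolved_wave M s (cell_class d M N j) t x) ^+ 2.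
have w0 j : 0 <= w j by rewrite mulr_ge0 ?class_weight_ge0 ?sqr_ge0.
have wE j : complex.Re ((class_weight j)%:C *
    (normc (evolved_wave M s (cell_class d M N j) t x) ^+ 2)%:C) = w j.
  by rewrite -rmorphM.
under eq_integral do rewrite wE.
rewrite ge0_integral_count; last by move=> j; rewrite lee_fin.
apply: (@le_trans _ _ (\sum_(0 <= j < size ks) (w j)%:E)%E); last first.
  by apply: nneseries_lim_ge => j _ _; rewrite lee_fin.
rewrite sumEFin lee_fin.
have d1 : 0 < 2 * d%:R :> R by rewrite mulr_gt0// ltr0n.
have J0 := @versine_mass_gt0 R.
have K0 : 0 < (2 * versine_mass : R) ^+ d by rewrite exprn_gt0// mulr_gt0.
have Mr : 0 < M%:R :> R by rewrite ltr0n.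
pose v k : R := (B ^+ k) `^ (- alpha) * (4^-1 * ((2 * d%:R * 2 ^+ k) `^ (- s)) ^+ 2
  * M%:R^-1 ^+ d / (2 * versine_mass) ^+ d).
have v0 k : 0 <= v k.
  apply: mulr_ge0; first exact: powR_ge0.
  apply: divr_ge0; last exact: ltW.
  by rewrite !mulr_ge0 ?sqr_ge0// exprn_ge0// invr_ge0.
apply: (@le_trans _ _ (\sum_(0 <= j < size ks) v (scale j) * (size (cell_class d M N j))%:R));
  last first.
  rewrite !big_nat; apply: ler_sum => j /andP[_ jJ].
  rewrite /w /class_weight jJ /v -mulrA; apply: ler_wpM2l; first exact: powR_ge0.
  set L := 2 * d%:R * 2 ^+ scale j.
  have L0 : 0 < L by rewrite mulr_gt0// exprn_gt0.
  have S0 : (0 < size (cell_class d M N j))%N by rewrite lt0n size_eq0 cell_class_neq0.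
  have hL (a : d.-tuple nat) (xi : euclid R d) : a \in cell_class d M N j ->
      grid_cell M a xi -> normE xi <= L.
    by move=> aj xa; exact: class_normE_le jJ aj xa.
  have hph (a : d.-tuple nat) (xi : euclid R d) : a \in cell_class d M N j ->
      grid_cell M a xi ->
      `|dotE x xi - t * normE xi ^+ 2 - class_phase N j t x| <= 1.
    by move=> aj xa; exact: class_phase_le jJ aj xa _ _ ht hx.
  apply: le_trans (evolved_wave_ge M0 s0 (@cell_class_gt0 d M N d0 M0 j) S0 L0 hL hph).
  by rewrite le_eqVlt; apply/orP; left; apply/eqP; ring.
rewrite sum_cell_classes; apply: le_trans (sum_cells_ge N d0 M0 v0).
(* The M^d 2^(k d) cells of a scale have volume M^(-d) each: the fineness cancels, and every scale
   contributes the same constant. *)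
suff vk k : v k * ((M * 2 ^ k) ^ d)%:R =
    4^-1 * (2 * d%:R) `^ (- (2 * s)) / (2 * versine_mass) ^+ d.
  under eq_bigr do rewrite vk.
  by rewrite sumr_const_nat subn0 mulr_natr.
rewrite /v.
have -> : ((M * 2 ^ k) ^ d)%:R = M%:R ^+ d * (2 ^+ k) ^+ d :> R.
  by rewrite natrX (natrM R M (2 ^ k)) (natrX R 2 k) exprMn.
have p2 : 0 < 2 ^+ k :> R by rewrite exprn_gt0.
have -> : ((2 * d%:R * 2 ^+ k) `^ (- s)) ^+ 2 =
    (2 * d%:R) `^ (- (2 * s)) * (2 ^+ k) `^ (- (2 * s)) :> R.
  rewrite -powRM ?(ltW d1) ?(ltW p2)// -powR_mulrn ?powR_ge0// -powRrM.
  by congr (_ `^ _); ring.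
have e1 := dyadic_scaling k scaling; rewrite -/alpha -/B in e1.
transitivity (4^-1 * (2 * d%:R) `^ (- (2 * s)) / (2 * versine_mass) ^+ d *
  ((B ^+ k) `^ (- alpha) * (2 ^+ k) `^ (- (2 * s)) * (2 ^+ k) ^+ d) *
  (M%:R^-1 ^+ d * M%:R ^+ d)); first by ring.
by rewrite e1 mulr1 exprVn mulVf ?mulr1// expf_neq0// gt_eqF.
Qed.

End fixed_scale.

Lemma orthonormal_estimate_fails : ~ (exists C : R, orthonormal_estimate d p q r s C).
Proof.
move=> [C hC].
have C01 : 1 <= (4 * d)%:R :> R by rewrite ler1n muln_gt0 d0.
have M0 N : (0 < 2 * d * 2 ^ N)%N by rewrite !muln_gt0 d0 expn_gt0.
have [K K0 hK] := @seq_lorentz_growth R p r B _ alpha0 B1 C01 r1 pr.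
have k01 := fine_inv_lt1 r1; set kappa := fine r^-1 in k01 hK.
pose e : R := (2 * d%:R)^-1.
have e0 : 0 < e by rewrite invr_gt0 mulr_gt0// ltr0n.
pose c := 4^-1 * (2 * d%:R) `^ (- (2 * s)) / (2 * @versine_mass R) ^+ d.
have c0 : 0 < c.
  apply: divr_gt0; last by rewrite exprn_gt0// mulr_gt0// versine_mass_gt0.
  apply: mulr_gt0; first by rewrite invr_gt0.
  by apply: powR_gt0; rewrite mulr_gt0// ltr0n.
pose a := (e / 2) `^ fine p^-1 * ((e ^+ d / 2) `^ fine q^-1 * c).
have a0 : 0 < a.
  apply: mulr_gt0; first by apply: powR_gt0; rewrite divr_gt0.
  apply: mulr_gt0 => //; apply: powR_gt0.
  by rewrite divr_gt0// exprn_gt0.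
(* The assumed constant may be negative, hence its absolute value. Neither it nor [K] depends on
   [N]. *)
apply: (@linear_not_le_power R a (`|C| * K) kappa a0 k01) => N N0.
have lorN := hK _ N N0 (class_weight_distribution N).
have lfin : (seq_lorentz p r (fun j => (class_weight N j)%:C) < +oo)%E.
  by apply: le_lt_trans lorN _; rewrite ltry.
have est := hC _ (fun j => (class_weight N j)%:C)
  (fun j t => evolved_wave (2 * d * 2 ^ N) s (cell_class d (2 * d * 2 ^ N) N j) t)
  (@orthonormal_class_waves N) _ lfin.
have {est} est := est (fun j t => is_schrodinger_evolved_wave (M0 N) s0
  (@cell_class_gt0 d _ N d0 (M0 N) j) t).
have low := @mixed_weak_norm_ge R d p q _ e (c * N%:R) e0
  (fun t x ht hx => sum_class_waves_ge N ht hx).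
rewrite -lee_fin.
apply: (@le_trans _ _ (mixed_weak_norm p q (fun t x => abs_integral counting
  (fun j => (class_weight N j)%:C *
     (normc (evolved_wave (2 * d * 2 ^ N) s (cell_class d (2 * d * 2 ^ N) N j) t x) ^+ 2)%:C)))).
  by apply: le_trans low; rewrite lee_fin /a !mulrA.
apply: le_trans est _.
apply: (@le_trans _ _ (`|C|%:E * seq_lorentz p r (fun j => (class_weight N j)%:C))%E).
  by apply: lee_wpmul2r; [exact: seq_lorentz_ge0|rewrite lee_fin ler_norm].
by rewrite -mulrA EFinM; apply: lee_wpmul2l; rewrite ?lee_fin.
Qed.

End orthonormal_failure.

(** * Failure of the velocity estimate *)

(** [product_measure1] integrates the sections at fixed first variable; a tube is simple only at
    fixed velocity, the second one. *)
Lemma product_measure_ysection (R : realType) (d1 d2 : measure_display)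
    (T1 : measurableType d1) (T2 : measurableType d2)
    (m1 : {sigma_finite_measure set T1 -> \bar R})
    (m2 : {sigma_finite_measure set T2 -> \bar R}) (A : set (T1 * T2)) :
  measurable A -> (m1 \x m2)%E A = (\int[m2]_y m1 (ysection A y))%E.
Proof.
move=> mA; transitivity (\int[m1 \x m2]_z (\1_A z)%:E)%E.
  by rewrite integral_indic// setIT.
by rewrite indic_fubini_tonelli1// indic_fubini_tonelli// indic_fubini_tonelli_GE.
Qed.

Section velocity_failure.
Context {R : realType} (d : nat).
Hypothesis d0 : (0 < d)%N.
Local Notation E := (euclid R d).
Local Notation leb := (@lebesgueE R d).
Let B : R := 2 ^+ d.+1.

Definition dyadic_box (k : nat) : set E := boxE d (fun=> `[2 ^+ k, 2 ^+ k.+1[%classic).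

(* The points reached at the times l / 2^k by free transport of the unit cube
   with velocities in dyadic_box k, thickened so as to cover all times in [0, 1]. *)
Definition tube (k l : nat) : set (E * E) :=
  [set z | dyadic_box k z.2 /\
    boxE d (fun=> `[-3, 3]%classic) (transport z.1 z.2 (- (l%:R / 2 ^+ k)))].

Definition tubes (k : nat) : set (E * E) := \big[setU/set0]_(l < (2 ^ k).+1) tube k l.

Lemma measurable_dyadic_box k : measurable (dyadic_box k).
Proof. exact: measurable_boxE. Qed.

Lemma lebesgueE_dyadic_box k : leb (dyadic_box k) = ((2 ^+ k) ^+ d)%:E.
Proof.
apply: (@lebesgueE_cube _ d (fun=> 2 ^+ k) (fun=> 2 ^+ k.+1)); last exact: exprn_ge0.
by move=> i; rewrite exprS mulr_natl mulr2n addrK.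
Qed.

Lemma dyadic_box_disjoint k l (v : E) : dyadic_box k v -> dyadic_box l v -> k = l.
Proof.
suff le (m n : nat) : dyadic_box m v -> dyadic_box n v -> (m <= n)%N.
  by move=> kv lv; apply/eqP; rewrite eqn_leq !le.
move=> /(_ (Ordinal d0))/=; rewrite in_itv/= => /andP[h _].
move=> /(_ (Ordinal d0))/=; rewrite in_itv/= => /andP[_ h'].
rewrite -ltnS -(@ltr_eXn2l R 2) ?ltr1n//.
exact: le_lt_trans h h'.
Qed.

Lemma measurable_transport t : measurable_fun setT (fun z : E * E => transport z.1 z.2 t).
Proof.
apply/measurable_fun_tnthP => i; rewrite (_ : _ \o _ = fun z => tnth z.1 i - t * tnth z.2 i).
  apply: measurable_funB.
    exact: (measurableT_comp (measurable_coord i) (@measurable_fst _ _ E E)).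
  apply: measurable_funM => //.
  exact: (measurableT_comp (measurable_coord i) (@measurable_snd _ _ E E)).
by apply/funext => z; rewrite /transport /= tnth_mktuple.
Qed.

Lemma measurable_tube k l : measurable (tube k l).
Proof.
rewrite (_ : tube k l = snd @^-1` dyadic_box k `&`
  (fun z : E * E => transport z.1 z.2 (- (l%:R / 2 ^+ k))) @^-1` boxE d (fun=> `[-3, 3]%classic))//.
apply: measurableI; rewrite -[X in measurable X]setTI.
  by apply: measurable_snd => //; exact: measurable_dyadic_box.
apply: measurable_transport => //; exact: measurable_boxE.
Qed.

Lemma measurable_tubes k : measurable (tubes k).
Proof. by apply: bigsetU_measurable => l _; exact: measurable_tube. Qed.

Lemma measure_tube k l : ((leb \x leb) (tube k l) = (6 ^+ d * (2 ^+ k) ^+ d)%:E)%E.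
Proof.
rewrite product_measure_ysection; last exact: measurable_tube.
transitivity (\int[leb]_y ((6 ^+ d)%:E * (\1_(dyadic_box k) y)%:E))%E.
  apply: eq_integral => y _; rewrite indicE.
  have [yk|yk] := boolP (y \in dyadic_box k).
    (* At fixed velocity y the section of the tube is the cube [-3, 3]^d translated by - c y, of
       measure 6^d. *)
    rewrite mule1; pose c : R := l%:R / 2 ^+ k.
    rewrite -(@lebesgueE_cube R d (fun i => -3 - c * nth 0 y i)
      (fun i => 3 - c * nth 0 y i) 6 _ _ true false)//; last by move=> i; ring.
    congr (leb _); apply/seteqP; split => x; rewrite /ysection/= inE.
      move=> [_ h] i; have := h i; rewrite /= tnth_mktuple -/c !in_itv/= (tnth_nth 0 y).
      by move=> ?; lra.
    move=> h; split => [|i]; first exact: set_mem.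
    have := h i; rewrite /= tnth_mktuple -/c !in_itv/= (tnth_nth 0 y).
    by move=> ?; lra.
  rewrite mule0 (_ : ysection _ _ = set0) ?measure0//.
  apply/seteqP; split => // x; rewrite /ysection/= inE => -[yk' _].
  by move: yk; rewrite (mem_set yk').
rewrite ge0_integralZl//.
- rewrite integral_indic//; last exact: measurable_dyadic_box.
  by rewrite setIT EFinM; congr (_ * _)%E; exact: lebesgueE_dyadic_box.
- by apply/measurable_EFinP; apply: measurable_indic; exact: measurable_dyadic_box.
Qed.

(** Subadditivity over the 2^k + 1 <= 2 2^k time steps: these supply the extra power of 2^k beyond
    the volume of the velocity box. *)
Lemma measure_tubes_le k :
  ((leb \x leb) (tubes k) <= (2 * 6 ^+ d * B ^+ k)%:E)%E.
Proof.
apply: (@le_trans _ _ (\sum_(l < (2 ^ k).+1) (leb \x leb) (tube k l)))%E.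
  apply: (@content_subadditive _ _ _ (leb \x leb)%E _ (tube k) (2 ^ k).+1) => //.
  - by move=> l _; exact: measurable_tube.
  - exact: measurable_tubes.
under eq_bigr do rewrite measure_tube.
rewrite sumEFin lee_fin sumr_const card_ord -[leLHS]mulr_natl.
have -> : B ^+ k = 2 ^+ k * (2 ^+ k) ^+ d by rewrite /B exprAC exprS.
rewrite [leRHS](_ : _ = (2 * 2 ^+ k) * (6 ^+ d * (2 ^+ k) ^+ d)); last by ring.
apply: ler_wpM2r; first by rewrite mulr_ge0// !exprn_ge0.
by rewrite -natrX -natrM ler_nat mul2n -addnn -addn1 leq_add2l expn_gt0.
Qed.

Lemma measure_union_tubes_le k :
  ((leb \x leb) (\big[setU/set0]_(j < k) tubes j) <= (2 * 6 ^+ d * B ^+ k)%:E)%E.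
Proof.
apply: (@le_trans _ _ (\sum_(j < k) (leb \x leb) (tubes j)))%E.
  apply: (@content_subadditive _ _ _ (leb \x leb)%E _ tubes k) => //.
  - by move=> j _; exact: measurable_tubes.
  - by apply: bigsetU_measurable => j _; exact: measurable_tubes.
have geom : \sum_(j < k) B ^+ j <= B ^+ k.
  elim: k => [|k IH]; first by rewrite big_ord0 expr0.
  rewrite big_ord_recr/= exprS; apply: (@le_trans _ _ (2 * B ^+ k)).
    by rewrite mulr_natl mulr2n lerD2r.
  apply: ler_wpM2r; first by rewrite !exprn_ge0.
  by rewrite /B exprS ler_peMr// exprn_ege1// ler1n.
apply: (@le_trans _ _ (\sum_(j < k) (2 * 6 ^+ d * B ^+ j)%:E)%E).
  by apply: lee_sum => j _; exact: measure_tubes_le.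
rewrite sumEFin lee_fin -mulr_sumr; apply: ler_wpM2l geom.
by rewrite mulr_ge0// exprn_ge0.
Qed.

Lemma tubes_transport k (x v : E) (t : R) : 0 <= t <= 1 ->
  (forall i, 0 <= tnth x i <= 1) -> dyadic_box k v -> tubes k (transport x v t, v).
Proof.
move=> /andP[t0 t1] hx kv.
have p2 : 0 < 2 ^+ k :> R by rewrite exprn_gt0.
(* The last time step before t. The remaining time is below 2^(-k) and the velocity below 2^(k+1),
   so a coordinate moves by at most 2 and ends in [-2, 1], inside [-3, 3]. *)
pose l := Num.truncn (t * 2 ^+ k).
have /andP[l1 l2] : l%:R <= t * 2 ^+ k < l.+1%:R.
  by rewrite truncn_itv// mulr_ge0// ltW.
have lk : (l < (2 ^ k).+1)%N.
  rewrite ltnS -(ler_nat R) natrX; apply: le_trans l1 _.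
  by rewrite ger_pMl.
rewrite /tubes -bigcup_mkord; exists l => //=; split => // i.
rewrite /= !tnth_mktuple in_itv/=.
have := kv i; rewrite /= in_itv/= => /andP[v1 v2].
have := hx i; move/andP => [x1 x2].
set w := tnth v i in v1 v2 *; set y := tnth x i in x1 x2 *.
have w0 : 0 <= w by apply: le_trans v1; exact: ltW.
rewrite (_ : _ - _ * w = y - (t - l%:R / 2 ^+ k) * w); last by ring.
have tl0 : 0 <= t - l%:R / 2 ^+ k by rewrite subr_ge0 ler_pdivrMr.
have tl1 : (t - l%:R / 2 ^+ k) * 2 ^+ k <= 1.
  by rewrite mulrBl divfK ?gt_eqF//; move: l2; rewrite -natr1 => ?; lra.
have h0 : 0 <= (t - l%:R / 2 ^+ k) * w by exact: mulr_ge0.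
have h2 : (t - l%:R / 2 ^+ k) * w <= 2.
  apply: (@le_trans _ _ ((t - l%:R / 2 ^+ k) * (2 * 2 ^+ k))).
    by apply: ler_wpM2l => //; rewrite -exprS ltW.
  by rewrite mulrCA; lra.
by lra.
Qed.

Lemma tubes_box k z : tubes k z -> dyadic_box k z.2.
Proof. by rewrite /tubes -bigcup_mkord => -[l _ []]. Qed.

Variables (p q r : \bar R) (s : R).
Hypotheses (alpha0 : 0 <= fine p^-1) (s0 : 0 <= s).
Hypothesis scaling : d.+1%:R * fine p^-1 = d%:R - 2 * s.
Hypotheses (r1 : (1 < r)%E) (pr : fine p^-1 = 0 -> r = +oo%E).
Let alpha := fine p^-1.

Let B1 : 1 < B. Proof. by rewrite exprn_egt1// ltr1n. Qed.

Section fixed_scale.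
Variable N : nat.

Definition tube_profile (z : E * E) : R :=
  \sum_(k < N) (B ^+ k) `^ (- alpha) * \1_(tubes k) z.

(** Tubes of different scales are disjoint because their velocities are, so a single term of the sum
    survives. *)
Lemma tube_profileE k z : (k < N)%N -> tubes k z ->
  tube_profile z = (B ^+ k) `^ (- alpha).
Proof.
move=> kN kz; rewrite /tube_profile (bigD1 (Ordinal kN))//= indicE (mem_set kz) mulr1.
rewrite big1 ?addr0// => j jk; rewrite indicE memNset ?mulr0// => jz.
move/eqP: jk; apply; apply: val_inj.
exact: dyadic_box_disjoint (tubes_box jz) (tubes_box kz).
Qed.

Lemma tube_profile_gt0 z : 0 < tube_profile z -> exists2 k, (k < N)%N & tubes k z.
Proof.
move=> z0; apply: contrapT => /forall2NP nz; move: z0.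
rewrite /tube_profile big1 ?ltxx// => k _; rewrite indicE memNset ?mulr0// => kz.
by have [|] := nz k.
Qed.

Lemma tube_profile_ge0 z : 0 <= tube_profile z.
Proof. by apply: sumr_ge0 => k _; rewrite mulr_ge0 ?powR_ge0// indicE. Qed.

Lemma cmeasurable_tube_profile : cmeasurable (fun z => (tube_profile z)%:C).
Proof.
split => //=; apply: measurable_sum => k; apply: measurable_funM => //.
by apply: measurable_indic; exact: measurable_tubes.
Qed.

Lemma tube_profile_distribution : distribution_bound (leb \x leb)%E alpha B (2 * 6 ^+ d) N
  (fun z => (normc (tube_profile z)%:C)%:E).
Proof.
have Bk k : 0 < B ^+ k by rewrite exprn_gt0// (lt_trans _ B1).
have nE z : normc (tube_profile z)%:C = tube_profile z.
  by rewrite normc_real ger0_norm// tube_profile_ge0.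
have union_le k (P : set (E * E)) :
    (forall z, P z -> exists2 j, (j < k)%N & tubes j z) ->
    ((leb \x leb) P <= (2 * 6 ^+ d * B ^+ k)%:E)%E.
  move=> hP; apply: le_trans (measure_union_tubes_le k).
  rewrite /product_measure1; apply: ge0_le_integral_nonmeasurable => // x _.
  apply: le_lebesgueE => y; rewrite /xsection/= !inE => /hP[j jk jz].
  by rewrite -bigcup_mkord; exists j.
split.
- move=> z; rewrite lee_fin nE.
  have := tube_profile_ge0 z; rewrite le_eqVlt => /orP[/eqP <-//|].
  move=> /tube_profile_gt0[k kN kz]; rewrite (tube_profileE kN kz).
  rewrite powRN invf_le1 ?powR_gt0//.
  apply: (@le_trans _ _ (1 `^ alpha)); first by rewrite powR1.
  by apply: ge0_ler_powR; rewrite // ?nnegrE ?(ltW (Bk _))// exprn_ege1// ltW.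
- move=> k kN; apply: union_le => z; rewrite /mkset lte_fin nE => hz.
  have [j jN jz] : exists2 j, (j < N)%N & tubes j z.
    by apply: tube_profile_gt0; apply: le_lt_trans hz; exact: powR_ge0.
  exists j => //; rewrite ltnNge; apply/negP => kj; move: hz.
  rewrite (tube_profileE jN jz); apply/negP; rewrite -leNgt !powRN.
  rewrite lef_pV2 ?posrE ?powR_gt0//.
  apply: ge0_ler_powR; rewrite // ?nnegrE ?(ltW (Bk _))//.
  by rewrite ler_eXn2l.
- by apply: union_le => z; rewrite /mkset lte_fin nE => /tube_profile_gt0.
Qed.

Lemma normE_dyadic_box_le k (v : E) : dyadic_box k v -> normE v <= 2 * d%:R * 2 ^+ k.
Proof.
move=> kv; have d1 : 1 <= d%:R :> R by rewrite ler1n.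
have p2 : 0 < 2 ^+ k :> R by rewrite exprn_gt0.
have L0 : 0 <= 2 * d%:R * 2 ^+ k :> R by rewrite mulr_ge0// ltW.
rewrite /normE -(ger0_norm L0) -sqrtr_sqr; apply: ler_wsqrtr.
apply: (@le_trans _ _ (\sum_(i < d) (2 * 2 ^+ k) ^+ 2)).
  apply: ler_sum => i _; rewrite -expr2.
  have := kv i; rewrite /= in_itv/= exprS => /andP[v1 v2].
  have vi0 : 0 <= tnth v i by apply: le_trans v1; exact: ltW.
  by rewrite lerXn2r ?nnegrE ?(ltW v2)// mulr_ge0// ltW.
rewrite sumr_const card_ord -[leLHS]mulr_natl.
rewrite (_ : (2 * d%:R * 2 ^+ k) ^+ 2 = d%:R * (d%:R * (2 * 2 ^+ k) ^+ 2)); last by ring.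
by apply: ler_wpM2l => //; rewrite ler_peMl// sqr_ge0.
Qed.

(** For fixed t and x each velocity box lies wholly inside the tubes of its scale, and |v|^(-2 s) is
    smallest at the upper bound of |v|. By [dyadic_scaling] each box contributes the same
    constant. *)
Lemma velocity_average_ge (t : R) (x : E) : 0 <= t <= 1 ->
  (forall i, 0 <= tnth x i <= 1) ->
  (((2 * d%:R) `^ (- (2 * s)) * N%:R)%:E <=
   abs_integral leb (fun v => (tube_profile (transport x v t, v))%:C *
     (normE v `^ (- (2 * s)))%:C)%R)%E.
Proof.
move=> ht hx; apply: abs_integral_ge.
pose w k : R := (B ^+ k) `^ (- alpha) * (2 * d%:R * 2 ^+ k) `^ (- (2 * s)).
have w0 k : 0 <= w k by rewrite mulr_ge0// powR_ge0.
have d1 : 0 < 2 * d%:R :> R by rewrite mulr_gt0// ltr0n.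
have mI k : measurable_fun setT (fun v : E => (w k * \1_(dyadic_box k) v)%:E).
  apply/measurable_EFinP; apply: measurable_funM => //.
  by apply: measurable_indic; exact: measurable_dyadic_box.
have I0 k v : (0 <= (w k * \1_(dyadic_box k) v)%:E)%E by rewrite lee_fin mulr_ge0// indicE.
apply: (@le_trans _ _ (\int[leb]_v (\sum_(k < N) (w k * \1_(dyadic_box k) v)%:E))%E).
  rewrite ge0_integral_sum//.
  rewrite (eq_bigr (fun=> ((2 * d%:R) `^ (- (2 * s)))%:E)) => [|k _].
    by rewrite sumEFin sumr_const card_ord mulr_natr.
  under eq_integral do rewrite EFinM.
  rewrite ge0_integralZl ?lee_fin ?w0//; last first.
    by apply/measurable_EFinP; apply: measurable_indic; exact: measurable_dyadic_box.
  rewrite integral_indic//; last exact: measurable_dyadic_box.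
  rewrite setIT; transitivity ((w k)%:E * ((2 ^+ k) ^+ d)%:E)%E.
    by congr (_ * _)%E; exact: lebesgueE_dyadic_box.
  rewrite -EFinM /w (powRM _ (ltW d1) (exprn_ge0 k (ler0n R 2))).
  have := dyadic_scaling k scaling; rewrite -/alpha -/B => e1.
  congr (_%:E); transitivity ((2 * d%:R) `^ (- (2 * s)) *
    ((B ^+ k) `^ (- alpha) * (2 ^+ k) `^ (- (2 * s)) * (2 ^+ k) ^+ d)).
    by rewrite [X in X * _]mulrCA -!mulrA.
  by rewrite e1 mulr1.
apply: ge0_le_integral_nonmeasurable => v _; first by apply: sume_ge0 => k _.
rewrite sumEFin lee_fin -rmorphM/=.
have [[k kv]|nv] := pselect (exists k : 'I_N, dyadic_box k v); last first.
  rewrite big1 => [|k _]; first by rewrite mulr_ge0 ?powR_ge0 ?tube_profile_ge0.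
  by rewrite indicE memNset ?mulr0// => kv; apply: nv; exists k.
rewrite (bigD1 k)//= big1 => [|j jk]; last first.
  rewrite indicE memNset ?mulr0// => jv; move/eqP: jk; apply; apply: val_inj.
  exact: dyadic_box_disjoint jv kv.
rewrite addr0 indicE (mem_set kv) mulr1.
rewrite (tube_profileE (ltn_ord k) (tubes_transport ht hx kv)).
apply: ler_wpM2l; first exact: powR_ge0.
have v0 : 0 < normE v.
  have vi := kv (Ordinal d0); move: vi; rewrite /= in_itv/= => /andP[vi _].
  apply: lt_le_trans (le_coord_normE v (Ordinal d0)).
  by apply: lt_le_trans (ler_norm _); apply: lt_le_trans vi; rewrite exprn_gt0.
have vk := normE_dyadic_box_le kv.
rewrite !powRN lef_pV2 ?posrE ?powR_gt0//; last exact: lt_le_trans v0 vk.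
apply: (ge0_ler_powR _ _ _ vk); first exact: mulr_ge0.
  by rewrite nnegrE ltW.
by rewrite nnegrE; exact: le_trans (ltW v0) vk.
Qed.

End fixed_scale.

Lemma velocity_estimate_fails : ~ (exists C : R, velocity_estimate d p q r s C).
Proof.
move=> [C hC].
have C01 : 1 <= 2 * 6 ^+ d :> R.
  by rewrite -natrX -natrM ler1n muln_gt0 expn_gt0.
have [K K0 hK] := @lorentz_growth R p r B _ alpha0 B1 C01 r1 pr.
have k01 := fine_inv_lt1 r1; set kappa := fine r^-1 in k01 hK.
pose c : R := (2 * d%:R) `^ (- (2 * s)).
have c0 : 0 < c by apply: powR_gt0; rewrite mulr_gt0// ltr0n.
pose a : R := (1 / 2) `^ fine p^-1 * ((1 ^+ d / 2) `^ fine q^-1 * c).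
have a0 : 0 < a.
  apply: mulr_gt0; first by apply: powR_gt0; rewrite divr_gt0.
  by apply: mulr_gt0 => //; apply: powR_gt0; rewrite expr1n divr_gt0.
apply: (@linear_not_le_power R a (`|C| * K) kappa a0 k01) => N N0.
have lorN := hK _ _ _ _ N N0 (tube_profile_distribution N).
have lfin : (lorentz (leb \x leb) p r (fun z => (normc (tube_profile N z)%:C)%:E) < +oo)%E.
  by apply: le_lt_trans lorN _; rewrite ltry.
have est := hC _ (cmeasurable_tube_profile N) lfin.
have low := @mixed_weak_norm_ge R d p q _ 1 (c * N%:R) ltr01
  (fun t x ht hx => velocity_average_ge N ht hx).
rewrite -lee_fin.
apply: (@le_trans _ _ (mixed_weak_norm p q (fun t x => abs_integral leb
  (fun v => (tube_profile N (transport x v t, v))%:C * (normE v `^ (- (2 * s)))%:C)%R))).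
  by apply: le_trans low; rewrite lee_fin /a !mulrA.
apply: le_trans est _.
apply: (@le_trans _ _ (`|C|%:E * lorentz (leb \x leb) p r
    (fun z => (normc (tube_profile N z)%:C)%:E))%E).
  by apply: lee_wpmul2r; [exact: lorentz_ge0|rewrite lee_fin ler_norm].
by rewrite -mulrA EFinM; apply: lee_wpmul2l; rewrite ?lee_fin.
Qed.

End velocity_failure.

Theorem proposition5p2 (R : realType) (d : nat) (hd : (3 <= d)%N)
    (p q : \bar R) (hp : (1 <= p)%E) (hq : (1 <= q)%E)
    (hpq : segment (0, 0) ((d%:R - 1) / (d%:R + 1), d%:R / (d%:R + 1))
             (fine q^-1, fine p^-1))
    (s : R) (hs : 2 * s = d%:R - (2 * fine p^-1 + d%:R * fine q^-1))
    (r : \bar R) (hr : (1 < r)%E) (hpr : p = +oo%E -> r = +oo%E) :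
  ~ (exists C : R, velocity_estimate d p q r s C) /\
  ~ (exists C : R, orthonormal_estimate d p q r s C).
Proof.
have d0 : (0 < d)%N by lia.
have D0 : 0 <= d%:R :> R by [].
case: hpq => theta /=; rewrite in_itv/= => /andP[theta0 theta1] [].
rewrite !scaler0 !add0r => qE pE.
have {}qE : fine q^-1 = theta * ((d%:R - 1) / (d%:R + 1)) by rewrite -qE.
have {}pE : fine p^-1 = theta * (d%:R / (d%:R + 1)) by rewrite -pE.
have D1 : d%:R + 1 != 0 :> R by rewrite gt_eqF// ltr_wpDl.
have alpha0 : 0 <= fine p^-1 by rewrite pE mulr_ge0// divr_ge0// addr_ge0.
(* At the parameter theta of the segment, 2/p + d/q = theta (2 d + d (d - 1)) / (d + 1) = theta
   d. *)
have sE : 2 * s = d%:R * (1 - theta) by rewrite hs qE pE; field.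
have s0 : 0 <= s.
  have : 0 <= d%:R * (1 - theta) by rewrite mulr_ge0// subr_ge0.
  by rewrite -sE; lra.
have scaling : d.+1%:R * fine p^-1 = d%:R - 2 * s.
  by rewrite sE pE -natr1; field.
(* A finite p >= 1 has a positive inverse, so 1/p = 0 happens only for p = +oo, where r = +oo is
   assumed. *)
have pr : fine p^-1 = 0 -> r = +oo%E.
  move: p hp hpr {pE hs alpha0 scaling} => [p'| |]// p1 pr; last by move=> _; exact: pr.
  rewrite lee_fin in p1; have p0 : 0 < p' by exact: lt_le_trans p1.
  by rewrite inver gt_eqF//= => /eqP; rewrite invr_eq0 gt_eqF.
split; first exact: velocity_estimate_fails.
exact: orthonormal_estimate_fails.
Qed.
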